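(* Let $d\ge 1$ be an integer, $D=d(d+1)/2$, and let $r_d$ be as defined in the context. Let $q$ be squarefree and $\chi$ a primitive Dirichlet character modulo $q$. Let $M,N,r$ be integers such that $r\ge r_d$ and $N\le q^{1/2+1/(4(r-D/2))}$. Then for any polynomial $F(x)$ of degree $d$ with real coefficients, $$\left|\sum_{M<n\le M+N}\chi(n)e^{2\pi i F(n)}\right|\le N^{1-1/r}\,q^{\frac{1}{4r}+\frac{D}{8r(r-D/2)}+\frac{1}{4r(r-D/2)}+o(1)}.$$
   Context: For integers $r,d,V\ge 1$, $J_{r,d}(V)$ denotes the number of integer solutions $(v_1,\dots,v_{2r})$ of the system $v_1^{i}+\dots+v_r^{i}=v_{r+1}^{i}+\dots+v_{2r}^{i}$ for $1\le i\le d$, with $1\le v_j\le V$. $r_d$ denotes the smallest integer such that for every integer $r\ge r_d$ one has $J_{r,d}(V)\le V^{2r-d(d+1)/2+o(1)}$ as $V\to\infty$. The factor $q^{o(1)}$ denotes a quantity bounded by $C(\varepsilon)q^{\varepsilon}$ for every $\varepsilon>0$, where $C(\varepsilon)$ depends only on $\varepsilon$ and the fixed parameters ($d,r$). *)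

(* Defs.v *)
From HB Require Import structures.
From mathcomp Require Import all_boot all_order all_algebra.
From mathcomp Require Import all_classical all_reals all_analysis.
From mathcomp Require Import complex.
Set Implicit Arguments. Unset Strict Implicit. Unset Printing Implicit Defensive.
Import Order.TTheory GRing.Theory Num.Theory.
Local Open Scope ring_scope.

(* J_{r,d}(V): number of (v_1..v_{2r}) with 1 <= v_j <= V and
   sum_{j<=r} v_j^i = sum_{j>r} v_j^i for 1 <= i <= d.
   A tuple is encoded as v : 'I_(r+r) -> 'I_V, with v_j = (v j).+1. *)
Definition J (r d V : nat) : nat :=
  #|[set v : {ffun 'I_(r + r) -> 'I_V} |
     [forall i : 'I_d,
        (\sum_(j < r) (v (lshift r j)).+1 ^ i.+1 ==
         \sum_(j < r) (v (rshift r j)).+1 ^ i.+1)%N]]|.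

Definition Dr (R : realType) (d : nat) : R := (d * d.+1)%:R / 2.

(* "for every r >= r0 (r >= 1): J_{r,d}(V) <= V^{2r - D + o(1)} as V -> oo",
   with o(1) meaning: for every eps > 0 there is C(eps) with
   J_{r,d}(V) <= C(eps) V^{2r-D+eps} for all V >= 1. *)
Definition vmvt_from (R : realType) (d r0 : nat) : Prop :=
  forall r : nat, (1 <= r)%N -> (r0 <= r)%N ->
  forall eps : R, 0 < eps -> exists C : R, forall V : nat, (1 <= V)%N ->
    (J r d V)%:R <= C * (V%:R `^ ((2 * r)%:R - Dr R d + eps)).

Definition is_rd (R : realType) (d rd : nat) : Prop :=
  [/\ (1 <= rd)%N, vmvt_from R d rd &
      forall r0 : nat, (1 <= r0)%N -> vmvt_from R d r0 -> (rd <= r0)%N].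

Definition squarefree (q : nat) : Prop :=
  (0 < q)%N /\ forall p : nat, prime p -> ~~ (p * p %| q)%N.

Definition dirichlet_character (R : realType) (q : nat) (chi : int -> R[i]) : Prop :=
  [/\ (0 < q)%N, chi 1 = 1,
      forall m n : int, chi (m * n) = chi m * chi n,
      forall n : int, chi (n + q%:Z) = chi n &
      forall n : int, chi n = 0 <-> ~~ coprimez n q%:Z].

(* primitive: chi is not induced by a character of smaller modulus, i.e. there
   is no proper divisor d of q such that chi(m) = chi(n) whenever m = n (mod d)
   and m, n are coprime to q. *)
Definition primitive_character (R : realType) (q : nat) (chi : int -> R[i]) : Prop :=
  dirichlet_character q chi /\
  ~ (exists d : nat, [/\ (d %| q)%N, (d < q)%N &
       forall m n : int, coprimez m q%:Z -> coprimez n q%:Z ->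
         (m == n %[mod d%:Z])%Z -> chi m = chi n]).

Definition ee (R : realType) (x : R) : R[i] :=
  (cos (2 * pi * x) +i* sin (2 * pi * x))%C.

Definition char_exp_sum (R : realType) (chi : int -> R[i]) (F : {poly R})
    (M : int) (N : nat) : R[i] :=
  \sum_(k < N) chi (M + k.+1%:Z) * ee F.[(M + k.+1%:Z)%:~R].

(* Main.v *)
(* Burgess's method with Vinogradov's mean value theorem.  With D = d(d+1)/2, m = 2r - D and V
   about q^(1/m), the sum is averaged over the shifts uv with u <= U = N/(16V) coprime to q and
   v <= V; writing n + uv = u(lambda + v) modulo q, the character sum becomes a sum over v of
   chi(lambda + v) twisted by e(G(v)), where the polynomial G depends on n and u.  By Fejer kernels
   e(G(v)) is a convex combination of O(V^D) fixed phases, so G can be removed.  By Hoelder's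
   inequality, with a count of the coincidences lambda = n/u, one is left with the 2r-th moment
   over all residues lambda and all phases: orthogonality of the phases leaves only the solutions
   v of the Vinogradov system, each weighted by the complete sum of
   chi((x + v_1)...(x + v_r)) conj chi((x + v_(r+1))...(x + v_2r)).  If some v_i is different from
   all the others this is O(q^(1/2)) up to gcd factors that are small on average (Weil's bound for
   prime moduli, by Stepanov's method, and the Chinese remainder theorem); there are only O(V^r)
   remaining solutions, to which the trivial bound q applies.  The hypothesis on r bounds the
   number of solutions by V^(m + o(1)) and forces r >= D, because the diagonal solutions already
   number V^r.  The ends left over by the shifts are handled by induction on N. *)

Require Import Defs.
From HB Require Import structures.
From mathcomp Require Import all_boot all_order all_algebra all_field.
From mathcomp Require Import all_classical all_reals all_analysis.
From mathcomp Require Import complex.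
From mathcomp Require Import zify ring lra.
Set Implicit Arguments.
Unset Strict Implicit.
Unset Printing Implicit Defensive.
Import Order.TTheory GRing.Theory Num.Theory.
Local Open Scope ring_scope.

(** * Frobenius orbits over a finite field *)

(** With [D + m = 2r] the exponent of [q] in the theorem is [(r+1)/(2rm)]: for [V^m] about [q] the
    claim is a bound [N^(1-1/r) V^((r+1)/(2r))] up to [q^o(1)]. This [V] balances the two parts of
    the moment. Tuples without isolated coordinate give [V^r q]. On the others the gcd factors are
    controlled only on average over all tuples, not over the solutions, so Cauchy-Schwarz gives
    [q^(1/2) J^(1/2) V^r], where [J] is about [V^m]. The condition on [N] says that [N^2] is at most
    [q V] up to a constant, as needed for [N U <= q]. Weil's bound is obtained without algebraic
    curves. Stepanov's method bounds from above the number of [x], in an extension of even degree,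
    at which the norm of [f x] has a given nonzero value. These fibres together fill nearly the
    whole field, so one-sided bounds control the character sums over the extensions, which are, up
    to sign, the power sums of the inverse roots of the L-function. An isolated shift is a simple
    zero of [f]: it keeps the auxiliary polynomial from vanishing and makes the L-function a
    polynomial. *)

Definition frob (K : fieldType) (l : nat) (hl : [pchar K].-nat l) (x : K) : K :=
  x ^+ l.

Lemma frob_zmod_morphism (K : fieldType) (l : nat) (hl : [pchar K].-nat l) :
  zmod_morphism (frob hl).
Proof.
move=> x y; rewrite /frob exprDn_pchar //.
congr (_ + _); apply/eqP; rewrite -subr_eq0 opprK -exprDn_pchar // addNr expr0n.
by case: l hl.
Qed.

Lemma frob_monoid_morphism (K : fieldType) (l : nat) (hl : [pchar K].-nat l) :
  monoid_morphism (frob hl).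
Proof. by split=> [|x y]; rewrite /frob ?expr1n // exprMn. Qed.

(** The proof [hl] is carried by the term [frob hl], so that unification finds these structures. *)
HB.instance Definition _ (K : fieldType) (l : nat) (hl : [pchar K].-nat l) :=
  GRing.isZmodMorphism.Build K K (frob hl) (frob_zmod_morphism hl).
HB.instance Definition _ (K : fieldType) (l : nat) (hl : [pchar K].-nat l) :=
  GRing.isMonoidMorphism.Build K K (frob hl) (frob_monoid_morphism hl).

(** [X^q - X] is the product of the [X - u] over [F]; at a fixed [x] one of the factors vanishes. *)
Lemma fixed_image (F : finFieldType) (K : fieldType) (io : {rmorphism F -> K})
    (x : K) : x ^+ #|F| = x -> {u | io u = x}.
Proof.
move=> hx; apply/sig_eqW.
have := congr1 (fun f => (map_poly io f).[x]) (finField_genPoly F).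
rewrite rmorphB /= map_polyXn map_polyX rmorph_prod hornerD hornerN hornerXn hornerX.
rewrite hx subrr horner_prod => /esym/eqP; rewrite prodf_seq_eq0 => /hasP[u _ /=].
rewrite rmorphB /= map_polyX map_polyC hornerXsubC subr_eq0 => /eqP ->.
by exists u.
Qed.

Section FrobeniusOrbits.
Variables (F K : finFieldType) (io : {rmorphism F -> K}).
Hypothesis hq : [pchar K].-nat #|F|.
Local Notation phi := (frob hq).

Definition rho (x : K) : F := odflt 0 [pick u | io u == x].

Lemma ioK : cancel io rho.
Proof.
move=> u; rewrite /rho; case: pickP => [v /eqP /fmorph_inj //|/(_ u)].
by rewrite eqxx.
Qed.

Lemma rhoK x : x ^+ #|F| = x -> io (rho x) = x.
Proof. by move/(@fixed_image F K io) => [u <-]; rewrite ioK. Qed.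

Lemma phi_inj : injective phi. Proof. exact: fmorph_inj. Qed.

Lemma iter_phi t x : iter t phi x = x ^+ (#|F| ^ t).
Proof. by elim: t => [|t IH]; rewrite ?expn0 ?expr1 //= IH /frob -exprM expnSr. Qed.

(* [cpoly k x] is the characteristic polynomial over [F] of an element [x] of the
   extension of degree [k]; [dcpoly k x] is the same polynomial with coefficients in [F]. *)
Definition cpoly (k : nat) (x : K) : {poly K} :=
  \prod_(t < k) ('X - (iter t phi x)%:P).

Lemma cpoly_monic k x : cpoly k x \is monic.
Proof. by apply: monic_prod_XsubC. Qed.

Lemma size_cpoly k x : size (cpoly k x) = k.+1.
Proof. by rewrite size_prod_XsubC /index_enum -enumT size_enum_ord. Qed.

Lemma map_phi_cpoly k x : iter k phi x = x -> map_poly phi (cpoly k x) = cpoly k x.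
Proof.
move=> hx; rewrite /cpoly rmorph_prod /=.
under eq_bigr => t _ do rewrite rmorphB /= map_polyX map_polyC /= -iterS.
case: k hx => [|k] hx; first by rewrite !big_ord0.
by rewrite big_ord_recr big_ord_recl /= -iterS hx mulrC.
Qed.

Lemma map_phi_descend (f : {poly K}) :
  map_poly phi f = f -> map_poly io (map_poly rho f) = f.
Proof.
move=> hf; apply/polyP => i.
have hr : rho 0 = 0 by rewrite -(rmorph0 io) ioK.
rewrite coef_map /= coef_map_id0 // rhoK //.
by move/polyP/(_ i): hf; rewrite coef_map.
Qed.

Definition dcpoly k x := map_poly rho (cpoly k x).

Lemma dcpolyE k x : iter k phi x = x -> map_poly io (dcpoly k x) = cpoly k x.
Proof. by move=> /map_phi_cpoly /map_phi_descend. Qed.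

Lemma dcpoly_monic k x : iter k phi x = x -> dcpoly k x \is monic.
Proof. by move=> h; rewrite -(map_monic io) dcpolyE // cpoly_monic. Qed.

Lemma size_dcpoly k x : iter k phi x = x -> size (dcpoly k x) = k.+1.
Proof. by move=> h; rewrite -(size_map_poly io) dcpolyE // size_cpoly. Qed.

Lemma cpolyD k l x : iter k phi x = x -> cpoly (k + l) x = cpoly k x * cpoly l x.
Proof.
move=> hx; rewrite /cpoly big_split_ord; congr (_ * _) => /=.
by apply: eq_bigr => i _; rewrite addnC iterD hx.
Qed.

Lemma iter_phiM d j x : iter d phi x = x -> iter (j * d) phi x = x.
Proof. by move=> hx; elim: j => //= j IH; rewrite mulSn addnC iterD hx. Qed.

Lemma cpolyM d j x : iter d phi x = x -> cpoly (j * d) x = cpoly d x ^+ j.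
Proof.
move=> hx; elim: j => [|j IH]; first by rewrite mul0n expr0 /cpoly big_ord0.
by rewrite mulSn addnC cpolyD ?IH ?exprSr //; apply: iter_phiM.
Qed.

Lemma prod_XsubC_exp_dvd (s : seq K) (f : {poly K}) j :
  f != 0 -> uniq s -> {in s, forall y, (j <= mup y f)%N} ->
  (\prod_(y <- s) ('X - y%:P)) ^+ j %| f.
Proof.
move=> f0; elim: s => [|y s IH]; first by rewrite big_nil expr1n dvd1p.
rewrite cons_uniq => /andP[ys us] h; rewrite big_cons exprMn Gauss_dvdp.
  by rewrite -mup_geq // h ?mem_head //= IH // => z zs; apply: h; rewrite inE zs orbT.
apply: coprimep_expl; apply: coprimep_expr.
by rewrite coprimep_sym coprimep_XsubC root_prod_XsubC.
Qed.

(** The degree over [F] of the field generated by [x]. *)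
Definition per x := fingraph.order phi x.

Lemma iter_per x : iter (per x) phi x = x.
Proof. exact: iter_order phi_inj x. Qed.

Lemma per_gt0 x : (0 < per x)%N.
Proof. exact: order_gt0. Qed.

Lemma cpoly_per x : cpoly (per x) x = \prod_(y <- orbit phi x) ('X - y%:P).
Proof.
rewrite /cpoly /orbit.
have -> : traject phi x (order phi x) = [seq iter t phi x | t <- iota 0 (per x)].
  apply: (@eq_from_nth _ x) => [|i]; first by rewrite size_map size_iota size_traject.
  rewrite size_traject => hi.
  by rewrite nth_traject // (nth_map 0%N) ?size_iota // nth_iota.
by rewrite big_map -[in RHS](subn0 (per x)) big_mkord.
Qed.

Lemma iter_phi_dvd k x : (iter k phi x == x) = (per x %| k)%N.
Proof.
apply/eqP/idP => [h|/dvdnP[j ->]]; last exact: iter_phiM (iter_per x).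
have h2 : iter (k %% per x) phi x = x.
  by rewrite -[RHS]h {2}(divn_eq k (per x)) addnC iterD (iter_phiM _ (iter_per x)).
have lt : (k %% per x < order phi x)%N by rewrite ltn_mod per_gt0.
have := findex_iter lt; rewrite h2 /dvdn => <-.
by have := @findex_iter _ phi x 0 (per_gt0 x) => /= ->.
Qed.

Lemma mup_frob (f : {poly K}) x : f != 0 -> map_poly phi f = f ->
  (mup x f <= mup (phi x) f)%N.
Proof.
move=> f0 hf; rewrite mup_geq // -{2}hf.
have -> : ('X - (phi x)%:P) ^+ mup x f = map_poly phi (('X - x%:P) ^+ mup x f).
  by rewrite [RHS]rmorphXn /= map_polyXsubC.
by rewrite dvdp_map -mup_geq.
Qed.

(** If the [k]-th iterate fixes [x], then [k = j * per x] and [cpoly k x] is the [j]-th power of the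
    minimal polynomial of [x]. It divides [f] exactly when [j <= mup x f], because the multiplicity
    does not decrease along the orbit. *)
Lemma cpoly_count (f : {poly K}) n x : f != 0 -> map_poly phi f = f ->
  size f = n.+1 ->
  (\sum_(1 <= k < n.+1) ((iter k phi x == x) && (cpoly k x %| f)%R))%N = mup x f.
Proof.
move=> f0 hf sf; pose d := per x.
have mupO y : y \in orbit phi x -> (mup x f <= mup y f)%N.
  case/trajectP => i _ ->; elim: i => [|i IH]; first exact: leqnn.
  by rewrite iterS; apply: leq_trans IH _; apply: mup_frob.
have key j : (cpoly (j * d) x %| f) = (j <= mup x f)%N.
  rewrite (cpolyM _ (iter_per x)) cpoly_per; apply/idP/idP => h.
    rewrite mup_geq //; apply: dvdp_trans h.
    rewrite (bigD1_seq x) ?in_orbit ?orbit_uniq //=.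
    by rewrite exprMn dvdp_mulr.
  apply: prod_XsubC_exp_dvd; [exact: f0 | exact: orbit_uniq |].
  by move=> y /mupO; apply: leq_trans h.
(* By degrees, the range [k <= n] misses none of the [k] to be counted. *)
have mdn : (mup x f * d <= n)%N.
  have : cpoly (mup x f * d) x %| f by rewrite key.
  by move/dvdp_leq => /(_ f0); rewrite size_cpoly sf.
have E k : (iter k phi x == x) && (cpoly k x %| f)%R = (d %| k)%N && (k <= mup x f * d)%N.
  rewrite iter_phi_dvd -/d; case: (boolP (d %| k)%N) => //= /dvdnP[j ->].
  by rewrite key leq_pmul2r // per_gt0.
under eq_bigr => k _ do rewrite E.
rewrite {key}/d in mdn E *; rewrite (@big_cat_nat _ _ _ (mup x f * per x).+1) //= [X in (_ + X)%N]big1_seq ?addn0; last first.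
  by move=> i /=; rewrite mem_index_iota => /andP[h _]; rewrite [(i <= _)%N]leqNgt h andbF.
rewrite (eq_big_nat _ _ (F2 := fun i => (per x %| i)%N : nat)); last first.
  by move=> i /andP[_]; rewrite ltnS => ->; rewrite andbT.
move: (mup x f) (per x) (per_gt0 x) {mdn E} => m e e0.
by rewrite -divn_count_dvd mulnK.
Qed.

End FrobeniusOrbits.

(** * Newton's identities for the L-function *)

(** Rows of length [n] encode the monic polynomials of degree [n], which turns sums over these into
    sums over a finite type. *)
Definition mon (F : fieldType) (n : nat) (c : 'rV[F]_n) : {poly F} := 'X^n + rVpoly c.

Lemma size_mon (F : fieldType) n (c : 'rV[F]_n) : size (mon c) = n.+1.
Proof. by rewrite /mon size_polyDl size_polyXn // ltnS size_poly. Qed.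

Lemma mon_monic (F : fieldType) n (c : 'rV[F]_n) : mon c \is monic.
Proof.
by rewrite monicE /mon lead_coefDl ?size_polyXn ?ltnS ?size_poly // lead_coefXn.
Qed.

Definition unmon (F : fieldType) n (f : {poly F}) : 'rV[F]_n := poly_rV (f - 'X^n).

Lemma monK (F : fieldType) n : cancel (@mon F n) (@unmon F n).
Proof. by move=> c; rewrite /unmon /mon addrAC subrr add0r rVpolyK. Qed.

Lemma unmonK (F : fieldType) n (f : {poly F}) :
  f \is monic -> size f = n.+1 -> mon (unmon n f) = f.
Proof.
move=> fm sf; rewrite /mon /unmon poly_rV_K; first by rewrite addrC subrK.
apply/leq_sizeP => j; rewrite leq_eqVlt coefB coefXn => /predU1P[<-|lj].
  by rewrite eqxx -[n]/(n.+1.-1) -sf -/(lead_coef f) (monicP fm) subrr.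
by rewrite nth_default ?sf // gtn_eqF // subrr.
Qed.

Lemma sum_count_mem (T : finType) (s : seq T) :
  (\sum_(x : T) count_mem x s)%N = size s.
Proof.
under eq_bigr => x _ do rewrite -sum1_count.
rewrite (exchange_big_dep predT) //= -[RHS]sum1_size; apply: eq_bigr => y _.
by rewrite (eq_bigl (pred1 y)) ?big_pred1_eq // => x; rewrite /= eq_sym.
Qed.

Section NewtonIdentity.
Variables (F K : finFieldType) (io : {rmorphism F -> K}).
Hypothesis hq : [pchar K].-nat #|F|.
Local Notation phi := (frob hq).
Variables (C : comNzRingType) (Lam : {poly F} -> C).
Hypothesis LamM : forall f g, Lam (f * g) = Lam f * Lam g.

Definition coefA n : C := \sum_(c : 'rV[F]_n) Lam (mon c).

(** For [K] large enough these [x] form the extension of [F] of degree [k], and for the [Lam] of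
    Weil's bound the summand is the character at a norm: this is the character sum over the
    extension. *)
Definition powS k : C := \sum_(x : K | iter k phi x == x) Lam (dcpoly io hq k x).

Lemma sum_multiples n (P : {poly F}) k : P \is monic -> size P = k.+1 -> (k <= n)%N ->
  \sum_(c : 'rV[F]_n | P %| mon c) Lam (mon c) = Lam P * coefA (n - k).
Proof.
move=> Pm sP kn; rewrite /coefA big_distrr /=.
have sPM (c : 'rV[F]_(n - k)) : size (P * mon c) = n.+1.
  by rewrite size_monicM ?mon_monic ?monic_neq0 ?mon_monic // sP size_mon; lia.
have PMm (c : 'rV[F]_(n - k)) : P * mon c \is monic by rewrite monicMl ?mon_monic.
have P0 := monic_neq0 Pm.
rewrite (reindex_onto (fun c : 'rV[F]_(n - k) => unmon n (P * mon c))
   (fun c => unmon (n - k) (mon c %/ P))) /=; last first.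
  move=> c Pc; have E : P * (mon c %/ P) = mon c by rewrite mulrC divpK.
  have Qm : mon c %/ P \is monic by rewrite -(monicMl _ Pm) E mon_monic.
  rewrite unmonK ?E ?monK //.
  by rewrite size_divp // size_mon sP; lia.
apply: eq_big => c.
  rewrite unmonK // dvdp_mulIl mulrC mulpK // monK eqxx //.
by rewrite unmonK // LamM.
Qed.

(* The coefficients [coefA] are those of the L-function attached to [Lam]: writing [n] as the
   number of roots of a monic [f] of degree [n] and grouping the roots by Frobenius orbits
   ([cpoly_count]) gives the logarithmic derivative of the Euler product. *)
Lemma newton n :
  (forall c : 'rV[F]_n, exists rs, map_poly io (mon c) = \prod_(y <- rs) ('X - y%:P)) ->
  n%:R * coefA n = \sum_(1 <= k < n.+1) powS k * coefA (n - k).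
Proof.
move=> spl; rewrite {1}/coefA big_distrr /=.
have E (c : 'rV[F]_n) : n%:R * Lam (mon c) =
    \sum_(1 <= k < n.+1) \sum_(x : K)
      (if (iter k phi x == x) && (cpoly hq k x %| map_poly io (mon c)) then Lam (mon c) else 0).
  have f0 : map_poly io (mon c) != 0 by rewrite map_poly_eq0 monic_neq0 ?mon_monic.
  have hf : map_poly phi (map_poly io (mon c)) = map_poly io (mon c).
    rewrite -map_poly_comp; apply: eq_map_poly => u /=.
    by rewrite /frob -rmorphXn /= expf_card.
  have {1}-> : n = (\sum_(x : K) mup x (map_poly io (mon c)))%N.
    have [rs hrs] := spl c; rewrite hrs.
    have -> : n = size rs.
      by have := size_mon c; rewrite -(size_map_poly io) hrs size_prod_XsubC => -[->].
    rewrite (eq_bigr (fun x => count_mem x rs)); first by rewrite sum_count_mem.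
    by move=> x _; apply: mu_prod_XsubC.
  rewrite exchange_big /= natr_sum big_distrl /=; apply: eq_bigr => x _.
  rewrite -(@cpoly_count _ _ hq _ n) ?size_map_poly ?size_mon // natr_sum big_distrl /=.
  by apply: eq_bigr => k _; case: ifP => _; rewrite ?mul1r ?mul0r.
under eq_bigr => c _ do rewrite E.
rewrite exchange_big /= !big_nat; apply: eq_bigr => k /andP[k1 kn].
rewrite exchange_big /= /powS big_distrl /= [RHS]big_mkcond /=.
apply: eq_bigr => x _; case: eqP => hx /=; last by rewrite big1.
rewrite -(sum_multiples (dcpoly_monic io hx) (size_dcpoly io hx)) //.
rewrite [RHS]big_mkcond; apply: eq_bigr => c _.
by rewrite -(dvdp_map io) dcpolyE.
Qed.

End NewtonIdentity.

(** Let [G] be the sum of the [p_k X^k] for [1 <= k <= n], with [p_k] the power sums. By induction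
    on [rs], a geometric sum telescoping at each step, [X P' + G P] is divisible by [X^(n+1)]; the
    identity is the vanishing of its coefficient of degree [n]. *)
Lemma newton_power_sums (C : comNzRingType) (rs : seq C) (n : nat) :
  let P := \prod_(w <- rs) (1 - w%:P * 'X) in
  n%:R * P`_n = \sum_(1 <= k < n.+1) (- \sum_(w <- rs) w ^+ k) * P`_(n - k).
Proof.
move=> P; pose G (s : seq C) : {poly C} := \sum_(1 <= k < n.+1) (\sum_(w <- s) w ^+ k) *: 'X^k.
have [Q HQ] : exists Q, 'X * P^`() + G rs * P = 'X^(n.+1) * Q.
  rewrite /P; elim: rs {P} => [|w s [Q IH]].
    exists 0; rewrite !big_nil derivC /G mulr0 add0r mulr1 mulr0.
    by rewrite big1 // => k _; rewrite big_nil scale0r.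
  rewrite big_cons; set P := \prod_(_ <- s) _ in IH *.
  have GE : G (w :: s) = G s + \sum_(1 <= k < n.+1) (w%:P * 'X) ^+ k.
    rewrite /G -big_split /=; apply: eq_bigr => k _.
    by rewrite big_cons scalerDl addrC exprMn -rmorphXn /= mul_polyC.
  have TE : (1 - w%:P * 'X) * \sum_(1 <= k < n.+1) (w%:P * 'X) ^+ k =
      w%:P * 'X - (w%:P * 'X) ^+ n.+1.
    move: (n) => m; elim: m => [|m IHm]; first by rewrite big_geq // mulr0 subrr.
    by rewrite big_nat_recr //= mulrDr IHm mulrBl mul1r -exprS addrA subrK.
  exists ((1 - w%:P * 'X) * Q - (w ^+ n.+1)%:P * P).
  rewrite [RHS]mulrBr ['X^_ * (_ * Q)]mulrCA -IH GE.
  have -> : 'X^(n.+1) * ((w ^+ n.+1)%:P * P) = (w%:P * 'X) ^+ n.+1 * P.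
    by rewrite exprMn -rmorphXn /= mulrA ['X^_ * _]mulrC.
  have -> : ((1 - w%:P * 'X) * P)^`() = - w%:P * P + (1 - w%:P * 'X) * P^`().
    by rewrite derivM derivB !poly.derivE mulr1 sub0r.
  move: TE; set s1 := \sum_(1 <= k < n.+1) _ => TE.
  have -> : (w%:P * 'X) ^+ n.+1 = w%:P * 'X - (1 - w%:P * 'X) * s1 by rewrite TE opprB addrC subrK.
  move: (G s) s1 (w%:P) P^`() => g s1' wp P' in TE *. ring.
have := congr1 (fun f : {poly C} => f`_n) HQ; rewrite /= coefXnM ltnSn.
rewrite coefD coefXM coefM => /eqP; rewrite addr_eq0 => /eqP.
case: n @G {HQ} => [|m] G.
  by rewrite /= big_geq // mul0r.
rewrite /= coef_deriv mulr_natl => ->; rewrite big_ord_recl.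
have G0 i : (G rs)`_i = if (0 < i <= m.+1)%N then \sum_(w <- rs) w ^+ i else 0.
  rewrite /G coef_sum; case: ifP => hi.
    rewrite (bigD1_seq i) ?iota_uniq ?mem_index_iota //= coefZ coefXn eqxx mulr1.
    by rewrite [X in _ + X]big1 ?addr0 // => j /negPf ij; rewrite coefZ coefXn eq_sym ij mulr0.
  rewrite big1_seq // => j /=; rewrite mem_index_iota coefZ coefXn => hj.
  by case: eqP hj hi => [->|]; rewrite ?mulr0 // ltnS => ->.
rewrite G0 mul0r add0r big_add1 big_mkord -sumrN; apply: eq_bigr => i _.
by rewrite G0 /= /bump add1n ltn_ord mulNr.
Qed.

(** The term [k = n] has coefficient [A 0 = 1], so the recurrence determines [S n] without division.
    This will identify [powS] with minus the power sums of the inverse roots. *)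
Lemma power_sums_unique (C : comNzRingType) (A S S' : nat -> C) (m : nat) :
  A 0%N = 1 ->
  (forall n, (0 < n <= m)%N -> n%:R * A n = \sum_(1 <= k < n.+1) S k * A (n - k)%N) ->
  (forall n, (0 < n <= m)%N -> n%:R * A n = \sum_(1 <= k < n.+1) S' k * A (n - k)%N) ->
  forall n, (0 < n <= m)%N -> S n = S' n.
Proof.
move=> A0 h h'; elim/ltn_ind => n IH hn.
have := h n hn; rewrite (h' n hn).
rewrite !big_nat_recr /= ?subnn ?A0 ?mulr1; try by case/andP: hn.
rewrite (eq_big_nat _ _ (F2 := fun k => S k * A (n - k)%N)); first by move/addrI.
by move=> k /andP[k0 kn]; rewrite IH // k0 /=; lia.
Qed.

(** * The modulus and power sums of complex numbers *)

(** The modulus as an element of [R]; the norm of [R[i]] takes its values in [R[i]]. *)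
Definition nm (R : rcfType) (z : R[i]) : R := ComplexField.Normc.normc z.

Section Modulus.
Variable R : rcfType.
Implicit Types x y z : R[i].

Lemma normE z : `|z| = (nm z)%:C%C.
Proof. by case: z. Qed.

Lemma nm0 : nm (0 : R[i]) = 0. Proof. exact: ComplexField.Normc.normc0. Qed.
Lemma nm1 : nm (1 : R[i]) = 1. Proof. exact: ComplexField.Normc.normc1. Qed.
Lemma nmM x y : nm (x * y) = nm x * nm y.
Proof. exact: ComplexField.Normc.normcM. Qed.
Lemma nmX x n : nm (x ^+ n) = nm x ^+ n.
Proof. by elim: n => [|n IH]; rewrite ?nm1 // !exprS nmM IH. Qed.
Lemma nm_ge0 x : 0 <= nm x.
Proof. by case: x => a b; apply: sqrtr_ge0. Qed.
Lemma nmD x y : nm (x + y) <= nm x + nm y.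
Proof. by rewrite -lecR rmorphD /= -!normE ler_normD. Qed.
Lemma nmN x : nm (- x) = nm x.
Proof. by apply/(@complexI R); rewrite -!normE normrN. Qed.
Lemma nm_conj x : nm x^*%C = nm x.
Proof. by case: x => a b; rewrite /nm /= sqrrN. Qed.
Lemma nm_nat n : nm (n%:R : R[i]) = n%:R.
Proof. by apply/(@complexI R); rewrite -normE normr_nat rmorph_nat. Qed.
Lemma nm_eq0 x : (nm x == 0) = (x == 0).
Proof. by apply/eqP/eqP => [/ComplexField.Normc.eq0_normc //|->]; rewrite nm0. Qed.
Lemma nm_sum (I : Type) (s : seq I) (P : pred I) (F : I -> R[i]) :
  nm (\sum_(i <- s | P i) F i) <= \sum_(i <- s | P i) nm (F i).
Proof.
elim/big_rec2: _ => [|i x y _ h]; first by rewrite nm0.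
by apply: le_trans (nmD _ _) _; rewrite lerD2l.
Qed.
Lemma nm_prod (I : Type) (s : seq I) (P : pred I) (F : I -> R[i]) :
  nm (\prod_(i <- s | P i) F i) = \prod_(i <- s | P i) nm (F i).
Proof. by elim/big_rec2: _ => [|i x y _ h]; rewrite ?nm1 // nmM h. Qed.
Lemma sqr_nm x : (nm x ^+ 2)%:C%C = x * x^*%C.
Proof. by rewrite -normCK rmorphXn /= normE. Qed.

End Modulus.

(** If [x] exceeded [b], Bernoulli's inequality would make [(x / b)^n] grow at least linearly. This
    is what erases the constant in the bounds for power sums. *)
Lemma exp_domination (R : realType) (x b C : R) (n0 : nat) : 0 <= x -> 0 < b ->
  (forall n, (n0 <= n)%N -> x ^+ n <= C * b ^+ n) -> x <= b.
Proof.
move=> x0 b0 h; rewrite leNgt; apply/negP => ltbx.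
pose t := x / b - 1; have t0 : 0 < t by rewrite subr_gt0 ltr_pdivlMr ?mul1r.
have key n : (n0 <= n)%N -> n%:R * t <= C.
  move=> /h; rewrite -ler_pdivrMr ?exprn_gt0 // -expr_div_n -(subrK 1 (x / b)) -/t.
  apply: le_trans; elim: n => [|n IH]; first by rewrite mul0r expr0 ler01.
  rewrite exprS; have : (n%:R * t) * t >= 0 by rewrite !mulr_ge0 ?ler0n // ltW.
  have : (1 + n%:R * t) * (t + 1) <= (t + 1) * (t + 1) ^+ n.
    rewrite mulrC ler_wpM2l //; first by lra.
    elim: (n) => [|m IHm]; first by rewrite mul0r addr0 expr0.
    rewrite exprS -natr1.
    have : (t + 1) * (1 + m%:R * t) <= (t + 1) * (t + 1) ^+ m by rewrite ler_wpM2l //; lra.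
    have : (m%:R * t) * t >= 0 by rewrite !mulr_ge0 ?ler0n // ltW.
    by nra.
  by rewrite -natr1; nra.
have /archi_boundP h2 : 0 <= `|C| / t by rewrite divr_ge0 // ltW.
have := key (n0 + Num.Def.archi_bound (`|C| / t))%N (leq_addr _ _).
rewrite natrD mulrDl; rewrite ltr_pdivrMr // in h2.
have := ler_norm C; have : 0 <= n0%:R * t by rewrite mulr_ge0 ?ler0n // ltW.
by nra.
Qed.

(* A polynomial vanishing at every element of [rs] but [w] turns the bound on the power sums
   into one on the powers of [w] alone. *)
Lemma power_sum_bound (R : realType) (rs : seq R[i]) (C b : R) (n0 : nat) : 0 < b ->
  (forall n, (n0 <= n)%N -> nm (\sum_(w <- rs) w ^+ n) <= C * b ^+ n) ->
  forall w, w \in rs -> nm w <= b.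
Proof.
move=> b0 h w wrs.
pose f := \prod_(v <- [seq v <- undup rs | v != w]) ('X - v%:P).
have fw : f.[w] != 0.
  rewrite -[_ == 0]/(root f w) root_prod_XsubC mem_filter eqxx //.
have f0 v : v \in rs -> v != w -> f.[v] = 0.
  move=> vrs vw; apply/eqP; rewrite -[_ == 0]/(root f v) root_prod_XsubC.
  by rewrite mem_filter vw mem_undup.
have cnt : (0 < count_mem w rs)%N by rewrite -has_count has_pred1.
have cf0 : 0 < (count_mem w rs)%:R * nm f.[w].
  by rewrite mulr_gt0 ?ltr0n // lt_def nm_ge0 nm_eq0 fw.
have E n : \sum_(v <- rs) f.[v] * v ^+ n = (count_mem w rs)%:R * f.[w] * w ^+ n.
  rewrite (bigID (pred1 w)) /= [X in _ + X]big1_seq ?addr0; last first.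
    by move=> v /andP[vw vrs]; rewrite f0 // mul0r.
  rewrite (eq_bigr (fun _ => f.[w] * w ^+ n)); last by move=> v /eqP ->.
  by rewrite big_const_seq iter_addr_0 -mulrA mulr_natl.
apply: (@exp_domination _ _ _ ((\sum_(k < size f) nm f`_k * C * b ^+ k) /
   ((count_mem w rs)%:R * nm f.[w])) n0 (nm_ge0 w) b0) => n hn.
rewrite mulrAC ler_pdivlMr // mulrC -nmX -nm_nat -!nmM -E.
under eq_bigr => v _ do rewrite horner_coef big_distrl /=.
rewrite exchange_big /=; apply: le_trans (nm_sum _ _ _) _.
rewrite big_distrl /=; apply: ler_sum => k _.
under eq_bigr => v _ do rewrite -mulrA -exprD.
rewrite -big_distrr /= nmM -!mulrA ler_wpM2l ?nm_ge0 //.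
by rewrite -exprD h // (leq_trans hn) // leq_addl.
Qed.

(** * Stepanov's method *)

(** Once the earlier [R s] vanish, all other terms are divisible by [X^(pos t + c)]. Hence [X^c]
    divides [R t * H t], and so [R t], whose size is at most [c]. *)
Lemma separated_sum_eq0 (K : fieldType) (T c : nat) (R H : 'I_T -> {poly K}) (pos : 'I_T -> nat) :
  (forall t, (size (R t) <= c)%N) -> (forall t, (H t).[0] != 0) ->
  (forall s t : 'I_T, (s < t)%N -> (pos s + c <= pos t)%N) ->
  \sum_t R t * H t * 'X^(pos t) = 0 -> forall t, R t = 0.
Proof.
move=> sR H0 sep S0 [t tT]; elim/ltn_ind: t tT => t IH tT; set t0 := Ordinal tT.
have : 'X^(pos t0 + c) %| R t0 * H t0 * 'X^(pos t0).
  move: S0; rewrite (bigD1 t0) //= => /eqP; rewrite addr_eq0 => /eqP ->.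
  rewrite dvdpNr; apply: (big_ind (fun f => 'X^(pos t0 + c) %| f)) => [|f g|s st].
  - exact: dvdp0.
  - exact: dvdp_add.
  case: (ltngtP s t) => [lt|gt|e].
  - by rewrite (_ : R s = 0) ?mul0r ?dvdp0 //; case: (s) lt => s' hs' /= lt; apply: IH.
  - by apply: dvdp_mull; apply: dvdp_exp2l; apply: sep.
  - by case/eqP: st; apply: val_inj.
rewrite addnC exprD dvdp_mul2r ?expf_neq0 ?polyX_eq0 // Gauss_dvdpl; last first.
  by apply: coprimep_expl; rewrite -['X]subr0 -polyC0 coprimep_sym coprimep_XsubC; apply: H0.
by move=> d; apply/eqP; case: eqP => // /eqP r0; move/dvdp_leq: d => /(_ r0);
  rewrite size_polyXn ltnNge sR.
Qed.

Lemma size_mul_bound (K : fieldType) (f g : {poly K}) (a b : nat) :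
  (size f <= a.+1)%N -> (size g <= b.+1)%N -> (size (f * g)%R <= (a + b).+1)%N.
Proof.
move=> fa gb; apply: leq_trans (size_polyMleq _ _) _.
by move: (size f) (size g) fa gb => x y; lia.
Qed.

Section Stepanov.
Variables (K : finFieldType) (l n c m : nat) (h : {poly K}) (z : K).
Hypothesis hl : [pchar K].-nat l.
Hypothesis (n0 : (0 < n)%N) (c0 : (0 < c)%N) (lE : l = (n * c).+1).
Local Notation g := ('X * h).
Hypothesis (h0 : h.[0] != 0) (sg : size g = m.+1) (lm : (2 * m + 2 < l)%N).

(** An index [t < T] encodes the exponent [t %/ n < J] of ['X^l] and the exponent [t %% n < n] of
    [g ^+ c]. The value of [J] makes the number [T * c] of unknown coefficients exceed the bound [D]
    for the size of [Psi]. *)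
Let J := (c + m + 2)%N.
Let T := (J * n)%N.
Let D := (l * c.-1 + n.-1 * c * m + J)%N.

(* [M] encodes the unknown coefficients.  At a point with [x ^+ (l ^ 2) = x] and
   [g.[x] ^+ (c * l.+1) = z], raising [Theta] to the power [l] and multiplying by
   [g.[x] ^+ (n.-1 * c)] gives [Psi], whose degree is small and which is additive in [M];
   so the pigeonhole principle provides [M != 0] with [Psi M = 0]. *)
Let Theta (M : 'M[K]_(T, c)) : {poly K} :=
  \sum_t rVpoly (row t M) * g ^+ (t %% n * c) * 'X^(t %/ n * l).

Let Psi (M : 'M[K]_(T, c)) : {poly K} :=
  \sum_t rVpoly (row t M) ^+ l * z%:P ^+ (t %% n) * g ^+ ((n.-1 - t %% n) * c) * 'X^(t %/ n).

Let hlP : [pchar {poly K}].-nat l.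
Proof. by apply: sub_in_pnat hl => p _; rewrite pchar_poly. Qed.

Let PsiB M N : Psi (M - N) = Psi M - Psi N.
Proof.
rewrite /Psi -sumrB; apply: eq_bigr => t _.
have -> : rVpoly (row t (M - N)) = rVpoly (row t M) - rVpoly (row t N).
  by rewrite -raddfB /= raddfB.
rewrite exprDn_pchar // -!mulrA -mulrBl; congr ((_ + _) * _).
apply/eqP; rewrite -addr_eq0 -exprDn_pchar // addNr expr0n.
by rewrite lE.
Qed.

Let tn (t : 'I_T) : (t %% n < n)%N. Proof. by rewrite ltn_mod. Qed.
Let tJ (t : 'I_T) : (t %/ n < J)%N. Proof. by rewrite ltn_divLR. Qed.

Let size_Psi M : (size (Psi M) <= D)%N.
Proof.
apply: (leq_trans (size_sum _ _ _)); apply/bigmax_leqP => t _.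
have a0 : (size (rVpoly (row t M)) <= c)%N by apply: size_poly.
have a1 : (size (rVpoly (row t M) ^+ l) <= (l * c.-1).+1)%N.
  apply: leq_trans (size_poly_exp_leq _ _) _; rewrite ltnS mulnC leq_mul2l.
  by apply/orP; right; lia.
have a2 : (size (z%:P ^+ (t %% n)) <= 1)%N by rewrite -rmorphXn size_polyC leq_b1.
have a3 : (size (g ^+ ((n.-1 - t %% n) * c)) <= (n.-1 * c * m).+1)%N.
  by apply: leq_trans (size_poly_exp_leq _ _) _; rewrite sg ltnS /= mulnC leq_mul2r leq_mul2r leq_subr !orbT.
have a4 := tJ t.
have a5 : (size ('X^(t %/ n) : {poly K}) <= (t %/ n).+1)%N by rewrite size_polyXn.
apply: leq_trans (size_mul_bound (size_mul_bound (size_mul_bound a1 a2) a3) a5) _.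
by rewrite addn0 /D -addnS leq_add2l.
Qed.

Let size_Theta M : (size (Theta M) <= c * l + (2 * m + 2) * l)%N.
Proof.
apply: (leq_trans (size_sum _ _ _)); apply/bigmax_leqP => t _.
have a1 : (size (rVpoly (row t M)) <= c)%N by apply: size_poly.
have a3 : (size (g ^+ (t %% n * c)) <= (n * c * m).+1)%N.
  apply: leq_trans (size_poly_exp_leq _ _) _; rewrite sg ltnS /= mulnC leq_mul2r.
  by rewrite leq_mul2r (ltnW (tn t)) !orbT.
have a4 : (t %/ n * l <= (c + m).+1 * l)%N by rewrite leq_mul2r; apply/orP; right; move: (tJ t); rewrite /J; lia.
have a5 : (size ('X^(t %/ n * l) : {poly K}) <= (t %/ n * l).+1)%N by rewrite size_polyXn.
have a1' : (size (rVpoly (row t M)) <= c.-1.+1)%N by rewrite prednK.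
apply: leq_trans (size_mul_bound (size_mul_bound a1' a3) a5) _.
have a7 : (c <= l)%N by rewrite lE leqW // leq_pmull.
have a8 : (n * c * m <= l * m)%N by rewrite leq_mul2r lE leqnSn orbT.
by move: c0 a4 a7 a8; clear; move: (t %/ n * l)%N (n * c * m)%N => u v; lia.
Qed.

Let exists_M : exists2 M, M != 0 & Psi M = 0.
Proof.
have card_lt : (#|{: 'rV[K]_D}| < #|{: 'M[K]_(T, c)}|)%N.
  rewrite !card_mx ltn_exp2l; last first.
    by rewrite (cardD1 0) (cardD1 1) !inE oner_neq0.
  move: lm n0 c0; rewrite /T /D /J lE; case: (n) => // n' h1 _; case: (c) h1 => // c' h1 _ /=; clear -h1; nia.
pose f M : 'rV_D := poly_rV (Psi M).
have /injectivePn[M [N MN fMN]] : ~~ injectiveb f.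
  by apply: contraL card_lt => /injectiveP /leq_card; rewrite -leqNgt.
exists (M - N); first by rewrite subr_eq0.
rewrite PsiB; apply/eqP; rewrite subr_eq0; apply/eqP.
by rewrite -[LHS](poly_rV_K (size_Psi M)) -[RHS](poly_rV_K (size_Psi N)); congr rVpoly.
Qed.

(** Since [g = 'X * h] and [l = n * c + 1], the power of ['X] in the term [t] is [t * c + t %/ n].
    These exponents are at least [c] apart, and the other factor, a power of [h], does not vanish at
    [0]: the simple zero of [g] is essential here. *)
Let Theta_neq0 M : M != 0 -> Theta M != 0.
Proof.
apply: contraNneq => TM; apply/eqP/row_matrixP => t; rewrite row0.
suff : rVpoly (row t M) = 0.
  by move=> e; rewrite -[LHS]rVpolyK e; apply/rowP => i; rewrite !mxE coef0.
move: t; apply: (@separated_sum_eq0 _ _ c _ (fun t => h ^+ (t %% n * c))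
   (fun t => t * c + t %/ n)%N).
- by move=> t; apply: size_poly.
- by move=> t; rewrite horner_exp expf_neq0.
- move=> s t st; have := leq_div2r n (ltnW st); have : (s.+1 * c <= t * c)%N by rewrite leq_mul2r st orbT.
  by clear; rewrite mulSn; lia.
rewrite -[RHS]TM; apply: eq_bigr => t _.
rewrite exprMn -!mulrA; congr (_ * _); rewrite mulrCA; congr (_ * _).
rewrite -exprD; congr (_ ^+ _); rewrite {1}(divn_eq t n) lE; clear; move: (t %/ n)%N (t %% n)%N => a b; lia.
Qed.

Let root_Theta M x : Psi M = 0 -> x ^+ (l ^ 2) = x -> g.[x] != 0 ->
  g.[x] ^+ (c * l.+1) = z -> root (Theta M) x.
Proof.
rewrite /Theta /Psi; move: ('X * h) => G PM xl gx gz.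
set Th := \sum_t _.
suff : Th.[x] ^+ l * G.[x] ^+ (n.-1 * c) == 0.
  by rewrite mulf_eq0 !expf_eq0 (negPf gx) andbF orbF => /andP[].
rewrite -[X in _ == X](horner0 x) -PM; apply/eqP.
rewrite /Th !horner_sum.
have -> (F : 'I_T -> K) : (\sum_i F i) ^+ l = \sum_i F i ^+ l.
  elim/big_rec2: _ => [|i a b _ <-]; first by rewrite expr0n lE.
  by rewrite exprDn_pchar.
rewrite big_distrl /=; apply: eq_bigr => t _.
rewrite !hornerM !horner_exp !hornerC hornerX !exprMn.
have -> : (x ^+ (t %/ n * l)) ^+ l = x ^+ (t %/ n).
  by rewrite -exprM -mulnA mulnn mulnC exprM xl.
have -> : z ^+ (t %% n) = (G.[x] ^+ (c * l)) ^+ (t %% n) * G.[x] ^+ (c * (t %% n)).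
  by rewrite -gz mulnS addnC exprD exprMn [G.[x] ^+ (c * (t %% n))]exprM.
have -> : (n.-1 * c = c * (t %% n) + (n.-1 - t %% n) * c)%N.
  by rewrite mulnBl [(c * _)%N]mulnC subnKC // leq_mul2r -ltnS prednK // tn orbT.
rewrite [in LHS]exprD -!exprM (_ : (t %% n * c * l = c * l * (t %% n))%N); last by lia.
move: (G.[x] ^+ (c * l * _)) (G.[x] ^+ (c * _)) (G.[x] ^+ (_ * c)) (x ^+ _) => A1 A2 A3 A4.
by move: (_ ^+ l) => A5; ring.
Qed.

(** In the field with [l^2] elements [x ^+ l] acts as a second coordinate whose [l]-th power is [x];
    hence simple zeros of [Theta] suffice and no derivatives occur. The main term [c * l] is the
    expected size of a fibre of the norm, up to [c], and the error is of the order of [l]. *)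
Lemma stepanov :
  (#|[pred x : K | [&& x ^+ (l ^ 2) == x, g.[x] != 0%R & g.[x] ^+ (c * l.+1) == z]]|
    <= c * l + (2 * m + 2) * l)%N.
Proof.
have [M M0 PM] := exists_M; rewrite cardE.
apply: ltnW; apply: leq_trans (size_Theta M); apply: max_poly_roots.
- exact: Theta_neq0.
- by apply/allP => x; rewrite mem_enum => /and3P[/eqP ? ? /eqP ?]; apply: root_Theta.
- exact: enum_uniq.
Qed.

End Stepanov.

(** * Weil's bound *)

(** Splitting the product of the finitely many nonzero polynomials of size at most [N + 1] gives a
    single [K] for all extensions and all [f] at once. *)
Lemma exists_splitting_field (F : finFieldType) (N : nat) :
  exists (K : finFieldType) (io : {rmorphism F -> K}),
  forall P : {poly F}, P \is monic -> (size P <= N.+1)%N ->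
  exists rs, map_poly io P = \prod_(y <- rs) ('X - y%:P).
Proof.
pose P0 : {poly F} := \prod_(c : 'rV[F]_N.+1 | rVpoly c != 0) rVpoly c.
have P00 : P0 != 0 by apply/prodf_neq0.
have [L [zs Dzs _]] := FinSplittingFieldFor P00.
exists (finvect_type L), (GRing.in_alg (finvect_type L)) => P Pm sP.
have : P %| P0.
  have rP : rVpoly (poly_rV P : 'rV_N.+1) = P by apply: poly_rV_K.
  rewrite /P0 (bigD1 (poly_rV P)) ?rP ?monic_neq0 //=.
  exact: dvdp_mulIl.
rewrite -(dvdp_map (GRing.in_alg L)) (eqp_dvdr _ Dzs) => /dvdp_prod_XsubC[m em].
exists (mask m zs); apply/eqP; rewrite -eqp_monic //.
  exact: monic_map.
exact: monic_prod_XsubC.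
Qed.

(** The derivative of [X^Q - X] is [-1], because [Q] is zero in [K]; so the roots are distinct. *)
Lemma card_frob_fixed (F K : finFieldType) (io : {rmorphism F -> K}) (Q : nat) :
  [pchar K].-nat Q -> (1 < Q)%N ->
  (exists rs, map_poly io ('X^Q - 'X) = \prod_(y <- rs) ('X - y%:P)) ->
  #|[pred x : K | x ^+ Q == x]| = Q.
Proof.
move=> hQ Q1 [rs]; rewrite rmorphB /= map_polyXn map_polyX => E.
have Q0 : Q%:R = 0 :> K.
  have [p pr] := finPcharP K.
  case/andP: hQ => Qgt0 /allP hQ; have [//|r rQ] := eqVneq (Q%:R : K) 0.
  have := hQ (pdiv Q); rewrite mem_primes pdiv_prime // Qgt0 pdiv_dvd => /(_ isT) hp.
  by have := dvdn_pcharf hp Q; rewrite pdiv_dvd => /esym/eqP.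
have us : uniq rs.
  rewrite -separable_prod_XsubC -E separable_poly.unlock derivB derivXn derivX.
  by rewrite -mulr_natr -polyC_natr Q0 mulr0 sub0r -(scaleN1r 1) coprimepZr ?oppr_eq0 ?oner_neq0 // coprimep1.
have sz : size rs = Q.
  have : size ('X^Q - 'X : {poly K}) = Q.+1.
    by rewrite size_polyDl size_polyXn // size_polyN size_polyX.
  by rewrite E size_prod_XsubC => -[].
rewrite -{2}sz -(card_uniqP us); apply: eq_card => x.
rewrite inE -subr_eq0 -[x in _ - x]hornerX -hornerXn -hornerN -hornerD E.
by rewrite -root_prod_XsubC.
Qed.

Section CharacterSums.
Variables (R : realType) (F : finFieldType) (X : F -> R[i]).
Hypothesis XM : forall u v, X (u * v) = X u * X v.
Hypothesis X0 : X 0 = 0.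
Hypothesis X1 : X 1 = 1.
Hypothesis Xnt : exists2 u, u != 0 & X u != 1.

Lemma charX u k : X (u ^+ k) = X u ^+ k.
Proof. by elim: k => [|k IH]; rewrite ?expr0 // !exprS XM IH. Qed.

Lemma char_prod (I : Type) (s : seq I) (P : pred I) (f : I -> F) :
  X (\prod_(i <- s | P i) f i) = \prod_(i <- s | P i) X (f i).
Proof. exact: (big_morph X XM X1). Qed.

Lemma nm_char_le1 u : nm (X u) <= 1.
Proof.
have [->|u0] := eqVneq u 0; first by rewrite X0 nm0.
have : X u ^+ #|F|.-1 = 1.
  rewrite -charX (_ : u ^+ #|F|.-1 = 1) //; apply: (mulfI u0).
  by rewrite -exprS prednK ?expf_card ?mulr1 // (cardD1 0).
move/(congr1 (@nm R)); rewrite nmX nm1 => /eqP.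
rewrite pexpr_eq1 ?nm_ge0 //; first by move/eqP ->.
by rewrite -ltnS prednK ?finNzRing_gt1 // ltnW // finNzRing_gt1.
Qed.

Lemma sum_char : \sum_u X u = 0.
Proof.
case: Xnt => v v0 Xv.
have : X v * (\sum_u X u) = \sum_u X u.
  rewrite big_distrr /= [RHS](reindex (fun u => v * u)) /=.
    by apply: eq_bigr => u _; rewrite XM.
  by exists (fun u => v^-1 * u) => u _; rewrite ?mulKf ?mulVKf.
move/eqP; rewrite -subr_eq0 -{2}[\sum__ _]mul1r -mulrBl mulf_eq0 subr_eq0.
by rewrite (negPf Xv) => /eqP.
Qed.

Variables (I : finType) (a : I -> F) (e : I -> nat) (i0 : I).
Hypothesis (a0 : a i0 = 0) (e0 : e i0 = 1%N).
Hypothesis aN : forall i, i != i0 -> a i != 0.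

(** The character at a resultant, the product of the values of [P] at the zeros of [numer]. It is
    multiplicative in [P] and takes the value [X numer.[x]] at ['X - x%:P], so that [coefA Lam 1] is
    the sum to be bounded. *)
Definition Lam (P : {poly F}) : R[i] := \prod_i X P.[a i] ^+ e i.

Lemma LamM P Q : Lam (P * Q) = Lam P * Lam Q.
Proof.
by rewrite /Lam -big_split; apply: eq_bigr => i _; rewrite hornerM XM exprMn.
Qed.

Lemma coefA0 : coefA Lam 0 = 1.
Proof.
rewrite /coefA (big_pred1 0) => [|c]; last by rewrite /= [c]thinmx0 eqxx.
rewrite /Lam /mon raddf0 addr0; apply: big1 => i _.
by rewrite hornerXn expr0 X1 expr1n.
Qed.

Lemma coefA1 : coefA Lam 1 = \sum_x Lam ('X - x%:P).
Proof.
rewrite /coefA (reindex (fun x : F => (\row_(i < 1) - x))) /=.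
  apply: eq_bigr => x _; congr Lam; rewrite /mon expr1; congr (_ + _).
  apply/polyP => i; rewrite coef_rVpoly coefN coefC.
  by case: insubP => [j _ <-|]; case: i => //=; rewrite ?mxE ?ord1 ?oppr0.
exists (fun c => - c 0 0) => [x _|c _]; first by rewrite mxE opprK.
by apply/rowP => i; rewrite mxE opprK ord1.
Qed.

(* Translating a monic [f] by multiples of [w], which vanishes at all the [a i] but [a i0],
   changes only the factor at [i0], over which the sum is that of a nontrivial character. *)
Lemma coefA_eq0 n : (#|I| <= n)%N -> coefA Lam n = 0.
Proof.
move=> In; pose w := \prod_(i | i != i0) ('X - (a i)%:P).
have sw : (size w <= n)%N.
  apply: leq_trans In; rewrite /w -big_filter size_prod_XsubC.
  have -> : size [seq i <- index_enum I | i != i0] = #|I|.-1.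
    by rewrite -sum1_size big_filter sum1_card -(cardC1 i0).
  by rewrite prednK // (cardD1 i0).
have w0 : w.[0] != 0.
  by rewrite horner_prod; apply/prodf_neq0 => i /aN ai; rewrite hornerXsubC sub0r oppr_eq0.
have wi i : i != i0 -> w.[a i] = 0.
  by move=> ii; rewrite horner_prod (bigD1 i) //= hornerXsubC subrr mul0r.
have E u : coefA Lam n = \sum_(c : 'rV[F]_n) Lam (mon c + u *: w).
  rewrite /coefA (reindex (fun c : 'rV[F]_n => c + u *: poly_rV w)) /=.
    apply: eq_bigr => c _; congr Lam; rewrite /mon -addrA; congr (_ + _).
    by rewrite raddfD /= linearZ /= poly_rV_K.
  by exists (fun c => c - u *: poly_rV w) => c _; rewrite ?addrK ?subrK.
have : \sum_(u : F) coefA Lam n = 0.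
  under eq_bigr => u _ do rewrite (E u).
  rewrite exchange_big big1 //= => c _.
  have L u : Lam (mon c + u *: w) =
      X ((mon c).[0] + u * w.[0]) * \prod_(i | i != i0) X (mon c).[a i] ^+ e i.
    rewrite /Lam (bigD1 i0) //= e0 expr1 a0 hornerD hornerZ; congr (_ * _).
    by apply: eq_bigr => i ii; rewrite hornerD hornerZ wi // mulr0 addr0.
  under eq_bigr => u _ do rewrite L.
  rewrite -big_distrl /= (_ : \sum_u X ((mon c).[0] + u * w.[0]) = 0) ?mul0r //.
  rewrite -[RHS]sum_char [RHS](reindex (fun u => (mon c).[0] + u * w.[0])) //=.
  exists (fun u => (u - (mon c).[0]) / w.[0]) => u _.
    by rewrite addrC addKr mulfK.
  by rewrite mulfVK // addrC subrK.
rewrite sumr_const -mulr_natl => /eqP; rewrite mulf_eq0 pnatr_eq0 => /orP[|/eqP //].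
by rewrite (cardD1 0).
Qed.

(** The order of subtraction makes [Lam_XsubC] hold without a sign. *)
Definition numer : {poly F} := \prod_i ((a i)%:P - 'X) ^+ e i.

Lemma Lam_XsubC x : Lam ('X - x%:P) = X numer.[x].
Proof.
rewrite /Lam /numer horner_prod char_prod; apply: eq_bigr => i _.
by rewrite horner_exp charX !hornerE.
Qed.

End CharacterSums.

Section WeilBound.
Variables (R : realType) (F : finFieldType) (X : F -> R[i]).
Hypothesis hF : [pchar F].-nat #|F|.
Hypothesis XM : forall u v, X (u * v) = X u * X v.
Hypothesis X0 : X 0 = 0.
Hypothesis X1 : X 1 = 1.
Hypothesis Xnt : exists2 u, u != 0 & X u != 1.
Variables (I : finType) (a : I -> F) (e : I -> nat) (i0 : I).
Hypothesis (a0 : a i0 = 0) (e0 : e i0 = 1%N).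
Hypothesis aN : forall i, i != i0 -> a i != 0.

Local Notation q := #|F|.
Local Notation f := (numer a e).
Let m := (size f).-1.

Let h : {poly F} := - \prod_(i | i != i0) ((a i)%:P - 'X) ^+ e i.

Let fE : f = 'X * h.
Proof.
by rewrite /numer (bigD1 i0) //= a0 e0 expr1 sub0r mulrN mulNr.
Qed.

Let h0 : h.[0] != 0.
Proof.
rewrite hornerN oppr_eq0 horner_prod; apply/prodf_neq0 => i /aN ai.
by rewrite horner_exp expf_neq0 // !hornerE subr0.
Qed.

Let f_neq0 : f != 0.
Proof.
rewrite fE mulf_neq0 ?polyX_eq0 //.
by apply: contraNneq h0 => ->; rewrite horner0.
Qed.

Let q1 : (1 < q)%N. Proof. exact: finNzRing_gt1. Qed.

Section Extension.
Variables (K : finFieldType) (io : {rmorphism F -> K}) (mu : nat).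
Hypothesis hq : [pchar K].-nat q.
Hypothesis splits : forall P : {poly F}, P \is monic -> (size P <= (q ^ (2 * mu)).+1)%N ->
  exists rs, map_poly io P = \prod_(y <- rs) ('X - y%:P).
Hypothesis hmu : (2 * m + 2 < q ^ mu)%N.
Local Notation phi := (frob hq).
Let l := (q ^ mu)%N.
Let n := q.-1.
Let c := (\sum_(t < mu) q ^ t)%N.
Let fK := map_poly io f.

Let mu0 : (0 < mu)%N.
Proof. by case: (mu) hmu => //; rewrite expn0; lia. Qed.

Let lE : l = (n * c).+1.
Proof. by rewrite /l /n /c -predn_exp prednK // expn_gt0 ltnW. Qed.

(** This is the exponent of the norm to [F] from the field with [q ^ (2 * mu) = l ^ 2] elements. *)
Let cE : (\sum_(t < 2 * mu) q ^ t = c * l.+1)%N.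
Proof.
apply/eqP; rewrite -(@eqn_pmul2l n); last by rewrite /n -ltnS prednK // ltnW.
rewrite -predn_exp mulnA mul2n -addnn expnD -/l lE; apply/eqP; lia.
Qed.

Let lQ : (q ^ (2 * mu) = l ^ 2)%N. Proof. by rewrite mulnC expnM. Qed.

(** The norm of [f] at [x], written with the characteristic polynomial of [x] so as to be an element
    of [F]. *)
Let normx (x : K) := \prod_i (dcpoly io hq (2 * mu) x).[a i] ^+ e i.

Let fixedE x : (iter (2 * mu) phi x == x) = (x ^+ (l ^ 2) == x).
Proof. by rewrite iter_phi lQ. Qed.

Let norm_io x : x ^+ (l ^ 2) == x -> io (normx x) = fK.[x] ^+ (c * l.+1).
Proof.
rewrite -fixedE => /eqP hx; rewrite /normx rmorph_prod /=.
transitivity (\prod_i \prod_(t < 2 * mu) (io (a i) - iter t phi x) ^+ e i).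
  apply: eq_bigr => i _; rewrite rmorphXn /= -horner_map /= dcpolyE // /cpoly horner_prod.
  by rewrite -prodrXl; apply: eq_bigr => t _; rewrite hornerXsubC.
rewrite exchange_big /= -cE expr_sum; apply: eq_bigr => t _.
have fphi P : map_poly phi (map_poly io P) = map_poly io P.
  by rewrite -map_poly_comp; apply: eq_map_poly => u /=; rewrite /frob -rmorphXn /= expf_card.
have -> : fK.[x] ^+ (q ^ t) = fK.[iter t phi x].
  rewrite -iter_phi; elim: (t : nat) => //= k ->.
  by rewrite -[fK in RHS]fphi horner_map.
rewrite /fK /numer rmorph_prod horner_prod; apply: eq_bigr => i _.
by rewrite rmorphXn rmorphB /= map_polyX map_polyC /= horner_exp !hornerE.
Qed.

Let Nu (u : F) := #|[pred x : K | (x ^+ (l ^ 2) == x) && (normx x == u)]|.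

Let hl : [pchar K].-nat l. Proof. by rewrite pnatX hq. Qed.

Let c0 : (0 < c)%N.
Proof. by rewrite /c; case: (mu) mu0 => // k _; rewrite big_ord_recl addn_gt0 expn0. Qed.

Let n0 : (0 < n)%N. Proof. by rewrite /n -ltnS prednK // ltnW. Qed.

Let B := (c * l + (2 * m + 2) * l)%N.

Let fKE : fK = 'X * map_poly io h.
Proof. by rewrite /fK fE rmorphM /= map_polyX. Qed.

Let Nu_le u : u != 0 -> (Nu u <= B)%N.
Proof.
move=> u0.
have sK : size ('X * map_poly io h) = m.+1.
  by rewrite -fKE size_map_poly /m prednK // size_poly_gt0.
have hK0 : (map_poly io h).[0] != 0 by rewrite -[X in _.[X]](rmorph0 io) horner_map fmorph_eq0.
apply: leq_trans (stepanov (io u) hl n0 c0 lE hK0 sK hmu).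
apply/subset_leq_card/fintype.subsetP => x; rewrite !inE -fKE => /andP[xl /eqP nx].
have := norm_io xl; rewrite nx xl => <-; rewrite eqxx andbT /=.
apply: contraNneq u0 => fx0; rewrite -(fmorph_eq0 io) -nx norm_io // fx0.
by rewrite expf_eq0 eqxx andbT muln_gt0 c0.
Qed.

(** A point of the field with [l ^ 2] elements which is not one of the at most [m] zeros of [f] lies
    in a fibre over some [u != 0]. *)
Let sum_Nu : (l ^ 2 - m <= \sum_(u | u != 0%R) Nu u)%N.
Proof.
pose A := [pred x : K | (x ^+ (l ^ 2) == x) && (fK.[x] != 0)].
have -> : (\sum_(u | u != 0%R) Nu u = #|A|)%N.
  rewrite -sum1_card (partition_big normx (fun u => u != 0%R)) /=; last first.
    move=> x /andP[xl fx]; rewrite -(fmorph_eq0 io) norm_io // expf_neq0 //.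
  apply: eq_bigr => u u0; rewrite /Nu -sum1_card; apply: eq_bigl => x; rewrite !inE.
  case: (boolP (_ == x)) => //= xl; case: eqP => [nx|]; last by rewrite andbF.
  rewrite andbT; apply/esym; apply: contraNneq u0 => fx0.
  rewrite -(fmorph_eq0 io) -nx norm_io // fx0.
  by rewrite expf_eq0 eqxx andbT muln_gt0 c0.
have cQ : #|[pred x : K | x ^+ (l ^ 2) == x]| = (l ^ 2)%N.
  apply: (@card_frob_fixed F K io (l ^ 2)%N); first by rewrite pnatX hl.
    by rewrite lE; nia.
  apply: splits.
    rewrite monicE lead_coefDl ?lead_coefXn // size_polyN size_polyX size_polyXn ltnS.
    by rewrite lE; nia.
  rewrite lQ size_polyDl ?size_polyXn // size_polyN size_polyX ltnS lE; nia.
rewrite leq_subLR -{1}cQ -(cardID [pred x | fK.[x] != 0%R]) addnC leq_add //.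
rewrite cardE -ltnS /m prednK ?size_poly_gt0 // -(size_map_poly io) -/fK.
apply: max_poly_roots; last exact: enum_uniq.
  by rewrite map_poly_eq0.
by apply/allP => x; rewrite mem_enum !inE negbK => /andP[].
Qed.

(** As the sum of [X] vanishes, [B] may be subtracted from every [Nu u]. All the differences then
    have the same sign, so their absolute values add up to [n * B] minus the number of points, where
    the terms in [l ^ 2] cancel. *)
Lemma nm_powS_le : nm (powS io hq (Lam X a e) (2 * mu)) <= (m + n * (2 * m + 2))%:R * l%:R.
Proof.
have LE x : Lam X a e (dcpoly io hq (2 * mu) x) = X (normx x).
  by rewrite /Lam /normx (char_prod XM X1); apply: eq_bigr => i _; rewrite (charX XM X1).
have -> : powS io hq (Lam X a e) (2 * mu) = \sum_(u | u != 0) X u * ((Nu u)%:R - B%:R).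
  under [RHS]eq_bigr => u _ do rewrite mulrBr.
  rewrite sumrB -big_distrl /=.
  have -> : \sum_(u | u != 0) X u = 0.
    by rewrite -[RHS](sum_char XM Xnt) [RHS](bigD1 0) //= X0 add0r.
  rewrite mul0r subr0 /powS (eq_bigl _ _ fixedE).
  rewrite (partition_big normx predT) //= (bigD1 0) //= big1 ?add0r; last first.
    by move=> x /andP[_ /eqP nx]; rewrite LE nx X0.
  apply: eq_bigr => u u0; rewrite (eq_bigr (fun=> X u)).
    by rewrite sumr_const mulr_natr.
  by move=> x /andP[_ /eqP nx]; rewrite LE nx.
apply: le_trans (nm_sum _ _ _) _.
apply: (@le_trans _ _ (\sum_(u | u != 0) (B%:R - (Nu u)%:R))).
  apply: ler_sum => u u0; rewrite nmM -[nm (_ - _)]nmN opprB -!natrB ?Nu_le // nm_nat.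
  by rewrite ler_piMl ?ler0n // nm_char_le1.
rewrite sumrB sumr_const (_ : #|_| = n); last exact: (cardC1 (0 : F)).
rewrite -natr_sum -[B%:R *+ n]mulr_natr -!natrM lerBlDr -natrD ler_nat.
have := sum_Nu; have : (B * n + l = (l + n * (2 * m + 2)) * l)%N.
  by rewrite /B; move: lE; clear; nia.
have : (l <= l ^ 2)%N by rewrite lE; nia.
have : (m <= m * l)%N by rewrite lE; nia.
rewrite -mulnn; clear; move: (\sum_(_ | _) _)%N (B * n)%N => s b; nia.
Qed.

End Extension.
Let A := coefA (Lam X a e).

(** The L-function is a polynomial of degree below [#|I|] with constant term [1]; [rs] consists of
    the inverses of its roots. *)
Let Lfactor : exists2 rs : seq R[i], (size rs < #|I|)%N &
  forall n, A n = (\prod_(w <- rs) (1 - w%:P * 'X))`_n.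
Proof.
pose p := \poly_(n < #|I|) A n.
have I0 : (0 < #|I|)%N by rewrite (cardD1 i0).
have p0 : p.[0] = 1 by rewrite horner_coef0 coef_poly I0 /A coefA0.
have pn0 : p != 0 by apply: contraTneq (oner_neq0 R[i]) => p00; rewrite -p0 p00 horner0 eqxx.
have [zs Ep] := closed_field_poly_normal p.
have z0 z : z \in zs -> z != 0.
  move=> zzs; apply: contra_eq_neq p0 => z00; rewrite Ep hornerZ.
  have /eqP -> : root (\prod_(z <- zs) ('X - z%:P)) 0 by rewrite root_prod_XsubC -z00.
  by rewrite mulr0 eq_sym oner_neq0.
have E : p = \prod_(w <- [seq z^-1 | z <- zs]) (1 - w%:P * 'X).
  rewrite big_map; have E1 : \prod_(z <- zs) ('X - z%:P) =
      (\prod_(z <- zs) - z) *: \prod_(z <- zs) (1 - (z^-1)%:P * 'X).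
    elim: zs z0 {Ep} => [|z s IH] z0; first by rewrite !big_nil scale1r.
    rewrite !big_cons IH => [|y ys]; last by rewrite z0 // inE ys orbT.
    have -> : 'X - z%:P = - z *: (1 - (z^-1)%:P * 'X).
      rewrite -mul_polyC mulrBr mulr1 mulrA -polyCM mulNr mulfV ?z0 ?mem_head //.
      by rewrite !polyCN polyC1 mulN1r opprK addrC.
    by rewrite -scalerAl -scalerAr scalerA.
  move: p0; rewrite Ep E1 scalerA hornerZ horner_prod.
  under [X in _ * X]eq_bigr => z _ do rewrite hornerD hornerN hornerM hornerX mulr0 subr0 hornerC.
  by rewrite big1_eq mulr1 => ->; rewrite scale1r.
exists [seq z^-1 | z <- zs].
  have := size_poly #|I| A; rewrite -/p Ep size_scale ?lead_coef_eq0 //.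
  by rewrite size_prod_XsubC size_map.
move=> n; rewrite -E coef_poly; case: ltnP => // In.
by rewrite /A (coefA_eq0 XM Xnt a0 e0 aN In).
Qed.

Lemma weil_simple_zero : nm (\sum_x X f.[x]) <= (#|I|.-1)%:R * Num.sqrt q%:R.
Proof.
have [rs srs Ars] := Lfactor.
have A00 : A 0%N = 1 by rewrite /A coefA0.
have psE n : n%:R * A n = \sum_(1 <= k < n.+1) (- \sum_(w <- rs) w ^+ k) * A (n - k)%N.
  by rewrite Ars newton_power_sums; apply: eq_bigr => k _; rewrite Ars.
(* The bound for [powS] concerns even degrees, hence the squares of the inverse roots, which will be
   shown to have modulus at most [q]. *)
have bnd mu : (2 * m + 3 <= mu)%N ->
    nm (\sum_(v <- [seq w ^+ 2 | w <- rs]) v ^+ mu) <= (m + q.-1 * (2 * m + 2))%:R * q%:R ^+ mu.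
  move=> hmu; have [K [io spl]] := exists_splitting_field F (q ^ (2 * mu)).
  have hq : [pchar K].-nat q by rewrite (eq_pnat _ (fmorph_pchar io)).
  have qmu : (mu < q ^ mu)%N by apply: ltn_expl.
  have q2mu : (2 * mu <= q ^ (2 * mu))%N by apply/ltnW/ltn_expl.
  have := nm_powS_le hq spl (leq_trans (_ : 2 * m + 2 < mu)%N (ltnW qmu)).
  rewrite -addn1 -addnA => /(_ hmu).
  rewrite (_ : powS _ _ _ _ = - \sum_(w <- rs) w ^+ (2 * mu)).
    by rewrite nmN natrX big_map; under [X in nm X]eq_bigr => w _ do rewrite exprM.
  apply: (@power_sums_unique _ A (powS io hq (Lam X a e)) (fun k => - \sum_(w <- rs) w ^+ k) (2 * mu)%N A00) => [n /andP[n0 hn]|n _|].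
  - apply: newton => [P Q|c]; first exact: LamM.
    by apply: spl; rewrite ?mon_monic // size_mon ltnS (leq_trans hn).
  - exact: psE.
  - by lia.
have q0 : 0 < q%:R :> R by rewrite ltr0n ltnW.
have wq w : w \in rs -> nm w <= Num.sqrt q%:R.
  move=> wrs; rewrite -[nm w]ger0_norm ?nm_ge0 // -sqrtr_sqr ler_wsqrtr // -nmX.
  by apply: (power_sum_bound q0 bnd); apply: map_f.
have -> : \sum_x X f.[x] = A 1%N.
  by rewrite /A coefA1; apply: eq_bigr => x _; rewrite Lam_XsubC.
have := psE 1%N; rewrite big_nat1 subnn A00 mul1r mulr1 => ->; rewrite nmN.
apply: le_trans (nm_sum _ _ _) _.
apply: (@le_trans _ _ (\sum_(w <- rs) Num.sqrt q%:R)).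
  by rewrite !big_seq; apply: ler_sum => w /wq; rewrite expr1.
rewrite big_const_seq count_predT iter_addr_0 -[Num.sqrt _ *+ _]mulr_natl ler_wpM2r ?sqrtr_ge0 // ler_nat.
by rewrite -ltnS prednK // (leq_trans _ srs).
Qed.

End WeilBound.

(** * Products of shifted values of a character and of its conjugate *)

Section WeilShifted.
Variables (R : realType) (F : finFieldType).
Hypothesis hF : [pchar F].-nat #|F|.
Variables (I : finType) (v : I -> F) (i0 : I).
Hypothesis vN : forall i, i != i0 -> v i != v i0.

Definition sconj (b : bool) (z : R[i]) : R[i] := if b then z else z^*%C.

(** A conjugated value is the value at the inverse, that is at the power [#|F| - 2]. Conjugations
    thus become exponents [e], while the isolated factor, which is not conjugated, remains a simple
    zero. *)
Let weil_true (X : F -> R[i]) (b : I -> bool) :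
  (forall u w, X (u * w) = X u * X w) -> X 0 = 0 -> X 1 = 1 ->
  (exists2 u, u != 0 & X u != 1) -> b i0 ->
  nm (\sum_x \prod_i sconj (b i) (X (x + v i))) <= (#|I|.-1)%:R * Num.sqrt (#|F|)%:R.
Proof.
move=> XM X0 X1 Xnt bi0.
pose a i := v i - v i0; pose e i := if b i then 1%N else #|F|.-2.
have a0 : a i0 = 0 by rewrite /a subrr.
have e0 : e i0 = 1%N by rewrite /e bi0.
have aN i : i != i0 -> a i != 0 by move=> /vN; rewrite subr_eq0.
apply: le_trans (weil_simple_zero hF XM X0 X1 Xnt a0 e0 aN).
rewrite le_eqVlt; apply/orP; left; apply/eqP; congr nm.
(* A nontrivial character needs a unit other than [1]. The exponent [#|F| - 2] is then positive, so
   the power also vanishes at [0], as the conjugate does. *)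
have F2 : (2 < #|F|)%N.
  case: Xnt => u u0 Xu; have u1 : u != 1 by apply: contraNneq Xu => ->; rewrite X1.
  by rewrite (cardD1 0) (cardD1 1) (cardD1 u) !inE oner_neq0 u0 u1.
have [k Fk] : exists k, #|F| = k.+3 by exists (#|F| - 3)%N; move: F2; clear; lia.
have XeE u i : sconj (b i) (X u) = X (u ^+ e i).
  rewrite /e /sconj; case: (b i); first by rewrite expr1.
  rewrite Fk /=; have [->|u0] := eqVneq u 0; first by rewrite expr0n X0 rmorph0.
  have uq : u ^+ k.+2 = 1.
    by apply: (mulfI u0); rewrite -exprS -Fk expf_card mulr1.
  have Xuq : X u * X (u ^+ k.+1) = 1 by rewrite -XM -exprS uq.
  have n1 : nm (X u) = 1.
    apply/le_anti/andP; split; first exact: nm_char_le1.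
    have := congr1 (@nm R) Xuq; rewrite nmM nm1 => <-.
    by rewrite ler_piMr ?nm_ge0 // nm_char_le1.
  have Xc : X u * (X u)^*%C = 1 by rewrite -sqr_nm n1 expr1n.
  have Xn0 : X u != 0 by rewrite -nm_eq0 n1 oner_neq0.
  by apply: (mulfI Xn0); rewrite Xuq.
(* With [x = - y - v i0], each [x + v i] becomes [a i - y], the shape of the factors of [numer]. *)
rewrite (reindex (fun y => - y - v i0)) /=.
  apply: eq_bigr => y _; rewrite /numer horner_prod (char_prod XM X1); apply: eq_bigr => i _.
  rewrite XeE horner_exp !hornerE /a; congr (X (_ ^+ _)); ring.
by exists (fun y => - y - v i0) => y _; rewrite opprD !opprK addrK.
Qed.

Lemma weil_bound (X : F -> R[i]) (b : I -> bool) :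
  (forall u w, X (u * w) = X u * X w) -> X 0 = 0 -> X 1 = 1 ->
  (exists2 u, u != 0 & X u != 1) ->
  nm (\sum_x \prod_i sconj (b i) (X (x + v i))) <= (#|I|.-1)%:R * Num.sqrt (#|F|)%:R.
Proof.
move=> XM X0 X1 [u u0 Xu]; case: (boolP (b i0)) => bi.
  by apply: weil_true => //; exists u.
pose X' w := (X w)^*%C.
have E : \sum_x \prod_i sconj (b i) (X (x + v i)) = \sum_x \prod_i sconj (~~ b i) (X' (x + v i)).
  by apply: eq_bigr => x _; apply: eq_bigr => i _; rewrite /sconj /X'; case: (b i); rewrite //= conjcK.
rewrite E; apply: weil_true => //.
- by move=> w t; rewrite /X' XM rmorphM.
- by rewrite /X' X0 rmorph0.
- by rewrite /X' X1 rmorph1.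
- by exists u => //; apply: contraNneq Xu => h; rewrite -[X u]conjcK -/(X' u) h rmorph1.
Qed.

End WeilShifted.

(** * Complete sums modulo a squarefree number *)

Section DirichletCharacters.
Variables (R : realType) (q : nat) (chi : int -> R[i]).
Hypothesis hchi : dirichlet_character q chi.

Lemma dir_gt0 : (0 < q)%N. Proof. by case: hchi. Qed.
Lemma dir1 : chi 1 = 1. Proof. by case: hchi. Qed.
Lemma dirM m n : chi (m * n) = chi m * chi n. Proof. by case: hchi. Qed.
Lemma dir0 n : (chi n == 0) = ~~ coprimez n q%:Z.
Proof. by case: hchi => _ _ _ _ h; apply/eqP/idP => /h. Qed.

Lemma dir_per n k : chi (n + k * q%:Z) = chi n.
Proof.
have per m : chi (m + q%:Z) = chi m by case: hchi.
have perN (j : nat) m : chi (m + j%:Z * q%:Z) = chi m.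
  elim: j => [|j IH]; first by rewrite mul0r addr0.
  by rewrite -[RHS]IH -[RHS]per; congr chi; rewrite -addn1 PoszD; ring.
case: k => j; first exact: perN.
by rewrite -[LHS](perN j.+1) NegzE; congr chi; ring.
Qed.

Lemma dir_eqmod m n : (q%:Z %| m - n)%Z -> chi m = chi n.
Proof. by case/dvdzP => k h; rewrite -(subrK n m) h addrC dir_per. Qed.

Lemma dirX n k : chi (n ^+ k) = chi n ^+ k.
Proof. by elim: k => [|k IH]; rewrite ?expr0 ?dir1 // !exprS dirM IH. Qed.

(** The powers of [chi n] are again values of [chi], hence bounded by the sum of the moduli over a
    period. *)
Lemma nm_dir_le1 n : nm (chi n) <= 1.
Proof.
apply: (@exp_domination R _ 1 (\sum_(x < q) nm (chi x%:Z)) 0%N (nm_ge0 _) ltr01) => k _.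
rewrite expr1n mulr1 -nmX -dirX.
have q0 : q%:Z != 0 by rewrite eqz_nat -lt0n dir_gt0.
set m := n ^+ k; have mq := modz_ge0 m q0.
have ltq : (`|(m %% q%:Z)%Z|%N < q)%N.
  by rewrite -ltz_nat gez0_abs // ltz_pmod // ltz_nat dir_gt0.
have -> : chi m = chi (Ordinal ltq : nat)%:Z.
  by rewrite /= gez0_abs // {1}(divz_eq m q%:Z) addrC dir_per.
by rewrite (bigD1 (Ordinal ltq)) //= lerDl sumr_ge0 // => i _; apply: nm_ge0.
Qed.

Definition csum (I : finType) (b : I -> bool) (v : I -> int) : R[i] :=
  \sum_(x < q) \prod_i sconj (b i) (chi (x%:Z + v i)).

Lemma nm_sconj b (z : R[i]) : nm (sconj b z) = nm z.
Proof. by case: b => //=; apply: nm_conj. Qed.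

Lemma nm_csum_trivial (I : finType) (b : I -> bool) (v : I -> int) : nm (csum b v) <= q%:R.
Proof.
apply: le_trans (nm_sum _ _ _) _.
apply: (@le_trans _ _ (\sum_(x < q) 1)); last by rewrite sumr_const card_ord.
apply: ler_sum => x _; rewrite nm_prod; apply: prodr_ile1 => i _.
by rewrite nm_ge0 nm_sconj nm_dir_le1.
Qed.

End DirichletCharacters.

Lemma csum_prime (R : realType) (p : nat) (chi : int -> R[i]) (I : finType) (b : I -> bool)
    (v : I -> int) (i0 : I) :
  prime p -> dirichlet_character p chi ->
  (exists2 n, coprimez n p%:Z & chi n != 1) ->
  (forall i, i != i0 -> ~~ (p%:Z %| v i - v i0)%Z) ->
  nm (csum p chi b v) <= (#|I|.-1)%:R * Num.sqrt p%:R.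
Proof.
move=> pp hchi [n0 cn0 chin0] vN.
pose X (u : 'F_p) := chi (u : nat)%:Z.
have dvdE (m : int) : (p%:Z %| m)%Z = (m%:~R == 0 :> 'F_p).
  rewrite dvdzE; case: m => k /=.
    by rewrite -?pmulrn -(dvdn_pcharf (pchar_Fp pp)).
  by rewrite NegzE rmorphN oppr_eq0 -?pmulrn -(dvdn_pcharf (pchar_Fp pp)).
have XE m : chi m = X m%:~R.
  apply: (dir_eqmod hchi); rewrite dvdE rmorphB /= subr_eq0 eq_sym; apply/eqP.
  by rewrite -pmulrn natr_Zp.
have cF : #|'F_p| = p by rewrite card_Fp.
have hF : [pchar 'F_p].-nat #|'F_p|.
  by rewrite cF pnatE // pchar_Fp.
have := @weil_bound R 'F_p hF I (fun i => (v i)%:~R) i0.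
have vN' i : i != i0 -> (v i)%:~R != (v i0)%:~R :> 'F_p.
  by move=> /vN; rewrite dvdE rmorphB /= subr_eq0.
move=> /(_ vN' X b); rewrite cF.
have XM u w : X (u * w) = X u * X w.
  by rewrite -(dirM hchi) XE; congr X; rewrite -PoszM -[RHS]pmulrn natrM !natr_Zp.
have X0 : X 0 = 0 by apply/eqP; rewrite /X (dir0 hchi) /coprimez gcd0z /=; apply/eqP => -[]; move: pp; case: (p) => [|[]].
have X1 : X 1 = 1 by rewrite -(dir1 hchi) XE.
have Xn : exists2 u, u != 0 & X u != 1.
  exists n0%:~R; last by rewrite -XE.
  rewrite -dvdE; apply: contraL cn0 => /dvdzP[k ->].
  by rewrite coprimezMl negb_and [in X in _ || X]/coprimez gcdzz; move: pp; case: (p) => [|[|k']] //; rewrite orbT.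
move=> /(_ XM X0 X1 Xn); congr (nm _ <= _).
pose G (x : nat) := \prod_i sconj (b i) (chi (x%:Z + v i)).
transitivity (\sum_(x : 'F_p) G x).
  apply: eq_bigr => x _; apply: eq_bigr => i _; rewrite XE; congr (sconj _ (X _)).
  by rewrite rmorphD /= -pmulrn natr_Zp.
have <- : \sum_(0 <= x < p) G x = csum p chi b v by rewrite big_mkord.
by rewrite -[X in index_iota 0 X](Fp_cast pp) big_mkord.
Qed.

(* For squarefree [q] this says that every [p]-component of [chi] is nontrivial. *)
Definition locally_nontrivial (R : realType) (q : nat) (chi : int -> R[i]) : Prop :=
  forall p : nat, prime p -> (p %| q)%N ->
  exists n : int, [/\ coprimez n q%:Z, ((q %/ p)%N%:Z %| n - 1)%Z & chi n != 1].

(** If [chi] were [1] at every [n] coprime to [q] with [n = 1] modulo [q / p], then multiplying by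
    an inverse [w] of [n] would show that [chi] depends only on the class modulo [q / p]. *)
Lemma primitive_locally_nontrivial (R : realType) (q : nat) (chi : int -> R[i]) :
  primitive_character q chi -> locally_nontrivial q chi.
Proof.
case=> hchi hprim p pp pq; apply: contrapT => hn; apply: hprim.
have q0 := dir_gt0 hchi.
exists (q %/ p)%N; split; [exact: dvdn_div | by rewrite ltn_Pdiv ?prime_gt1 |].
move=> m n cm cn; rewrite eqz_mod_dvd => mn.
have [w [_ nw]] : exists w, True /\ (q%:Z %| n * w - 1)%Z.
  have [u [w h]] := Bezoutz n q%:Z; exists u; split=> //.
  move: cn; rewrite /coprimez => /eqP g1; rewrite -g1 -h; apply/dvdzP; exists (- w); ring.
have cw : coprimez w q%:Z.
  apply/coprimezP; case/dvdzP: nw => k hk; exists (n, - k); rewrite /=.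
  by rewrite mulNr -hk; ring.
have E : chi (m * w) = 1.
  apply/eqP; apply: contra_notT hn => hmw; exists (m * w); split=> //.
    by rewrite coprimezMl cm.
  have -> : m * w - 1 = (m - n) * w + (n * w - 1) by ring.
  rewrite rpredD ?dvdz_mulr //; apply: dvdz_trans nw.
  by rewrite dvdzE /= dvdn_div.
have En : chi (n * w) = 1 by rewrite -(dir1 hchi); apply: (dir_eqmod hchi).
have : chi w != 0 by rewrite (dir0 hchi) negbK.
by move=> /mulIf; apply; rewrite -!(dirM hchi) E En.
Qed.

Lemma sum_chinese (C : comNzRingType) (p q : nat) (H1 H2 : nat -> C) :
  (0 < p)%N -> (0 < q)%N -> coprime p q ->
  (forall x, H1 (x %% p)%N = H1 x) -> (forall x, H2 (x %% q)%N = H2 x) ->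
  \sum_(x < p * q) H1 x * H2 x = (\sum_(x < p) H1 x) * (\sum_(x < q) H2 x).
Proof.
move=> p0 q0 cpq h1 h2; rewrite big_distrlr pair_big /=.
pose f (x : 'I_(p * q)) : 'I_p * 'I_q :=
  (Ordinal (ltn_pmod x p0), Ordinal (ltn_pmod x q0)).
have finj : injective f.
  move=> x y [/eqP hp /eqP hq]; apply: val_inj => /=.
  have := chinese_remainder cpq x y; rewrite hp hq /= => /eqP.
  by rewrite !modn_small.
have fbij : bijective f.
  by apply: inj_card_bij => //; rewrite card_prod !card_ord.
rewrite (reindex f) /=; last exact: onW_bij.
by apply: eq_bigr => x _ /=; rewrite h1 h2.
Qed.

(** By Bezout [E1] is [1] modulo [p] and [0] modulo [q], and [E2] the reverse, so [n * E1 + E2] is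
    [n] modulo [p] and [1] modulo [q]; [chi1] is [chi] at this number. *)
Lemma dir_split (R : realType) (p q : nat) (chi : int -> R[i]) :
  (0 < p)%N -> (0 < q)%N -> coprime p q -> dirichlet_character (p * q) chi ->
  exists chi1 : int -> R[i], dirichlet_character p chi1 /\
  forall n m, (q%:Z %| m - 1)%Z -> (p%:Z %| m - n)%Z -> chi m = chi1 n.
Proof.
move=> p0 q0 cpq hchi.
have [u [w h]] := Bezoutz p%:Z q%:Z.
move: cpq; rewrite -(coprimezE p%:Z q%:Z) /coprimez => /eqP g1; rewrite g1 in h.
pose E1 := w * q%:Z; pose E2 := u * p%:Z.
have E12 : E2 = 1 - E1 by rewrite -h /E1 /E2; ring.
have cong a b : (p%:Z %| a - b)%Z -> (q%:Z %| a - b)%Z -> chi a = chi b.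
  move=> ha hb; apply: (dir_eqmod hchi); rewrite PoszM Gauss_dvdz ?ha //.
  by rewrite coprimezE -coprimezE /coprimez g1.
have p2 : (p%:Z %| E2)%Z by apply: dvdz_mull.
have q1 : (q%:Z %| E1)%Z by apply: dvdz_mull.
pose chi1 n := chi (n * E1 + E2).
have key n m : (q%:Z %| m - 1)%Z -> (p%:Z %| m - n)%Z -> chi m = chi1 n.
  move=> hq hp; apply: cong.
    have -> : m - (n * E1 + E2) = (m - n) + (n - 1) * E2 by rewrite E12; ring.
    by rewrite rpredD // dvdz_mull.
  have -> : m - (n * E1 + E2) = (m - 1) + (1 - n) * E1 by rewrite E12; ring.
  by rewrite rpredD // dvdz_mull.
exists chi1; split=> //; split=> //.
- by rewrite /chi1 mul1r E12 addrC subrK (dir1 hchi).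
- move=> m n; rewrite /chi1 -(dirM hchi); apply: cong.
    have -> : m * n * E1 + E2 - (m * E1 + E2) * (n * E1 + E2) = (m * n - m - n + 1) * E1 * E2.
      by rewrite E12; ring.
    by rewrite dvdz_mull.
  have -> : m * n * E1 + E2 - (m * E1 + E2) * (n * E1 + E2) = (m * n - m - n + 1) * E2 * E1.
    by rewrite E12; ring.
  by rewrite dvdz_mull.
- move=> n; apply: cong.
    have -> : (n + p%:Z) * E1 + E2 - (n * E1 + E2) = E1 * p%:Z by ring.
    exact: dvdz_mull.
  have -> : (n + p%:Z) * E1 + E2 - (n * E1 + E2) = p%:Z * E1 by ring.
  exact: dvdz_mull.
- move=> n; have := dir0 hchi (n * E1 + E2); rewrite -/(chi1 n) PoszM coprimezMr.
  have cmod (a b : int) (k : nat) : (k%:Z %| a - b)%Z -> coprimez a k = coprimez b k.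
    rewrite -eqz_mod_dvd => /eqP hab.
    by rewrite /coprimez -gcdz_modl hab gcdz_modl.
  have -> : coprimez (n * E1 + E2) p%:Z = coprimez n p%:Z.
    apply: cmod; have -> : n * E1 + E2 - n = (1 - n) * E2 by rewrite E12; ring.
    exact: dvdz_mull.
  have -> : coprimez (n * E1 + E2) q%:Z = true.
    rewrite (cmod _ 1); first by rewrite coprimezE coprime1n.
    have -> : n * E1 + E2 - 1 = (n - 1) * E1 by rewrite E12; ring.
    exact: dvdz_mull.
  rewrite andbT => <-; split=> [->|/eqP //].
  by rewrite eqxx.
Qed.

Lemma dir_factor (R : realType) (p q : nat) (chi : int -> R[i]) :
  (0 < p)%N -> (0 < q)%N -> coprime p q -> dirichlet_character (p * q) chi ->
  exists chi1 chi2 : int -> R[i],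
  [/\ dirichlet_character p chi1, dirichlet_character q chi2,
      forall n, chi n = chi1 n * chi2 n,
      forall n, (q%:Z %| n - 1)%Z -> chi n = chi1 n &
      forall n, (p%:Z %| n - 1)%Z -> chi n = chi2 n].
Proof.
move=> p0 q0 cpq hchi.
have [chi1 [h1 k1]] := dir_split p0 q0 cpq hchi.
have hchi' : dirichlet_character (q * p) chi by rewrite mulnC.
have cqp : coprime q p by rewrite coprime_sym.
have [chi2 [h2 k2]] := dir_split q0 p0 cqp hchi'.
have cz : coprimez p%:Z q%:Z by rewrite coprimezE.
exists chi1, chi2; split=> // [n|n hn|n hn].
- pose m1 := zchinese p%:Z q%:Z n 1; pose m2 := zchinese p%:Z q%:Z 1 n.
  have a1 : (p%:Z %| m1 - n)%Z by rewrite -eqz_mod_dvd; apply/eqP/zchinese_modl.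
  have a2 : (q%:Z %| m1 - 1)%Z by rewrite -eqz_mod_dvd; apply/eqP/zchinese_modr.
  have a3 : (p%:Z %| m2 - 1)%Z by rewrite -eqz_mod_dvd; apply/eqP/zchinese_modl.
  have a4 : (q%:Z %| m2 - n)%Z by rewrite -eqz_mod_dvd; apply/eqP/zchinese_modr.
  rewrite -(k1 n m1 a2 a1) -(k2 n m2 a3 a4) -(dirM hchi); apply/esym/(dir_eqmod hchi).
  rewrite PoszM Gauss_dvdz //; apply/andP; split.
    have -> : m1 * m2 - n = (m1 - n) * m2 + n * (m2 - 1) by ring.
    by apply: rpredD; [apply: dvdz_mulr | apply: dvdz_mull].
  have -> : m1 * m2 - n = (m1 - 1) * m2 + (m2 - n) by ring.
  by rewrite rpredD // dvdz_mulr.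
- by rewrite (k1 n n hn) ?subrr ?dvdz0.
- by rewrite (k2 n n hn) ?subrr ?dvdz0.
Qed.

Lemma squarefreeM (p q : nat) : prime p -> squarefree (p * q) ->
  [/\ (0 < q)%N, coprime p q & squarefree q].
Proof.
move=> pp [pq0 sf]; have q0 : (0 < q)%N by move: pq0; rewrite muln_gt0 => /andP[].
split=> //.
  rewrite prime_coprime //; apply: contra (sf p pp) => /dvdnP[k ->].
  by rewrite [(k * p)%N]mulnC mulnA dvdn_mulr.
split=> // p' pp'; apply: contra (sf p' pp') => h.
exact: dvdn_mull.
Qed.

Lemma perm_primesM (p q : nat) : prime p -> (0 < q)%N -> coprime p q ->
  perm_eq (primes (p * q)) (p :: primes q).
Proof.
move=> pp q0 cpq; apply: uniq_perm; rewrite ?primes_uniq //=.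
  rewrite primes_uniq andbT mem_primes pp q0 /= -prime_coprime //.
move=> x; rewrite inE primesM ?(prime_gt0 pp) //.
by rewrite (primes_prime pp) inE.
Qed.

(** The sum factors over the primes of [q]. Where [v i0] meets another shift modulo [p], the zero is
    no longer simple and only the trivial bound [p] is available. *)
Lemma csum_squarefree (R : realType) (I : finType) (b : I -> bool) (v : I -> int) (i0 : I)
    (q : nat) : forall chi : int -> R[i], squarefree q -> dirichlet_character q chi ->
  locally_nontrivial q chi ->
  nm (csum q chi b v) <= \prod_(p <- primes q)
    (if [exists i, (i != i0) && (p%:Z %| v i - v i0)%Z] then p%:R
     else (#|I|)%:R * Num.sqrt p%:R).
Proof.
elim/ltn_ind: q => q IH chi sf hchi hnt.
have [q1|q1] := leqP q 1.
  have -> : primes q = [::] by move: q1; case: (q) => [|[|]].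
  rewrite big_nil; apply: le_trans (nm_csum_trivial hchi b v) _.
  by rewrite (ler_nat R q 1).
pose p := pdiv q; have pp : prime p by apply: pdiv_prime.
pose q' := (q %/ p)%N; have qE : q = (p * q')%N by rewrite mulnC divnK ?pdiv_dvd.
have [q0' cpq sf'] : [/\ (0 < q')%N, coprime p q' & squarefree q'].
  by apply: squarefreeM => //; rewrite -qE.
have p0 := prime_gt0 pp.
have hchi' : dirichlet_character (p * q') chi by rewrite -qE.
have [chi1 [chi2 [h1 h2 h12 k1 k2]]] := dir_factor p0 q0' cpq hchi'.
have prdE : nm (csum q chi b v) = nm (csum p chi1 b v) * nm (csum q' chi2 b v).
  rewrite -nmM; congr nm.
  have P (d : nat) (psi : int -> R[i]) : dirichlet_character d psi -> forall x : nat,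
      \prod_i sconj (b i) (psi ((x %% d)%N%:Z + v i)) = \prod_i sconj (b i) (psi (x%:Z + v i)).
    move=> hpsi x; apply: eq_bigr => i _; congr sconj; apply: (dir_eqmod hpsi).
    have xe : x%:Z = (x %/ d)%N%:Z * d%:Z + (x %% d)%N%:Z by rewrite -PoszM -PoszD -divn_eq.
    have -> : (x %% d)%N%:Z + v i - (x%:Z + v i) = - (x %/ d)%N%:Z * d%:Z by rewrite xe; ring.
    by rewrite dvdz_mull.
  have -> : csum q chi b v = csum (p * q')%N chi b v by rewrite -qE.
  rewrite /csum -(sum_chinese p0 q0' cpq (P _ _ h1) (P _ _ h2)); apply: eq_bigr => x _.
  rewrite -big_split; apply: eq_bigr => i _; rewrite h12 /sconj /=.
  by case: (b i); rewrite ?rmorphM.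
rewrite prdE qE (perm_big _ (perm_primesM pp q0' cpq)) /= big_cons.
apply: ler_pM; rewrite ?nm_ge0 //.
  case: ifP => [_|/negbT/existsPn hv]; first exact: (nm_csum_trivial h1).
  apply: (@le_trans _ _ ((#|I|.-1)%:R * Num.sqrt p%:R)); last first.
    by rewrite ler_wpM2r ?sqrtr_ge0 // ler_nat leq_pred.
  apply: (@csum_prime R p chi1 I b v i0 pp h1) => [|i ii0]; last by have := hv i; rewrite ii0.
  have [n [cn dn chin]] := hnt p pp (pdiv_dvd q); exists n; last by rewrite -k1.
  by move: cn; rewrite qE PoszM coprimezMr => /andP[].
apply: IH => //.
  by rewrite /q' ltn_Pdiv // ?prime_gt1 // ltnW.
move=> r pr rq'; have rq : (r %| q)%N by rewrite qE dvdn_mull.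
have [n [cn dn chin]] := hnt r pr rq.
have dq : (q %/ r = p * (q' %/ r))%N by rewrite qE muln_divA.
(* The witness for [r] modulo [q] is [1] modulo [q / r], hence modulo [p], where the other component
   is then [1]: it witnesses nontriviality for [chi2] too. *)
rewrite dq PoszM in dn; exists n; split.
- by move: cn; rewrite qE PoszM coprimezMr => /andP[].
- by apply: dvdz_trans dn; apply: dvdz_mull.
- by rewrite -k2 //; apply: dvdz_trans dn; apply: dvdz_mulr.
Qed.

Lemma prod_primes_le (n : nat) : (0 < n)%N -> (\prod_(p <- primes n) p <= n)%N.
Proof.
move=> n0; rewrite {2}(prod_prime_decomp n0) prime_decompE big_map /=.
rewrite !big_seq; apply: leq_prod => p hp; move: (hp); rewrite mem_primes => /and3P[pp _ pn].
by rewrite -{1}[p]expn1 leq_exp2l ?prime_gt1 // logn_gt0.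
Qed.

Lemma prod_primes_squarefree (q : nat) : squarefree q -> (\prod_(p <- primes q) p)%N = q.
Proof.
move=> [q0 sf]; rewrite {2}(prod_prime_decomp q0) prime_decompE big_map /=.
apply: eq_big_seq => p hp; move: (hp); rewrite mem_primes => /and3P[pp _ pn].
suff -> : logn p q = 1%N by rewrite expn1.
apply/eqP; rewrite eqn_leq logn_gt0 hp andbT leqNgt.
by apply: contra (sf p pp) => h; rewrite mulnn pfactor_dvdn.
Qed.

(** * Divisor and greatest common divisor estimates *)

Lemma prod_primes_dvd_le (q h : nat) : (0 < q)%N ->
  (\prod_(p <- primes q) (if (p %| h)%N then p else 1) <= gcdn q h)%N.
Proof.
move=> q0; rewrite -big_mkcond -big_filter /=.
have g0 : (0 < gcdn q h)%N by rewrite gcdn_gt0 q0.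
apply: leq_trans (prod_primes_le g0); rewrite leq_eqVlt; apply/orP; left; apply/eqP.
apply: perm_big; apply: uniq_perm; rewrite ?filter_uniq ?primes_uniq // => p.
rewrite mem_filter !mem_primes q0 g0 dvdn_gcd /=.
by case: (prime p); case: (p %| q)%N; case: (p %| h)%N.
Qed.

Lemma sqrt_prodn (R : realType) (I : Type) (s : seq I) (F : I -> nat) :
  \prod_(i <- s) Num.sqrt (F i)%:R = Num.sqrt (\prod_(i <- s) F i)%:R :> R.
Proof.
elim: s => [|i s IH]; first by rewrite !big_nil sqrtr1.
by rewrite !big_cons IH natrM sqrtrM ?ler0n.
Qed.

(** At a prime with a collision, [p] is the product of two square roots of [p]: one completes the
    square root of [q], the other is absorbed by the gcds, which contain all such primes. *)
Lemma csum_bound (R : realType) (I : finType) (b : I -> bool) (v : I -> int) (i0 : I)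
    (q : nat) (chi : int -> R[i]) :
  squarefree q -> dirichlet_character q chi -> locally_nontrivial q chi ->
  nm (csum q chi b v) <= (#|I| ^ size (primes q))%:R * Num.sqrt q%:R *
    Num.sqrt (\prod_(i | i != i0) gcdn q `|v i - v i0|)%:R.
Proof.
move=> sf hchi hnt; apply: le_trans (csum_squarefree b v i0 sf hchi hnt) _.
have I0 : (0 < #|I|)%N by rewrite (cardD1 i0).
have q0 : (0 < q)%N by case: sf.
pose g (p : nat) := if [exists i, (i != i0) && (p%:Z %| v i - v i0)%Z] then p else 1%N.
apply: (@le_trans _ _ (\prod_(p <- primes q) ((#|I|)%:R * Num.sqrt p%:R * Num.sqrt (g p)%:R))).
  rewrite !big_seq; apply: ler_prod => p; rewrite mem_primes => /and3P[pp _ _].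
  rewrite /g; case: ifP => _; last by rewrite sqrtr1 mulr1 lexx andbT mulr_ge0 ?ler0n ?sqrtr_ge0.
  rewrite ler0n -mulrA -expr2 sqr_sqrtr ?ler0n //= ler_peMl ?ler0n //.
  by rewrite (ler_nat R 1).
rewrite !big_split /= big_const_seq count_predT iter_mulr_1 -natrX !sqrt_prodn.
rewrite prod_primes_squarefree // ler_wpM2l ?mulr_ge0 ?ler0n ?sqrtr_ge0 //.
rewrite ler_wsqrtr // ler_nat.
apply: (@leq_trans (\prod_(p <- primes q) \prod_(i | i != i0)
    (if (p %| `|v i - v i0|)%N then p else 1))%N).
  rewrite !big_seq; apply: leq_prod => p; rewrite mem_primes => /and3P[pp _ _].
  rewrite /g; case: ifP => [/existsP[i /andP[ii0 pi]]|_].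
    rewrite (bigD1 i) //=; move: pi; rewrite dvdzE /= => ->.
    rewrite leq_pmulr // prodn_gt0 // => j.
    by case: ifP => // _; apply: prime_gt0.
  by rewrite prodn_gt0 // => j; case: ifP => // _; apply: prime_gt0.
rewrite exchange_big /=; apply: leq_prod => i _; exact: prod_primes_dvd_le.
Qed.

Lemma size_divisors_squarefree (q : nat) : squarefree q ->
  (size (divisors q) <= 2 ^ size (primes q))%N.
Proof.
elim/ltn_ind: q => q IH sf; have q0 : (0 < q)%N by case: sf.
have [q1|q1] := leqP q 1; first by have -> : q = 1%N by lia.
pose p := pdiv q; have pp : prime p by apply: pdiv_prime.
pose q' := (q %/ p)%N; have qE : q = (p * q')%N by rewrite mulnC divnK ?pdiv_dvd.
have [q0' cpq sf'] : [/\ (0 < q')%N, coprime p q' & squarefree q'].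
  by apply: squarefreeM => //; rewrite -qE.
have IH' := IH q' (ltn_Pdiv (prime_gt1 pp) q0) sf'.
have -> : size (primes q) = (size (primes q')).+1.
  by rewrite qE (perm_size (perm_primesM pp q0' cpq)).
apply: (@leq_trans (size (divisors q' ++ [seq (p * d)%N | d <- divisors q']))).
  apply: uniq_leq_size; first exact: divisors_uniq.
  move=> d; rewrite -dvdn_divisors // mem_cat => dq.
  have [pd|pd] := boolP (p %| d)%N.
    apply/orP; right; apply/mapP; exists (d %/ p)%N; last by rewrite mulnC divnK.
    rewrite -dvdn_divisors // -(@dvdn_pmul2l p) ?prime_gt0 // -qE.
    by rewrite [(p * _)%N]mulnC divnK.
  have cdp : coprime d p by rewrite coprime_sym prime_coprime.
  by rewrite -dvdn_divisors //; move: dq; rewrite qE Gauss_dvdr // => ->.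
by rewrite size_cat size_map addnn -mul2n expnS leq_mul2l IH'.
Qed.

(** A gcd is at most the sum of the common divisors, and each divisor [d], weighted by [d],
    contributes at most [V] through its multiples. *)
Lemma sum_gcdn_le (q V : nat) : (0 < q)%N ->
  (\sum_(1 <= h < V) gcdn q h <= size (divisors q) * V)%N.
Proof.
move=> q0; case: V => [|V]; first by rewrite big_geq.
apply: (@leq_trans (\sum_(1 <= h < V.+1) \sum_(d <- divisors q) d * (d %| h))%N).
  rewrite !big_nat; apply: leq_sum => h /andP[h0 _].
  rewrite (big_rem (gcdn q h)) /=; last by rewrite -dvdn_divisors // dvdn_gcdl.
  by rewrite dvdn_gcdr muln1 leq_addr.
rewrite exchange_big /= -sum1_size big_distrl /=; apply: leq_sum => d _.
by rewrite -big_distrr /= -divn_count_dvd mul1n leqW // mulnC leq_trunc_div.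
Qed.

Lemma sum_gcdn_shift_le (q V a : nat) : (0 < q)%N -> (a < V)%N ->
  (\sum_(w < V | w != a :> nat) gcdn q `|w%:Z - a%:Z| <= 2 * (size (divisors q) * V))%N.
Proof.
move=> q0 aV; apply: leq_trans (leq_mul (leqnn 2) (sum_gcdn_le V q0)).
have le1 (P : pred 'I_V) : {in P &, forall x y, x = y} -> (#|P| <= 1)%N.
  by move=> h; apply/card_le1_eqP => x y hx hy; apply: h.
apply: (@leq_trans (\sum_(w < V | w != a :> nat) \sum_(1 <= h < V)
    ((w == a + h :> nat) + (w + h == a)) * gcdn q h)%N).
  apply: leq_sum => w wa; have wV := ltn_ord w.
  have hV : (`|w%:Z - a%:Z| \in index_iota 1 V)%N by rewrite mem_index_iota; lia.
  rewrite (big_rem _ hV) /=; apply: leq_trans (leq_addr _ _).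
  rewrite leq_pmull // addn_gt0 !lt0b; lia.
rewrite exchange_big big_distrr /=; apply: leq_sum => h _.
rewrite -big_distrl leq_mul2r big_split /=; apply/orP; right.
have S (P : pred 'I_V) : (\sum_(w < V | w != a :> nat) P w <= #|P|)%N.
  rewrite -big_mkcondr /= sum1_card; apply: subset_leq_card; apply/fintype.subsetP => w.
  by rewrite unfold_in => /andP[_ Pw]; rewrite unfold_in.
rewrite -[2%N]/(1 + 1)%N leq_add //.
  apply: leq_trans (S (fun w => w == a + h :> nat)%N) (le1 _ _) => x y.
  by rewrite !unfold_in => /eqP hx /eqP hy; apply: val_inj; rewrite /= hx hy.
apply: leq_trans (S (fun w => w + h == a)%N) (le1 _ _) => x y.
by rewrite !unfold_in => /eqP hx /eqP hy; apply: val_inj => /=; lia.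
Qed.

(** A prime with [p^eps >= A] pays for its own factor [A]; fewer primes than [P0] remain, and these
    go into the constant. *)
Lemma omega_bound (R : realType) (A : nat) (eps : R) : (0 < A)%N -> 0 < eps ->
  exists C : R, forall q : nat, (0 < q)%N -> (A ^ size (primes q))%:R <= C * q%:R `^ eps.
Proof.
move=> A0 eps0.
have [P0 hP] : exists P0 : nat, forall p : nat, (P0 <= p)%N -> A%:R <= p%:R `^ eps.
  have /archi_boundP h : 0 <= A%:R `^ (eps^-1) :> R by apply: powR_ge0.
  exists (Num.Def.archi_bound (A%:R `^ (eps^-1) : R)) => p hp.
  have E : A%:R = (A%:R `^ eps^-1) `^ eps :> R.
    by rewrite -powRrM mulVf ?lt0r_neq0 // powRr1.
  rewrite [leLHS]E; apply: ge0_ler_powR; rewrite ?nnegrE ?powR_ge0 ?ler0n ?(ltW eps0) //.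
  by apply: (le_trans (ltW h)); rewrite ler_nat.
exists (A ^ P0)%:R => q q0.
have -> : (A ^ size (primes q))%:R = \prod_(p <- primes q) A%:R :> R.
  by rewrite big_const_seq count_predT iter_mulr_1 natrX.
apply: (@le_trans _ _ (\prod_(p <- primes q) ((if (p < P0)%N then A%:R else 1) * p%:R `^ eps))).
  rewrite !big_seq; apply: ler_prod => p; rewrite mem_primes => /and3P[pp _ _].
  rewrite ler0n /=; case: ltnP => hp; last by rewrite mul1r hP.
  have : p%:R `^ 0 <= p%:R `^ eps :> R.
    by apply: ler_powR; rewrite ?(ltW eps0) // (ler_nat R 1) prime_gt0.
  by rewrite powRr0 => h; rewrite ler_peMr ?ler0n.
rewrite big_split /=; apply: ler_pM.
- by apply: prodr_ge0 => p _; case: ifP.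
- by apply: prodr_ge0 => p _; apply: powR_ge0.
- rewrite -big_mkcond -big_filter /= big_const_seq count_predT iter_mulr_1 -natrX ler_nat.
  rewrite leq_pexp2l //; apply: (@leq_trans (size (iota 0 P0))); last by rewrite size_iota.
  apply: uniq_leq_size; first by rewrite filter_uniq ?primes_uniq.
  by move=> p; rewrite mem_filter mem_iota => /andP[].
apply: (@le_trans _ _ ((\prod_(p <- primes q) p)%:R `^ eps)).
  elim: (primes q) => [|p s IH]; first by rewrite !big_nil powR1.
  by rewrite !big_cons natrM powRM ?ler0n // ler_wpM2l ?powR_ge0.
by apply: ge0_ler_powR; rewrite ?nnegrE ?ler0n ?(ltW eps0) // ler_nat prod_primes_le.
Qed.

(** * Moments of complete sums over solutions of the Vinogradov system *)

Lemma cauchy_schwarz_sum (R : realDomainType) (I : finType) (P : pred I) (a b : I -> R) :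
  (\sum_(i | P i) a i * b i) ^+ 2 <= (\sum_(i | P i) a i ^+ 2) * (\sum_(i | P i) b i ^+ 2).
Proof.
have : 0 <= \sum_(i | P i) \sum_(j | P j) (a i * b j - a j * b i) ^+ 2.
  by apply: sumr_ge0 => i _; apply: sumr_ge0 => j _; apply: sqr_ge0.
have -> : \sum_(i | P i) \sum_(j | P j) (a i * b j - a j * b i) ^+ 2 =
   ((\sum_(i | P i) a i ^+ 2) * (\sum_(i | P i) b i ^+ 2)
     - (\sum_(i | P i) a i * b i) ^+ 2) *+ 2.
  have E : \sum_(i | P i) \sum_(j | P j) a i ^+ 2 * b j ^+ 2 =
      (\sum_(i | P i) a i ^+ 2) * (\sum_(i | P i) b i ^+ 2) by rewrite big_distrlr.
  have E' : \sum_(i | P i) \sum_(j | P j) a j ^+ 2 * b i ^+ 2 =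
      (\sum_(i | P i) a i ^+ 2) * (\sum_(i | P i) b i ^+ 2) by rewrite exchange_big.
  rewrite mulrnBl mulr2n -{1}E -E' [in X in _ - X]expr2 big_distrlr /=.
  rewrite -sumrMnl -big_split -sumrB; apply: eq_bigr => i _.
  rewrite -sumrMnl -big_split -sumrB; apply: eq_bigr => j _ /=; ring.
by rewrite pmulrn_lge0 // subr_ge0.
Qed.

Section Tuples.
Variables (r V q : nat).
Hypothesis q0 : (0 < q)%N.
Local Notation tup := {ffun 'I_(r + r) -> 'I_V}.

Definition uniq_at (i0 : 'I_(r + r)) (v : tup) : bool := [forall i, (i != i0) ==> (v i != v i0)].

Lemma sum_gcdn_uniq (i0 : 'I_(r + r)) :
  (\sum_(v : tup | uniq_at i0 v) \prod_(i | i != i0) gcdn q `|(v i)%:Z - (v i0)%:Z|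
    <= V * (2 * (size (divisors q) * V)) ^ (r + r).-1)%N.
Proof.
(* With [a] the value of [v i0], the condition of isolation is put into vanishing factors, so that
   the sum over tuples becomes a product of sums over the coordinates. *)
pose F (a : 'I_V) (i : 'I_(r + r)) (w : 'I_V) : nat :=
  if i == i0 then (w == a) : nat else if w == a then 0%N else gcdn q `|w%:Z - a%:Z|.
apply: (@leq_trans (\sum_(v : tup) \sum_a \prod_i F a i (v i))%N).
  rewrite big_mkcond /=; apply: leq_sum => v _; case: ifP => // /forallP uv.
  rewrite (bigD1 (v i0)) //=; apply: leq_trans (leq_addr _ _).
  rewrite [X in (_ <= X)%N](bigD1 i0) //= /F !eqxx mul1n; apply: leq_prod => i ii0.
  by have := uv i; rewrite ii0 (negPf ii0) /= => /negPf ->.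
rewrite exchange_big /=; apply: (@leq_trans (\sum_(a : 'I_V) (2 * (size (divisors q) * V)) ^ (r + r).-1)%N).
  apply: leq_sum => a _; rewrite -bigA_distr_bigA (bigD1 i0) //=.
  have -> : (\sum_j F a i0 j = 1)%N.
    rewrite (bigD1 a) //= /F !eqxx big1 // => w wa; by rewrite (negPf wa).
  rewrite mul1n; apply: (@leq_trans (\prod_(i | i != i0) (2 * (size (divisors q) * V)))%N).
    apply: leq_prod => i ii0; apply: leq_trans (sum_gcdn_shift_le q0 (ltn_ord a)).
    rewrite [X in (_ <= X)%N]big_mkcond /=; apply: leq_sum => w _.
    by rewrite /F (negPf ii0) -val_eqE /=; case: eqP.
  by rewrite prod_nat_const (cardC1 i0) card_ord.
by rewrite sum_nat_const card_ord.
Qed.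

End Tuples.

(** Each value is taken at least twice, so there are at most [r] values and the tuple factors
    through ['I_r]. *)
Lemma card_no_uniq (r V : nat) : (0 < r)%N ->
  (#|[pred v : {ffun 'I_(r + r) -> 'I_V} | ~~ [exists i0, uniq_at i0 v]]| <= r ^ (r + r) * V ^ r)%N.
Proof.
case: r => // k _; set r := k.+1.
pose f (p : {ffun 'I_(r + r) -> 'I_r} * {ffun 'I_r -> 'I_V}) : {ffun 'I_(r + r) -> 'I_V} :=
  [ffun i => p.2 (p.1 i)].
apply: (@leq_trans #|[set f p | p in predT]|); last first.
  apply: leq_trans (leq_imset_card _ _) _.
  by rewrite card_prod !card_ffun !card_ord.
apply: subset_leq_card; apply/fintype.subsetP => v.
rewrite inE negb_exists => /forallP hv; apply/imsetP.
pose A := [set v i | i in predT].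
have cA : (#|A| <= r)%N.
  have : (\sum_(i : 'I_(r + r)) 1 = r + r)%N by rewrite sum1_card card_ord.
  rewrite (partition_big v (fun a => a \in A)) /=; last by move=> i _; apply: imset_f.
  move=> e; have : (\sum_(a in A) 2 <= \sum_(a in A) \sum_(i | v i == a) 1)%N.
    apply: leq_sum => a /imsetP[i0 _ ->].
    have := hv i0; rewrite negb_forall => /existsP[j]; rewrite negb_imply negbK => /andP[ji vj].
    by rewrite (bigD1 i0) //= (bigD1 j) //= vj.
  by rewrite e sum_nat_const muln2 addnn leq_double.
have v0 : 'I_V := v ord0.
exists ([ffun i => inord (index (v i) (enum A))], [ffun j : 'I_r => nth (v ord0) (enum A) j]) => //.
apply/ffunP => i; rewrite /f !ffunE /= inordK.
  by rewrite nth_index // mem_enum imset_f.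
apply: leq_trans cA; rewrite cardE index_mem mem_enum; exact: imset_f.
Qed.

Definition vmvt_sols (r d V : nat) : {set {ffun 'I_(r + r) -> 'I_V}} :=
  [set v : {ffun 'I_(r + r) -> 'I_V} |
     [forall i : 'I_d,
        (\sum_(j < r) (v (lshift r j)).+1 ^ i.+1 ==
         \sum_(j < r) (v (rshift r j)).+1 ^ i.+1)%N]].

Definition vals (r V : nat) (v : {ffun 'I_(r + r) -> 'I_V}) (i : 'I_(r + r)) : int :=
  (v i).+1%:Z.

(** The first term bounds the tuples without isolated coordinate. On the others [csum_bound] leaves
    the square root of a product of gcds; Cauchy-Schwarz separates it from the condition of being a
    solution, and the gcds are then averaged over all tuples with the given coordinate isolated. *)
Lemma moment_bound (R : realType) (r d V q : nat) (chi : int -> R[i])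
    (b : 'I_(r + r) -> bool) : (0 < r)%N ->
  squarefree q -> dirichlet_character q chi -> locally_nontrivial q chi ->
  \sum_(v in vmvt_sols r d V) nm (csum q chi b (vals v)) <=
    (r ^ (r + r) * V ^ r * q)%:R +
    (r + r)%:R * (((r + r) ^ size (primes q))%:R * Num.sqrt q%:R *
      (Num.sqrt (J r d V)%:R *
       Num.sqrt (V * (2 * (size (divisors q) * V)) ^ (r + r).-1)%:R)).
Proof.
move=> r0 sf hchi hnt; have q0 : (0 < q)%N by case: sf.
pose S (v : {ffun 'I_(r + r) -> 'I_V}) := nm (csum q chi b (vals v)).
have S0 v : 0 <= S v by apply: nm_ge0.
rewrite (bigID (fun v => [exists i0, uniq_at i0 v])) /= addrC lerD //.
  apply: (@le_trans _ _ (\sum_(v | ~~ [exists i0, uniq_at i0 v]) q%:R)).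
    rewrite big_mkcond [leRHS]big_mkcond /=; apply: ler_sum => v _.
    case: (v \in _) => /=; last by case: ifP.
    by case: ifP => // _; apply: nm_csum_trivial.
  rewrite sumr_const -[q%:R *+ _]mulr_natl -natrM ler_nat leq_mul2r.
  by rewrite card_no_uniq ?orbT.
apply: (@le_trans _ _ (\sum_(i0 : 'I_(r + r)) \sum_(v in vmvt_sols r d V | uniq_at i0 v) S v)).
  rewrite [leRHS](exchange_big_dep (mem (vmvt_sols r d V))) /=; last by move=> i v _ /andP[].
  rewrite [leLHS]big_mkcondr /=; apply: ler_sum => v vJ.
  case: existsP => [[i0 ui]|_]; last by apply: sumr_ge0.
  by rewrite (bigD1 i0) ?vJ //= lerDl sumr_ge0.
set B := (X in _ <= _ * X).
apply: (@le_trans _ _ (\sum_(i0 : 'I_(r + r)) B)); last first.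
  by rewrite sumr_const card_ord -[B *+ _]mulr_natl.
apply: ler_sum => i0 _.
pose G (v : {ffun 'I_(r + r) -> 'I_V}) := (\prod_(i | i != i0) gcdn q `|(v i)%:Z - (v i0)%:Z|)%N.
set K := (r + r)%N; set w := size (primes q).
apply: (@le_trans _ _ (\sum_(v in vmvt_sols r d V | uniq_at i0 v)
     ((K ^ w)%:R * Num.sqrt q%:R * Num.sqrt (G v)%:R))).
  apply: ler_sum => v _; rewrite /S.
  apply: le_trans (csum_bound b (vals v) i0 sf hchi hnt) _.
  rewrite card_ord /G le_eqVlt; apply/orP; left; apply/eqP; congr (_ * Num.sqrt _%:R).
  apply: eq_bigr => i _; congr (gcdn q (absz _)); rewrite /vals; lia.
rewrite -big_distrr /= /B ler_wpM2l ?mulr_ge0 ?ler0n ?sqrtr_ge0 //.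
rewrite -sqrtrM ?ler0n // -[leLHS]ger0_norm; last by apply: sumr_ge0 => v _; apply: sqrtr_ge0.
rewrite -sqrtr_sqr ler_wsqrtr //.
have := cauchy_schwarz_sum (fun v => (v \in vmvt_sols r d V) && uniq_at i0 v)
   (fun=> 1) (fun v => Num.sqrt (G v)%:R : R).
rewrite /=; under eq_bigr => v _ do rewrite mul1r.
move=> h; apply: le_trans h _; apply: ler_pM.
- by apply: sumr_ge0 => v _; apply: sqr_ge0.
- by apply: sumr_ge0 => v _; apply: sqr_ge0.
- rewrite expr1n sumr_const ler_nat; apply: subset_leq_card; apply/fintype.subsetP => v.
  by rewrite unfold_in => /andP[].
under eq_bigr => v _ do rewrite sqr_sqrtr ?ler0n //.
rewrite -natr_sum ler_nat; apply: leq_trans (sum_gcdn_uniq V q0 i0).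
rewrite [leqRHS]big_mkcond /= big_mkcond /=; apply: leq_sum => v _.
by case: (v \in _) => //=; case: ifP.
Qed.

(** * Counting shifts coprime to the modulus *)

Lemma sum_multiples_of (A : nmodType) (d U : nat) (f : nat -> A) : (0 < d)%N ->
  \sum_(1 <= u < U.+1 | (d %| u)%N) f u = \sum_(1 <= k < (U %/ d).+1) f (d * k)%N.
Proof.
move=> d0; elim: U => [|U IH]; first by rewrite div0n !big_geq.
rewrite big_mkcond big_nat_recr //= -big_mkcond /= IH divnS //.
case: (boolP (d %| U.+1)%N) => h; last by rewrite addr0.
rewrite add1n [RHS]big_nat_recr //=; congr (_ + _); congr f.
by rewrite -[LHS](divnK h) divnS // h mulnC.
Qed.

Definition legendre (ps : seq nat) (U : nat) : nat :=
  (\sum_(1 <= u < U.+1) all (fun p => ~~ (p %| u)%N) ps)%N.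

Lemma legendre_rec p ps U : prime p -> all prime ps -> p \notin ps ->
  (legendre (p :: ps) U + legendre ps (U %/ p) = legendre ps U)%N.
Proof.
move=> pp pps pns; rewrite /legendre.
have -> : (\sum_(1 <= u < (U %/ p).+1) all (fun p => ~~ (p %| u)) ps)%N =
    (\sum_(1 <= u < U.+1 | (p %| u)%N) all (fun p => ~~ (p %| u)%N) ps)%N.
  rewrite sum_multiples_of ?prime_gt0 //; apply: eq_bigr => u _; congr nat_of_bool.
  apply: eq_in_all => p' hp'; have pp' := allP pps _ hp'.
  rewrite Euclid_dvdM // (dvdn_prime2 pp' pp).
  by have /negPf -> : p' != p by apply: contraNneq pns => <-.
rewrite [X in (_ + X)%N]big_mkcond -big_split /=; apply: eq_bigr => u _.
by case: (p %| u)%N; rewrite ?addn0.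
Qed.

(** Inclusion-exclusion, one prime at a time: each prime doubles the error, and the floor in
    [U %/ p] adds at most one. *)
Lemma legendre_approx (R : realFieldType) ps U : all prime ps -> uniq ps ->
  `|(legendre ps U)%:R - U%:R * \prod_(p <- ps) (1 - p%:R^-1)| <= 2 ^+ size ps - 1 :> R.
Proof.
elim: ps U => [|p ps IH] U /=.
  move=> _ _; rewrite big_nil mulr1 /legendre sum_nat_const_nat subSS subn0 muln1.
  by rewrite !subrr normr0.
case/andP=> pp pps /andP[pns ups].
have p0 : 0 < p%:R :> R by rewrite ltr0n prime_gt0.
have h1 := IH U pps ups; have h2 := IH (U %/ p)%N pps ups.
have /(congr1 (fun n => n%:R : R)) := legendre_rec U pp pps pns.
rewrite natrD big_cons => E.
set P := \prod_(_ <- _) _ in h1 h2 *.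
have P01 : 0 <= P <= 1.
  rewrite /P; elim: (ps) pps {h1 h2 pns ups IH E P} => [|p' s IHs] /=.
    by move=> _; rewrite big_nil ler01 lexx.
  case/andP=> pp' /IHs /andP[h0 h1]; rewrite big_cons.
  have p1 : 0 <= (p'%:R^-1 : R) <= 1.
    by rewrite invr_ge0 ler0n invf_le1 ?ltr0n ?prime_gt0 // (ler_nat R 1) prime_gt0.
  by apply/andP; split; nra.
have fl : (U %/ p)%:R <= U%:R / p%:R :> R.
  by rewrite ler_pdivlMr // -natrM ler_nat leq_trunc_div.
have fl2 : U%:R / p%:R <= (U %/ p)%:R + 1 :> R.
  rewrite ler_pdivrMr // natr1 -natrM ler_nat ltnW // mulnC.
  by rewrite mulnC -ltn_divLR ?prime_gt0.
move: h1 h2; rewrite !ler_norml exprS => /andP[a1 a2] /andP[b1 b2].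
set x := (U %/ p)%:R in b1 b2 fl fl2 E; set y := U%:R in a1 a2 fl fl2 *.
set z := y / p%:R in fl fl2.
have zE : y * ((1 - p%:R^-1) * P) = y * P - z * P by rewrite /z; ring.
rewrite zE; case/andP: P01 => P0 P1.
have c1 : x * P <= z * P by rewrite ler_wpM2r.
have c2 : z * P <= x * P + 1 by nra.
by apply/andP; split; lra.
Qed.

(** Each factor [1 - 1/p] is at least [1/2]; the loss is a power of [2 ^ size (primes q)], harmless
    by [omega_bound]. *)
Lemma coprime_count (R : realFieldType) (q U : nat) : (0 < q)%N ->
  U%:R / 2 ^+ size (primes q) - 2 ^+ size (primes q) <=
    #|[pred u : 'I_U | coprime u.+1 q]|%:R :> R.
Proof.
move=> q0; have app : all prime (primes q) by apply: all_prime_primes.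
have /ler_normlP[h _] := legendre_approx R U app (primes_uniq q).
have -> : #|[pred u : 'I_U | coprime u.+1 q]| = legendre (primes q) U.
  rewrite /legendre big_add1 big_mkord -sum1_card big_mkcond /=; apply: eq_bigr => u _.
  have -> : (u \in [pred u : 'I_U | coprime u.+1 q]) = all (fun p => ~~ (p %| u.+1)%N) (primes q).
    rewrite inE coprime_has_primes // -all_predC; apply: eq_in_all => p.
    by rewrite mem_primes /= mem_primes => /and3P[-> _ _].
  by case: all.
have : U%:R / 2 ^+ size (primes q) <= U%:R * \prod_(p <- primes q) (1 - p%:R^-1) :> R.
  rewrite ler_wpM2l ?ler0n // -exprVn.
  elim: (primes q) app => [|p s IH] /=; first by rewrite big_nil expr0.
  case/andP=> pp /IH h2; rewrite big_cons exprS.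
  have : p%:R^-1 <= 2^-1 :> R.
    by rewrite lef_pV2 ?posrE ?ltr0n ?prime_gt0 // (ler_nat R 2) prime_gt1.
  move=> p2; apply: ler_pM => //; rewrite ?exprn_ge0 ?invr_ge0 //.
  by rewrite lerBrDr -lerBrDl; apply: le_trans p2 _; lra.
by move: h; lra.
Qed.

(** * Harmonic sums and the divisor function *)

Definition harm (R : realType) (U : nat) : R := \sum_(1 <= k < U.+1) k%:R^-1.

Lemma harm_le_ln (R : realType) (U : nat) : (0 < U)%N -> harm R U <= 1 + ln U%:R.
Proof.
case: U => // U _; elim: U => [|U IH].
  by rewrite /harm big_nat1 invr1 ln1 addr0.
rewrite /harm big_nat_recr //= -/(harm R U.+1); apply: le_trans (lerD IH (lexx _)) _.
rewrite -addrA lerD2l -lerBrDl.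
have U0 : 0 < U.+1%:R :> R by rewrite ltr0n.
have U1 : 0 < U.+2%:R :> R by rewrite ltr0n.
have x1 : -1 < - U.+2%:R^-1 :> R by rewrite ltrN2 invf_lt1 // (ltr_nat R 1).
have := le_ln1Dx x1; have -> : 1 - U.+2%:R^-1 = U.+1%:R / U.+2%:R :> R.
  apply: (mulIf (lt0r_neq0 U1)); rewrite mulrBl mulVf ?lt0r_neq0 // mul1r.
  by rewrite mulfVK ?lt0r_neq0 // -[U.+2%:R]natr1 addrK.
rewrite lnM ?posrE ?invr_gt0 // lnV ?posrE //.
by move: (ln _) (ln _) (_^-1) => x y z; lra.
Qed.

Lemma harm_powR (R : realType) (eps : R) : 0 < eps ->
  exists C : R, forall U : nat, (0 < U)%N -> harm R U <= C * U%:R `^ eps.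
Proof.
move=> e0; exists (1 + eps^-1) => U U0.
apply: le_trans (harm_le_ln R U0) _; rewrite mulrDl; apply: lerD.
  rewrite mul1r; have : U%:R `^ 0 <= U%:R `^ eps :> R.
    by apply: ler_powR; rewrite ?(ltW e0) // (ler_nat R 1).
  by rewrite powRr0.
rewrite -ler_pdivrMl ?invr_gt0 // invrK -ln_powR.
by apply: ltW; apply: ln_sublinear; rewrite powR_gt0 // ltr0n.
Qed.

(** Writing [u = d * k] turns the sum into part of the product of two harmonic sums. *)
Lemma sum_divisors_harm (R : realType) (U : nat) :
  \sum_(1 <= u < U.+1) (size (divisors u))%:R / u%:R <= harm R U ^+ 2.
Proof.
have -> : \sum_(1 <= u < U.+1) (size (divisors u))%:R / u%:R =
    \sum_(1 <= d < U.+1) \sum_(1 <= u < U.+1 | (d %| u)%N) u%:R^-1 :> R.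
  rewrite (exchange_big_dep_nat predT) //=; apply: eq_big_nat => u /andP[u0 uU].
  rewrite big_const_seq iter_addr_0 mulr_natl; congr (_ *+ _).
  rewrite -size_filter; apply/perm_size/uniq_perm; rewrite ?divisors_uniq ?filter_uniq ?iota_uniq //.
  move=> d; rewrite mem_filter mem_index_iota -dvdn_divisors //.
  case: (boolP (d %| u)%N) => //= du; rewrite (dvdn_gt0 u0 du) /=.
  by rewrite (leq_ltn_trans (dvdn_leq u0 du) uU).
rewrite expr2 {2}/harm big_distrr /= !big_nat; apply: ler_sum => d /andP[d0 _].
rewrite sum_multiples_of //.
under eq_bigr => k _ do rewrite natrM invfM.
rewrite -big_distrr /= mulrC ler_wpM2r ?invr_ge0 ?ler0n //.
rewrite /harm [leRHS](@big_cat_nat _ _ _ (U %/ d).+1) //=; last by rewrite ltnS leq_div.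
by rewrite lerDl sumr_ge0 // => k _; rewrite invr_ge0 ler0n.
Qed.

(** * Counting coincidences of fractions modulo q *)

(** Two solutions differ by a multiple of [(u1, u2)] divided by the gcd. So the first coordinate is
    determined modulo [k = u1 / gcd], and its quotient by [k] determines the solution. *)
Lemma fiber_count (N u1 u2 : nat) (D : int) : (0 < u1)%N ->
  (#|[pred m : 'I_N * 'I_N | (m.1%:Z * u2%:Z - m.2%:Z * u1%:Z == D)%R]|
    <= (N %/ (u1 %/ gcdn u1 u2)).+1)%N.
Proof.
move=> u0; set g := gcdn u1 u2; set k := (u1 %/ g)%N.
have g0 : (0 < g)%N by rewrite gcdn_gt0 u0.
have u1E : u1 = (k * g)%N by rewrite divnK ?dvdn_gcdl.
have k0 : (0 < k)%N by move: u0; rewrite u1E muln_gt0 => /andP[].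
pose k2 := (u2 %/ g)%N; have u2E : u2 = (k2 * g)%N by rewrite divnK ?dvdn_gcdr.
have ck : coprime k k2.
  have : (gcdn k k2 * g = 1 * g)%N by rewrite muln_gcdl -u1E -u2E mul1n.
  by move/eqP; rewrite eqn_pmul2r.
have hlt (m : 'I_N) : (m %/ k < (N %/ k).+1)%N.
  by rewrite ltnS leq_div2r // ltnW.
pose f (m : 'I_N * 'I_N) : 'I_(N %/ k).+1 := Ordinal (hlt m.1).
set A := [pred m | _].
rewrite -[leqRHS]card_ord; apply: (@leq_card_in _ _ f A) => a b.
rewrite !inE => /eqP ha /eqP hb /(congr1 val) /= fab.
have E : (a.1%:Z - b.1%:Z) * u2%:Z = (a.2%:Z - b.2%:Z) * u1%:Z.
  apply/eqP; rewrite -subr_eq0; apply/eqP.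
  have -> : (a.1%:Z - b.1%:Z) * u2%:Z - (a.2%:Z - b.2%:Z) * u1%:Z =
    (a.1%:Z * u2%:Z - a.2%:Z * u1%:Z) - (b.1%:Z * u2%:Z - b.2%:Z * u1%:Z) by ring.
  by rewrite ha hb subrr.
have gz : g%:Z != 0 by rewrite eqz_nat -lt0n.
have E2 : (a.1%:Z - b.1%:Z) * k2%:Z = (a.2%:Z - b.2%:Z) * k%:Z.
  by apply: (mulIf gz); rewrite -!mulrA -!PoszM -u1E -u2E.
have dv : (k%:Z %| a.1%:Z - b.1%:Z)%Z.
  rewrite -(@Gauss_dvdzl k%:Z _ k2%:Z) ?coprimezE //.
  by rewrite E2 dvdz_mull.
have a1 : a.1 = b.1.
  apply: val_inj => /=; move: dv; rewrite -eqz_mod_dvd !modz_nat => /eqP [mab].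
  by rewrite (divn_eq a.1 k) fab mab -divn_eq.
move: E; rewrite a1 subrr mul0r => /esym/eqP; rewrite mulf_eq0 subr_eq0 eqz_nat.
rewrite [(u1%:Z == 0)]eqz_nat (gtn_eqF u0) orbF => /eqP a2.
by rewrite [a]surjective_pairing [b]surjective_pairing a1 (val_inj a2).
Qed.

(* As [N * U <= q], the difference takes at most three values divisible by [q]. *)
Lemma pair_count (N U q u1 u2 : nat) (M : int) :
  (0 < u1 <= U)%N -> (u2 <= U)%N -> (N * U <= q)%N ->
  (#|[pred m : 'I_N * 'I_N |
       (q%:Z %| ((M + m.1%:Z) * u2%:Z - (M + m.2%:Z) * u1%:Z)%R)%Z]|
    <= 3 * (N %/ (u1 %/ gcdn u1 u2)).+1)%N.
Proof.
case/andP=> u10 u1U u2U NU; set A := [pred m | _].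
have [|A0] := boolP [exists m, A m]; last first.
  rewrite (_ : #|A| = 0%N) //; apply: eq_card0 => m.
  by apply/negbTE; apply: contra A0 => Am; apply/existsP; exists m.
case/existsP=> s0 As0; pose D (m : 'I_N * 'I_N) := m.1%:Z * u2%:Z - m.2%:Z * u1%:Z.
pose Fib (D0 : int) := [pred m : 'I_N * 'I_N | m.1%:Z * u2%:Z - m.2%:Z * u1%:Z == D0].
have q0 : (0 < q)%N.
  apply: leq_trans NU; rewrite muln_gt0 (leq_trans u10 u1U) andbT.
  exact: leq_ltn_trans (leq0n _) (ltn_ord s0.1).
have bd (m : 'I_N * 'I_N) : `|D m| < q%:Z.
  have h1 : (m.1 * u2 < q)%N.
    apply: leq_trans NU; have := ltn_ord m.1; move: (nat_of_ord m.1) u10 u1U u2U => x; nia.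
  have h2 : (m.2 * u1 < q)%N.
    apply: leq_trans NU; have := ltn_ord m.2; move: (nat_of_ord m.2) u10 u1U u2U => x; nia.
  by rewrite /D -!PoszM; move: h1 h2; move: (_ * _)%N (_ * _)%N => x y; lia.
have sub : A \subset [predU Fib (D s0) & [predU Fib (D s0 + q%:Z) & Fib (D s0 - q%:Z)]].
  apply/fintype.subsetP => m Am; rewrite !inE -/(D m).
  have : (q%:Z %| D m - D s0)%Z.
    have -> : D m - D s0 = (M + m.1%:Z) * u2%:Z - (M + m.2%:Z) * u1%:Z -
      ((M + s0.1%:Z) * u2%:Z - (M + s0.2%:Z) * u1%:Z) by rewrite /D; ring.
    by apply: rpredB.
  case/dvdzP => k hk; have := bd m; have := bd s0; move: (D m) (D s0) hk => x y hk hx hy.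
  have : k = 0 \/ k = 1 \/ k = -1 by nia.
  case=> [k0|[k0|k0]]; rewrite k0 in hk; apply/or3P.
  - by apply: Or31; lia.
  - by apply: Or32; lia.
  - by apply: Or33; lia.
apply: leq_trans (subset_leq_card sub) _.
have cU (P Q : {pred 'I_N * 'I_N}) : (#|[predU P & Q]| <= #|P| + #|Q|)%N.
  by rewrite -cardUI leq_addr.
have fc D0 : (#|Fib D0| <= (N %/ (u1 %/ gcdn u1 u2)).+1)%N by apply: fiber_count.
have c2 : (#|[predU Fib (D s0 + q%:Z)%R & Fib (D s0 - q%:Z)%R]| <=
    2 * (N %/ (u1 %/ gcdn u1 u2)).+1)%N.
  apply: leq_trans (cU (Fib _) (Fib _)) _; rewrite mul2n -addnn.
  by apply: leq_add; apply: fc.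
apply: leq_trans (cU (Fib _) _) _; rewrite mulSn; apply: leq_add; [exact: fc | exact: c2].
Qed.

(** This majorizes the coincidences of the classes [n / u] modulo [q]. The sum of [gcd(u1, u2) / u1]
    over [u2] is controlled by the divisor function of [u1], and [sum_divisors_harm] finishes. *)
Lemma quad_count (R : realType) (N U q : nat) (M : int) : (0 < U)%N -> (N * U <= q)%N ->
  (\sum_(u1 < U) \sum_(u2 < U) #|[pred m : 'I_N * 'I_N |
       (q%:Z %| ((M + m.1%:Z) * u2.+1%:Z - (M + m.2%:Z) * u1.+1%:Z)%R)%Z]|)%N%:R <=
  3 * U%:R ^+ 2 + 6 * N%:R * U%:R * harm R U ^+ 2 :> R.
Proof.
move=> U0 NU.
apply: (@le_trans _ _ (\sum_(u1 < U) \sum_(u2 < U)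
   (3 + 3 * N%:R * ((gcdn u1.+1 u2.+1)%:R / u1.+1%:R)))).
  rewrite natr_sum; apply: ler_sum => u1 _; rewrite natr_sum; apply: ler_sum => u2 _.
  apply: (@le_trans _ _ (3 * (N %/ (u1.+1 %/ gcdn u1.+1 u2.+1)).+1)%:R).
    by rewrite ler_nat; apply: (@pair_count N U); rewrite ?ltn_ord.
  set g := gcdn _ _; set k := (u1.+1 %/ g)%N.
  have g0 : (0 < g)%N by rewrite gcdn_gt0.
  have u1E : u1.+1 = (k * g)%N by rewrite divnK ?dvdn_gcdl.
  have k0 : (0 < k)%N by have : (0 < u1.+1)%N := isT; rewrite u1E muln_gt0 => /andP[].
  have kR : 0 < k%:R :> R by rewrite ltr0n.
  have gR : 0 < g%:R :> R by rewrite ltr0n.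
  have -> : g%:R / u1.+1%:R = k%:R^-1 :> R.
    by rewrite u1E natrM; field; rewrite !lt0r_neq0.
  have : (N %/ k)%:R <= N%:R / k%:R :> R by rewrite ler_pdivlMr // -natrM ler_nat leq_trunc_div.
  by rewrite natrM -[(_ %/ _).+1%:R]natr1 -mulrA; move: (N%:R / k%:R) (_ %/ _)%:R => x y; lra.
apply: (@le_trans _ _ (\sum_(u1 < U) (3 * U%:R +
   6 * N%:R * U%:R * ((size (divisors u1.+1))%:R / u1.+1%:R)))); last first.
  rewrite big_split /= sumr_const card_ord -big_distrr /= -[_ *+ U]mulr_natr; apply: lerD.
    by rewrite expr2 mulrA.
  rewrite ler_wpM2l ?mulr_ge0 ?ler0n //.
  by have := sum_divisors_harm R U; rewrite big_add1 big_mkord.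
apply: ler_sum => u1 _; rewrite big_split /= sumr_const card_ord -[_ *+ U]mulr_natr lerD2l.
rewrite -big_distrr /= -mulr_suml.
have := @sum_gcdn_le u1.+1 U.+1 isT; rewrite big_add1 big_mkord -(ler_nat R) natr_sum natrM.
set G := \sum_(_ < _) _; set t := (size _)%:R => h.
have N0 : 0 <= 3 * N%:R :> R by rewrite mulr_ge0 ?ler0n.
have -> : 6 * N%:R * U%:R * (t / u1.+1%:R) = 3 * N%:R * ((t * (2 * U%:R)) / u1.+1%:R).
  by move: (_^-1) => x; ring.
apply: ler_wpM2l => //; rewrite ler_wpM2r ?invr_ge0 ?ler0n //.
apply: le_trans h _; rewrite ler_wpM2l ?ler0n // -natrM ler_nat; lia.
Qed.

(** * Separation of polynomial phases *)

Section Phases.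
Variable R : realType.
Implicit Types x y : R.

Lemma eeD x y : ee (x + y) = ee x * ee y :> R[i].
Proof.
rewrite /ee mulrDr cosD sinD; apply/eqP; rewrite eq_complex /= eqxx /=.
by rewrite addrC mulrC [X in _ == X + _]mulrC; apply/eqP; ring.
Qed.

Lemma ee0 : ee (0 : R) = 1.
Proof. by rewrite /ee mulr0 cos0 sin0. Qed.

Lemma nm_ee x : nm (ee x) = 1.
Proof. by rewrite /nm /ee /= cos2Dsin2 sqrtr1. Qed.

Lemma ee_conj x : (ee x)^*%C = ee (- x).
Proof. by rewrite /ee mulrN cosN sinN. Qed.

Lemma eeMn x n : ee (x * n%:R) = ee x ^+ n.
Proof.
elim: n => [|n IH]; first by rewrite mulr0 ee0.
by rewrite -natr1 mulrDr mulr1 eeD IH exprSr.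
Qed.

Lemma ee1 : ee (1 : R) = 1.
Proof. by rewrite /ee mulr1 mulr_natl cos2pi sin2pi. Qed.

Lemma ee_neq1 x : 0 < x < 1 -> ee x != 1.
Proof.
case/andP=> x0 x1; apply/eqP => /(congr1 (@complex.Re R)) /=.
have p0 : 0 < pi * x < (pi : R) by rewrite mulr_gt0 ?pi_gt0 //= -[ltRHS]mulr1 ltr_pM2l ?pi_gt0.
have s0 := sin_gt0_pi p0.
rewrite -mulrA mulr_natl cos_mulr2n => /eqP.
have := cos2Dsin2 (pi * x); nra.
Qed.

Lemma ee_orth (T : nat) (h : int) : (`|h| < T)%N ->
  \sum_(b < T) ee (b%:R * (h%:~R / T%:R)) = (if h == 0 then T%:R else 0) :> R[i].
Proof.
move=> hT; have T0 : 0 < T%:R :> R by rewrite ltr0n (leq_ltn_trans _ hT).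
case: eqP => [->|/eqP h0].
  by under eq_bigr => b _ do rewrite mul0r mulr0 ee0; rewrite sumr_const card_ord.
set z := ee (h%:~R / T%:R : R).
under eq_bigr => b _ do rewrite mulrC eeMn -/z.
have zT : z ^+ T = 1.
  rewrite -eeMn divfK ?lt0r_neq0 //; case: (h) => k; first by rewrite -pmulrn -(mul1r k%:R) eeMn ee1 expr1n.
  by rewrite NegzE mulrNz -ee_conj -pmulrn -(mul1r k.+1%:R) eeMn ee1 expr1n conjc1.
have z1 : z != 1.
  have H (k : nat) : (0 < k < T)%N -> ee (k%:R / T%:R : R) != 1.
    case/andP=> k0 kT; apply: ee_neq1; apply/andP; split.
      by rewrite divr_gt0 // ltr0n.
    by rewrite ltr_pdivrMr // mul1r ltr_nat.
  rewrite /z; move: h0 hT; case: (h) => k h0 hT; first by apply: H; move: h0 hT; lia.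
  rewrite NegzE mulrNz mulNr -ee_conj; apply/eqP => h1.
  have h2 : (ee (k.+1%:R / T%:R : R))^*%C = 1 := h1.
  have hk : (0 < k.+1 < T)%N by move: hT; lia.
  by have := H _ hk; rewrite -[ee _]conjcK h2 conjc1 eqxx.
have := subrX1 z T; rewrite zT subrr => /esym/eqP; rewrite mulf_eq0 subr_eq0 (negPf z1) /=.
by move/eqP.
Qed.

(** Fejer's kernel of length [2N], sampled at [T] equally spaced points. It is nonnegative, and
    dividing by [2NT] gives it total mass 1: these are the weights of a convex combination. *)
Definition fejer (N T : nat) (a : R) (b : nat) : R :=
  nm (\sum_(j < 2 * N) ee (j%:R * (a - b%:R / T%:R))) ^+ 2 / (2 * N * T)%:R.

Lemma fejer_ge0 N T a b : 0 <= fejer N T a b.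
Proof. by rewrite /fejer divr_ge0 ?sqr_ge0 ?ler0n. Qed.

Lemma sum_ord_shift (L v : nat) : (v <= L)%N ->
  (\sum_(j1 < L) \sum_(j2 < L) (j1 == j2 + v :> nat) = L - v)%N.
Proof.
move=> vL; rewrite exchange_big /=.
have E (j2 : 'I_L) : (\sum_(j1 < L) (j1 == j2 + v :> nat) = (j2 < L - v))%N.
  case: ltnP => h.
    have h2 : (j2 + v < L)%N by lia.
    rewrite (bigD1 (Ordinal h2)) //= eqxx big1 // => j jn.
    by apply/eqP; rewrite eqb0; apply: contra jn => /eqP e; apply/eqP/val_inj.
  by rewrite big1 // => j _; apply/eqP; rewrite eqb0; have := ltn_ord j; lia.
rewrite (eq_bigr (fun j2 : 'I_L => nat_of_bool (j2 < L - v)%N) (fun j2 _ => E j2)).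
rewrite -(big_mkord predT (fun j => nat_of_bool (j < L - v)%N)) (@big_cat_nat _ _ _ (L - v)) ?leq_subr //=.
rewrite [X in (_ + X)%N]big_nat [X in (_ + X)%N]big1 ?addn0; last first.
  by move=> j /andP[h _]; rewrite ltnNge h.
rewrite big_nat (eq_bigr (fun=> 1%N)); last first.
  by move=> j /andP[_ jL]; rewrite jL.
by rewrite -big_nat sum_nat_const_nat subn0 muln1.
Qed.

(* Only frequencies [|v| <= N] are reproduced with the weight [(2N - v) / 2N], which the
   phases of [phase_family] divide out; this weight is at least [1/2], whence the factors 4. *)
Lemma fejer_expand (N T v : nat) (a : R) : (0 < N)%N -> (3 * N < T)%N -> (v <= N)%N ->
  \sum_(b < T) (fejer N T a b)%:C%C * ee (b%:R * (v%:R / T%:R)) =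
    ((2 * N - v)%:R / (2 * N)%:R) * ee (v%:R * a).
Proof.
move=> N0 NT vN; have T0 : T%:R != 0 :> R[i] by rewrite pnatr_eq0; lia.
have N20 : (2 * N)%:R != 0 :> R[i] by rewrite pnatr_eq0; lia.
have E (b : nat) : (fejer N T a b)%:C%C * ee (b%:R * (v%:R / T%:R)) =
    (2 * N * T)%:R^-1 * \sum_(j1 < 2 * N) \sum_(j2 < 2 * N)
      ee ((j1%:R - j2%:R) * a) * ee (b%:R * ((v%:Z - (j1%:Z - j2%:Z))%:~R / T%:R)).
  rewrite /fejer rmorphM /= sqr_nm fmorphV rmorph_nat mulrAC [LHS]mulrC; congr (_ * _).
  have -> : (\sum_(j < 2 * N) ee (j%:R * (a - b%:R / T%:R)))^*%C =
      \sum_(j < 2 * N) ee (- (j%:R * (a - b%:R / T%:R))).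
    by rewrite rmorph_sum; apply: eq_bigr => j _; apply: ee_conj.
  rewrite big_distrlr /= big_distrl /=; apply: eq_bigr => j1 _.
  rewrite big_distrl /=; apply: eq_bigr => j2 _.
  rewrite -!eeD; congr ee; rewrite !rmorphB /= -!pmulrn; ring.
under eq_bigr => b _ do rewrite E.
rewrite -big_distrr /= exchange_big /=.
have E2 (j1 j2 : 'I_(2 * N)) : \sum_(b < T) ee ((j1%:R - j2%:R) * a) *
     ee (b%:R * ((v%:Z - (j1%:Z - j2%:Z))%:~R / T%:R)) =
   T%:R * ee (v%:R * a) * (j1 == j2 + v :> nat)%N%:R.
  rewrite -big_distrr /= ee_orth; last by have := ltn_ord j1; have := ltn_ord j2; lia.
  have -> : (v%:Z - (j1%:Z - j2%:Z) == 0) = (j1 == j2 + v :> nat)%N by lia.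
  case: eqP => [->|_]; last by rewrite !mulr0.
  by rewrite natrD mulr1 mulrC addrC addKr.
under eq_bigr => j1 _ do rewrite exchange_big /=.
under eq_bigr => j1 _ do under eq_bigr => j2 _ do rewrite E2.
under eq_bigr => j1 _ do rewrite -big_distrr /= -natr_sum.
rewrite -big_distrr /= -natr_sum sum_ord_shift; last by lia.
rewrite [(2 * N * T)%:R]natrM; move: N20 T0.
move: (2 * N)%:R T%:R (_ - _)%:R (ee _) => x y w z hx hy.
by field; rewrite hx hy.
Qed.

End Phases.

Lemma sconjM (R : realType) (b : bool) (x y : R[i]) : sconj b (x * y) = sconj b x * sconj b y.
Proof. by case: b => //=; rewrite rmorphM. Qed.

Lemma sum_fejer (R : realType) (N T : nat) (a : R) : (0 < N)%N -> (3 * N < T)%N ->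
  \sum_(b < T) fejer N T a b = 1.
Proof.
move=> N0 NT; apply/(@complexI R).
have := fejer_expand a N0 NT (leq0n N).
under eq_bigr => b _ do rewrite mul0r mulr0 ee0 mulr1.
rewrite subn0 mul0r ee0 mulr1 divff ?pnatr_eq0; last by lia.
by rewrite rmorph_sum.
Qed.

Lemma sum_phase_tuple (R : realType) (r T : nat) (x : 'I_(r + r) -> nat) :
  (\sum_(j < r) x (lshift r j) < T)%N -> (\sum_(j < r) x (rshift r j) < T)%N ->
  \sum_(c < T) \prod_(j < r + r) sconj (j < r)%N (ee (c%:R * ((x j)%:R / T%:R))) =
  (if (\sum_(j < r) x (lshift r j) == \sum_(j < r) x (rshift r j))%N then T%:R else 0) :> R[i].
Proof.
move=> h1 h2; set s1 := (\sum_(j < r) x (lshift r j))%N in h1 *.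
set s2 := (\sum_(j < r) x (rshift r j))%N in h2 *.
have ee_sum (I : finType) (F : I -> R) : \prod_i ee (F i) = ee (\sum_i F i).
  by apply/esym/big_morph; [apply: eeD | apply: ee0].
have E (c : nat) : \prod_(j < r + r) sconj (j < r)%N (ee (c%:R * ((x j)%:R / T%:R) : R)) =
    ee (c%:R * ((s1%:Z - s2%:Z)%:~R / T%:R)).
  rewrite big_split_ord (eq_bigr (fun j : 'I_r => ee (c%:R * ((x (lshift r j))%:R / T%:R)))).
    rewrite [X in _ * X = _](eq_bigr (fun j : 'I_r => ee (- (c%:R * ((x (rshift r j))%:R / T%:R))))).
      rewrite !ee_sum -eeD; congr ee; rewrite sumrN -!big_distrr /= -!mulr_suml -!natr_sum.
      by rewrite -/s1 -/s2 rmorphB /= -!pmulrn; ring.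
    by move=> j _; rewrite -ee_conj /sconj ltnNge leq_addr.
  by move=> j _; rewrite /sconj /= ltn_ord.
under eq_bigr => c _ do rewrite E.
rewrite ee_orth; last by lia.
by have -> : (s1%:Z - s2%:Z == 0) = (s1 == s2) by lia.
Qed.

(* A finite set of phases of which [v |-> ee (G v)] is, for every polynomial [G] of degree [d]
   without constant term, a convex combination on [v <= V]: the mean over the phases then
   selects the solutions of the Vinogradov system, uniformly in [G]. *)
Lemma phase_family (R : realType) (r V d : nat) : (0 < r)%N -> (0 < V)%N ->
  exists (B : finType) (phi : B -> nat -> R[i]),
  [/\ #|B| = (\prod_(i < d) (4 * r * V ^ i.+1))%N,
      forall g : nat -> R, exists kap : B -> R,
        [/\ forall b, 0 <= kap b, \sum_b kap b = 1 &
            forall v, (v <= V)%N -> ee (\sum_(i < d) g i * v%:R ^+ i.+1) =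
              \sum_b (kap b)%:C%C * phi b v] &
      forall w : 'I_(r + r) -> nat, (forall j, (w j <= V)%N) ->
        nm (\sum_b \prod_(j < r + r) sconj (j < r)%N (phi b (w j))) <=
        if [forall i : 'I_d, (\sum_(j < r) w (lshift r j) ^ i.+1 ==
             \sum_(j < r) w (rshift r j) ^ i.+1)%N]
        then (4 ^ (r * d) * #|B|)%:R else 0 ].
Proof.
move=> r0 V0; elim: d => [|d [B [phi [cB hkap hsum]]]].
  exists unit, (fun _ _ => 1); split.
  - by rewrite big_ord0 card_unit.
  - move=> g; exists (fun=> 1); split=> // [|v _].
      by rewrite sumr_const card_unit.
    by rewrite big_ord0 ee0 sumr_const card_unit mulr1n mulr1.
  - move=> w _; case: forallP => [_|]; last by case=> -[].
    rewrite muln0 expn0 mul1n; apply: le_trans (nm_sum _ _ _) _.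
    apply: (@le_trans _ _ (\sum_(b : unit) 1)); last by rewrite sumr_const.
    by apply: ler_sum => b _; rewrite nm_prod big1 // => j _; rewrite nm_sconj nm1.
(* [T] exceeds the sums of [r] powers, at most [r * N], so that orthogonality modulo [T] detects
   their equality; it also exceeds [3 * N], as [fejer_expand] asks. *)
pose N := (V ^ d.+1)%N; pose T := (4 * r * N)%N.
have N0 : (0 < N)%N by rewrite expn_gt0 V0.
have NT : (3 * N < T)%N by rewrite /T; nia.
pose wt (v : nat) : R := (2 * N)%:R / (2 * N - v ^ d.+1)%:R.
pose psi (c : 'I_T) (v : nat) : R[i] := (wt v)%:C%C * ee (c%:R * ((v ^ d.+1)%:R / T%:R)).
have vN v : (v <= V)%N -> (v ^ d.+1 <= N)%N by move=> vV; rewrite leq_exp2r.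
exists (B * 'I_T)%type, (fun bc v => phi bc.1 v * psi bc.2 v); split.
- by rewrite card_prod card_ord cB big_ord_recr.
- move=> g; have [kap [k0 k1 kE]] := hkap g.
  exists (fun bc : B * 'I_T => kap bc.1 * fejer N T (g d) bc.2); split.
  + by move=> bc; rewrite mulr_ge0 ?fejer_ge0.
  + by rewrite -(pair_bigA _ (fun b (c : 'I_T) => kap b * fejer N T (g d) c)) /= -big_distrlr /= k1 sum_fejer ?mul1r.
  + move=> v vV; rewrite big_ord_recr /= eeD kE //.
    have := fejer_expand (g d) N0 NT (vN v vV) => fE.
    have nz1 : (2 * N)%:R != 0 :> R[i] by rewrite pnatr_eq0; lia.
    have nz2 : (2 * N - v ^ d.+1)%:R != 0 :> R[i] by rewrite pnatr_eq0; have := vN v vV; lia.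
    have -> : ee (g d * v%:R ^+ d.+1) =
        \sum_(c < T) (fejer N T (g d) c)%:C%C * psi c v.
      under eq_bigr => c _ do rewrite /psi mulrCA.
      rewrite -big_distrr /= fE /wt rmorphM fmorphV !rmorph_nat natrX [g d * _]mulrC.
      move: nz1 nz2; move: (2 * N)%:R (_ - _)%:R (ee _) => x y z hx hy.
      by field; rewrite hx hy.
    rewrite big_distrlr /= pair_bigA /=; apply: eq_bigr => bc _.
    by rewrite [(kap _ * _)%:C%C]rmorphM [LHS]mulrACA.
move=> w wV.
have E : \sum_(bc : B * 'I_T) \prod_(j < r + r) sconj (j < r)%N (phi bc.1 (w j) * psi bc.2 (w j)) =
   (\sum_b \prod_(j < r + r) sconj (j < r)%N (phi b (w j))) *
   ((\prod_j (wt (w j))%:C%C) *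
    \sum_(c < T) \prod_(j < r + r) sconj (j < r)%N (ee (c%:R * ((w j ^ d.+1)%:R / T%:R)))).
  rewrite [X in _ = _ * X]big_distrr big_distrlr pair_bigA.
  apply: eq_bigr => bc _; rewrite /= -!big_split /=; apply: eq_bigr => j _.
  rewrite sconjM; congr (_ * _); rewrite sconjM; congr (_ * _).
  by rewrite /sconj; case: ifP => // _; rewrite conjc_real.
rewrite E !nmM sum_phase_tuple; last first.
- apply: (@leq_ltn_trans (\sum_(j < r) N)%N); first by apply: leq_sum => j _; apply: vN.
  by rewrite sum_nat_const card_ord /T; nia.
- apply: (@leq_ltn_trans (\sum_(j < r) N)%N); first by apply: leq_sum => j _; apply: vN.
  by rewrite sum_nat_const card_ord /T; nia.
have wt4 : nm (\prod_j (wt (w j))%:C%C) <= (4 ^ r)%:R.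
  rewrite nm_prod; apply: (@le_trans _ _ (\prod_(j < r + r) 2)); last first.
    by rewrite prodr_const card_ord addnn -mul2n exprM -natrX -natrX.
  apply: ler_prod => j _; rewrite nm_ge0 andTb.
  have d0 : 0 < (2 * N - w j ^ d.+1)%:R :> R by rewrite ltr0n; have := vN _ (wV j); lia.
  have -> : nm (wt (w j))%:C%C = wt (w j).
    rewrite /nm /= expr0n addr0 sqrtr_sqr ger0_norm // /wt divr_ge0 ?ler0n //.
  rewrite /wt ler_pdivrMr // -natrM ler_nat; have := vN _ (wV j); lia.
have := hsum w wV; case: ifP => [/forallP hall|hn] hle; last first.
  have -> : nm (\sum_b \prod_(j < r + r) sconj (j < r)%N (phi b (w j))) = 0 by apply/le_anti; rewrite hle nm_ge0.
  rewrite mul0r; by case: ifP.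
case: eqP => hd; last first.
  by rewrite nm0 !mulr0; case: ifP.
case: forallP => [_|[]]; last first.
  move=> i; case: (unliftP ord_max i) => [k ->|->] /=; last by apply/eqP.
  by rewrite /bump leqNgt ltn_ord /=; apply: hall.
rewrite nm_nat card_prod card_ord mulnS expnD.
have -> : (4 ^ r * 4 ^ (r * d) * (#|B| * T))%N%:R =
  (4 ^ (r * d) * #|B|)%N%:R * ((4 ^ r)%N%:R * T%:R) :> R by rewrite -!natrM; congr _%:R; lia.
apply: ler_pM; rewrite ?nm_ge0 ?mulr_ge0 ?nm_ge0 ?ler0n // ler_wpM2r ?ler0n //.
Qed.

(** * The Burgess step *)

(** The products [(x i - x j) * (x i ^+ n - x j ^+ n)] are nonnegative; expand their weighted double
    sum. *)
Lemma chebyshev_sum (R : realDomainType) (I : finType) (w x : I -> R) (n : nat) :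
  (forall i, 0 <= w i) -> (forall i, 0 <= x i) ->
  (\sum_i w i * x i) * (\sum_i w i * x i ^+ n) <= (\sum_i w i) * (\sum_i w i * x i ^+ n.+1).
Proof.
move=> w0 x0.
have : 0 <= \sum_i \sum_j w i * w j * ((x i - x j) * (x i ^+ n - x j ^+ n)).
  apply: sumr_ge0 => i _; apply: sumr_ge0 => j _; apply: mulr_ge0; first exact: mulr_ge0.
  wlog le : i j / x j <= x i.
    move=> H; have [|/ltW] := leP (x j) (x i); first exact: H.
    by move=> h; rewrite -mulrNN !opprB; apply: H.
  by rewrite mulr_ge0 ?subr_ge0 // lerXn2r ?nnegrE.
have E : \sum_i \sum_j w i * (w j * x j ^+ n.+1) = (\sum_i w i) * (\sum_i w i * x i ^+ n.+1).
  by rewrite big_distrlr.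
have E' : \sum_i \sum_j w j * (w i * x i ^+ n.+1) = (\sum_i w i) * (\sum_i w i * x i ^+ n.+1).
  by rewrite exchange_big.
have G : \sum_i \sum_j w i * x i * (w j * x j ^+ n) =
   (\sum_i w i * x i) * (\sum_i w i * x i ^+ n) by rewrite big_distrlr.
have G' : \sum_i \sum_j w j * x j * (w i * x i ^+ n) =
   (\sum_i w i * x i) * (\sum_i w i * x i ^+ n) by rewrite exchange_big.
have -> : \sum_i \sum_j w i * w j * ((x i - x j) * (x i ^+ n - x j ^+ n)) =
  (\sum_i \sum_j w i * (w j * x j ^+ n.+1) + \sum_i \sum_j w j * (w i * x i ^+ n.+1)) -
  (\sum_i \sum_j w i * x i * (w j * x j ^+ n) + \sum_i \sum_j w j * x j * (w i * x i ^+ n)).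
  rewrite -!big_split -sumrB; apply: eq_bigr => i _.
  rewrite -!big_split -sumrB; apply: eq_bigr => j _ /=; rewrite !exprS; ring.
rewrite E E' G G'; lra.
Qed.

Lemma power_mean (R : realDomainType) (I : finType) (w x : I -> R) (r : nat) :
  (forall i, 0 <= w i) -> (forall i, 0 <= x i) ->
  (\sum_i w i * x i) ^+ r.+1 <= (\sum_i w i) ^+ r * \sum_i w i * x i ^+ r.+1.
Proof.
move=> w0 x0; elim: r => [|r IH]; first by rewrite expr0 mul1r.
have wx0 : 0 <= \sum_i w i * x i by apply: sumr_ge0 => i _; rewrite mulr_ge0.
rewrite exprS; apply: le_trans (ler_wpM2l wx0 IH) _.
rewrite mulrCA exprSr -mulrA ler_wpM2l ?exprn_ge0 ?sumr_ge0 //.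
exact: chebyshev_sum.
Qed.

(** The power mean inequality with weights [w], followed by Cauchy-Schwarz between [w] and the
    [r]-th powers of [x]. *)
Lemma holder_even (R : realDomainType) (I : finType) (w x : I -> R) (r : nat) : (0 < r)%N ->
  (forall i, 0 <= w i) -> (forall i, 0 <= x i) ->
  (\sum_i w i * x i) ^+ (2 * r) <=
    (\sum_i w i) ^+ (2 * r.-1) * ((\sum_i w i ^+ 2) * \sum_i x i ^+ (2 * r)).
Proof.
case: r => // r _ w0 x0; have wx0 : 0 <= \sum_i w i * x i by apply: sumr_ge0 => i _; rewrite mulr_ge0.
rewrite mulnC exprM; apply: (@le_trans _ _ (((\sum_i w i) ^+ r * \sum_i w i * x i ^+ r.+1) ^+ 2)).
  apply: lerXn2r; rewrite ?nnegrE ?exprn_ge0 ?power_mean //.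
  by rewrite mulr_ge0 ?exprn_ge0 ?sumr_ge0 // => i _; rewrite mulr_ge0 ?exprn_ge0.
rewrite exprMn -exprM [(r * 2)%N]mulnC ler_wpM2l ?exprn_ge0 ?sumr_ge0 //.
apply: le_trans (cauchy_schwarz_sum _ _ _) _.
by under [X in _ * X <= _]eq_bigr => i _ do rewrite -exprM.
Qed.

Lemma nm_real (R : rcfType) (x : R) : nm x%:C%C = `|x|.
Proof. by rewrite /nm /= expr0n addr0 sqrtr_sqr. Qed.

Lemma nm_prod_sconj (R : realType) (r : nat) (z : R[i]) :
  (nm z ^+ (2 * r))%:C%C = \prod_(j < r + r) sconj (j < r)%N z.
Proof.
rewrite exprM rmorphXn /= sqr_nm exprMn big_split_ord /=; congr (_ * _).
  rewrite (eq_bigr (fun=> z)); first by rewrite prodr_const card_ord.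
  by move=> j _; rewrite ltn_ord.
rewrite (eq_bigr (fun=> z^*%C)); first by rewrite prodr_const card_ord.
by move=> j _; rewrite ltnNge leq_addr.
Qed.

Lemma sconj_sum (R : realType) (I : Type) (s : seq I) (P : pred I) (b : bool) (F : I -> R[i]) :
  sconj b (\sum_(i <- s | P i) F i) = \sum_(i <- s | P i) sconj b (F i).
Proof. by case: b => //; apply: rmorph_sum. Qed.

Section BurgessStep.
Variables (R : realType) (q : nat) (chi : int -> R[i]) (F : {poly R}).
Variables (d r U V N : nat) (M : int).
Hypothesis hchi : dirichlet_character q chi.
Hypothesis sF : (size F <= d.+1)%N.
Hypotheses (r0 : (0 < r)%N) (U0 : (0 < U)%N) (V0 : (0 < V)%N) (NU : (N * U <= q)%N).

Definition psi (n : int) : R[i] := chi n * ee F.[n%:~R].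

Let UU := [pred u : 'I_U | coprime u.+1 q].
Let nn (m : 'I_N) : int := M + m.+1%:Z.

Let S1 : R := \sum_(p : 'I_U * 'I_N | p.1 \in UU)
  nm (\sum_(v < V) psi (nn p.2 + p.1.+1%:Z * v.+1%:Z)).

Let q0 : (0 < q)%N := dir_gt0 hchi.

Let exists_lam (p : 'I_U * 'I_N) : exists lam : 'I_q,
  p.1 \in UU -> (q%:Z %| p.1.+1%:Z * lam%:Z - nn p.2)%Z.
Proof.
have [pU|pU] := boolP (p.1 \in UU); last by exists (Ordinal q0).
have /coprimezP [[a b] /= ab] : coprimez p.1.+1%:Z q%:Z by rewrite coprimezE.
have qz : q%:Z != 0 by rewrite eqz_nat -lt0n.
pose l := (a * nn p.2 %% q%:Z)%Z.
have l0 : 0 <= l by apply: modz_ge0.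
have lq : (`|l| < q)%N by rewrite -ltz_nat gez0_abs // ltz_pmod // ltz_nat.
exists (Ordinal lq) => _ /=; rewrite gez0_abs //.
have -> : l = a * nn p.2 - (a * nn p.2 %/ q%:Z)%Z * q%:Z.
  by rewrite [X in _ = X - _](divz_eq (a * nn p.2) q%:Z) [RHS]addrC addKr.
set t := (_ %/ _)%Z.
have -> : p.1.+1%:Z * (a * nn p.2 - t * q%:Z) - nn p.2 = (- b * nn p.2 - p.1.+1%:Z * t) * q%:Z.
  have e1 : a * p.1.+1%:Z = 1 - b * q%:Z by rewrite -ab addrK.
  transitivity ((a * p.1.+1%:Z - 1) * nn p.2 - p.1.+1%:Z * t * q%:Z); first by ring.
  by rewrite e1; ring.
exact: dvdz_mull.
Qed.

Lemma burgess_step : exists2 A : nat, A = (\prod_(i < d) (4 * r * V ^ i.+1))%N &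
  S1 ^+ (2 * r) <= (N * #|UU|)%:R ^+ (2 * r.-1) *
   ((3 * U%:R ^+ 2 + 6 * N%:R * U%:R * harm R U ^+ 2) *
    ((4 ^ (r * d) * A)%:R * \sum_(v in vmvt_sols r d V) nm (csum q chi (fun j : 'I_(r + r) => j < r)%N (vals v)))).
Proof.
have [B [phi [cB hkap hsum]]] := phase_family R d r0 V0.
exists #|B| => //.
have [kapf hk] := choice hkap.
have [lam hlam] := choice exists_lam.
(* Along [n + u v] the phase is a polynomial in [v]. Its constant term is pulled out as a factor of
   modulus 1, since [phase_family] has none. *)
pose G (p : 'I_U * 'I_N) : {poly R} := F \Po ((nn p.2)%:~R%:P + p.1.+1%:R *: 'X).
pose kap p := kapf (fun i => (G p)`_i.+1).
pose Tz (l : 'I_q) b := \sum_(v < V) chi (l%:Z + v.+1%:Z) * phi b v.+1.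
have GE (p : 'I_U * 'I_N) (v : nat) : F.[(nn p.2 + p.1.+1%:Z * v%:Z)%:~R] =
    (G p)`_0 + \sum_(i < d) (G p)`_i.+1 * v%:R ^+ i.+1.
  have -> : F.[(nn p.2 + p.1.+1%:Z * v%:Z)%:~R] = (G p).[v%:R].
    rewrite /G horner_comp !hornerE; congr (F.[_]).
    by rewrite rmorphD rmorphM /= -!pmulrn.
  have sG : (size (G p) <= d.+1)%N.
    rewrite size_comp_poly2 // addrC size_polyDl; rewrite size_scale ?size_polyX ?pnatr_eq0 //.
    by rewrite ltnS size_polyC_leq1.
  rewrite horner_coef (big_ord_widen d.+1 (fun i => (G p)`_i * v%:R ^+ i) sG) big_mkcond /=.
  rewrite big_ord_recl expr0 mulr1; congr (_ + _).
    by case: ltnP => // /leq_sizeP ->.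
  apply: eq_bigr => i _; rewrite /= /bump /= ?add1n.
  by case: ltnP => // /leq_sizeP -> //; rewrite mul0r.
have psiE (p : 'I_U * 'I_N) : p.1 \in UU ->
    nm (\sum_(v < V) psi (nn p.2 + p.1.+1%:Z * v.+1%:Z)) <= \sum_b kap p b * nm (Tz (lam p) b).
  move=> pU; have hl := hlam p pU.
  have [k0 _ kE] := hk (fun i => (G p)`_i.+1).
  have -> : \sum_(v < V) psi (nn p.2 + p.1.+1%:Z * v.+1%:Z) =
      chi p.1.+1%:Z * ee (G p)`_0 * \sum_b (kap p b)%:C%C * Tz (lam p) b.
    rewrite /Tz; under [X in _ = _ * X]eq_bigr => b _ do rewrite big_distrr.
    rewrite exchange_big big_distrr /=; apply: eq_bigr => v _.
    have -> : \sum_b (kap p b)%:C%C * (chi ((lam p)%:Z + v.+1%:Z) * phi b v.+1) =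
       chi ((lam p)%:Z + v.+1%:Z) * \sum_b (kap p b)%:C%C * phi b v.+1.
      by rewrite big_distrr; apply: eq_bigr => b _; rewrite mulrCA.
    rewrite -kE // /psi GE eeD.
    have -> : chi (nn p.2 + p.1.+1%:Z * v.+1%:Z) = chi p.1.+1%:Z * chi ((lam p)%:Z + v.+1%:Z).
      rewrite -(dirM hchi); apply/esym/(dir_eqmod hchi).
      have -> : p.1.+1%:Z * ((lam p)%:Z + v.+1%:Z) - (nn p.2 + p.1.+1%:Z * v.+1%:Z) =
        p.1.+1%:Z * (lam p)%:Z - nn p.2 by ring.
      exact: hl.
    by rewrite -!mulrA; congr (_ * _); rewrite mulrCA.
  rewrite !nmM nm_ee mulr1; apply: (@le_trans _ _ (1 * nm (\sum_b (kap p b)%:C%C * Tz (lam p) b))).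
    by rewrite ler_wpM2r ?nm_ge0 // (nm_dir_le1 hchi).
  rewrite mul1r; apply: le_trans (nm_sum _ _ _) _; apply: ler_sum => b _.
  by rewrite nmM nm_real ger0_norm //; apply: k0.
(* Each pair [(u, n)] is spread, at its class [lam], over the phases with total weight 1; Hoelder is
   applied over pairs of a class and a phase. *)
pose W (lb : 'I_q * B) : R := \sum_(p : 'I_U * 'I_N | (p.1 \in UU) && (lam p == lb.1)) kap p lb.2.
have kap0 (p : 'I_U * 'I_N) b : 0 <= kap p b by have [k0 _ _] := hk (fun i => (G p)`_i.+1); apply: k0.
have kap1 (p : 'I_U * 'I_N) : \sum_b kap p b = 1 by have [_ k1 _] := hk (fun i => (G p)`_i.+1); apply: k1.
have W0 lb : 0 <= W lb by apply: sumr_ge0.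
have step1 : S1 <= \sum_lb W lb * nm (Tz lb.1 lb.2).
  apply: (@le_trans _ _ (\sum_(p : 'I_U * 'I_N | p.1 \in UU) \sum_b kap p b * nm (Tz (lam p) b))).
    exact: ler_sum.
  rewrite le_eqVlt; apply/orP; left; apply/eqP.
  rewrite -(pair_bigA _ (fun l b => W (l, b) * nm (Tz l b))) /=.
  rewrite (partition_big lam predT) //=; apply: eq_bigr => l _.
  rewrite exchange_big /=; apply: eq_bigr => b _.
  by rewrite /W /= big_distrl /=; apply: eq_bigr => p /andP[_ /eqP ->].
have sumW : \sum_lb W lb = (N * #|UU|)%:R.
  rewrite -(pair_bigA _ (fun l b => W (l, b))) /=.
  transitivity (\sum_(p : 'I_U * 'I_N | p.1 \in UU) (1 : R)).
    rewrite [RHS](partition_big lam predT) //=; apply: eq_bigr => l _.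
    by rewrite /W /= exchange_big /=; apply: eq_bigr => p _; rewrite kap1.
  rewrite sumr_const; congr _%:R.
  rewrite (_ : #|_| = #|[predX UU & 'I_N]|); last by apply: eq_card => p; rewrite !inE andbT.
  by rewrite cardX card_ord mulnC.
(* For one class the sum over the phases of the squares is at most the square of the sum. This
   leaves the number of pairs with equal classes. *)
have sumW2 : \sum_lb W lb ^+ 2 <= 3 * U%:R ^+ 2 + 6 * N%:R * U%:R * harm R U ^+ 2.
  apply: le_trans (quad_count R (M + 1) U0 NU).
  apply: (@le_trans _ _ (\sum_(l < q) (\sum_(p : 'I_U * 'I_N | (p.1 \in UU) && (lam p == l)) 1) ^+ 2)).
    rewrite -(pair_bigA _ (fun l b => W (l, b) ^+ 2)) /=; apply: ler_sum => l _.
    have -> : \sum_(p : 'I_U * 'I_N | (p.1 \in UU) && (lam p == l)) (1 : R) = \sum_b W (l, b).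
      by rewrite /W /= exchange_big /=; apply: eq_bigr => p _; rewrite kap1.
    rewrite expr2 big_distrlr /=; apply: ler_sum => b _.
    by rewrite (bigD1 b) //= expr2 lerDl sumr_ge0 // => b' _; apply: mulr_ge0.
  have -> : \sum_(l < q) (\sum_(p : 'I_U * 'I_N | (p.1 \in UU) && (lam p == l)) (1 : R)) ^+ 2 =
     \sum_(p : 'I_U * 'I_N | p.1 \in UU) \sum_(p' : 'I_U * 'I_N | p'.1 \in UU) (lam p == lam p')%:R.
    rewrite [RHS](partition_big lam predT) //=; apply: eq_bigr => l _.
    rewrite expr2 big_distrlr /=; apply: eq_bigr => p /andP[_ /eqP ->].
    rewrite big_mkcondr /=; apply: eq_bigr => p' _; rewrite mulr1 eq_sym.
    by case: eqP.
  pose D (p p' : 'I_U * 'I_N) := (q%:Z %| nn p.2 * p'.1.+1%:Z - nn p'.2 * p.1.+1%:Z)%Z.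
  apply: (@le_trans _ _ (\sum_(p : 'I_U * 'I_N) \sum_(p' : 'I_U * 'I_N) (D p p')%:R)).
    rewrite big_mkcond /=; apply: ler_sum => p _; case: ifP => pU; last first.
      by apply: sumr_ge0 => p' _; apply: ler0n.
    rewrite big_mkcond /=; apply: ler_sum => p' _; case: ifP => pU'; last exact: ler0n.
    rewrite ler_nat; case: eqP => // e; rewrite (_ : D p p') //.
    have := hlam p pU; have := hlam p' pU'; rewrite e /D => h1 h2.
    have -> : nn p.2 * p'.1.+1%:Z - nn p'.2 * p.1.+1%:Z =
      (p'.1.+1%:Z * (lam p')%:Z - nn p'.2) * p.1.+1%:Z -
      (p.1.+1%:Z * (lam p')%:Z - nn p.2) * p'.1.+1%:Z by ring.
    by apply: rpredB; apply: dvdz_mulr.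
  rewrite -(pair_bigA _ (fun u m => \sum_(p' : 'I_U * 'I_N) (D (u, m) p')%:R)) /=.
  rewrite natr_sum; apply: ler_sum => u _; rewrite natr_sum.
  under eq_bigr => m _ do rewrite -(pair_bigA _ (fun u' m' => (D (u, m) (u', m'))%:R)) /=.
  rewrite exchange_big /=; apply: ler_sum => u' _.
  rewrite pair_bigA /= -natr_sum ler_nat -sum1_card big_mkcond [leqRHS]big_mkcond /=.
  apply: leq_sum => m _; rewrite !inE /D /nn /= -!addrA -![1 + _]PoszD !add1n.
  by case: (_ \in _).
have sumT : \sum_(lb : 'I_q * B) nm (Tz lb.1 lb.2) ^+ (2 * r) <=
   (4 ^ (r * d) * #|B|)%:R * \sum_(v in vmvt_sols r d V) nm (csum q chi (fun j : 'I_(r + r) => j < r)%N (vals v)).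
  apply: (@le_trans _ _ (nm (\sum_(v : {ffun 'I_(r + r) -> 'I_V})
      csum q chi (fun j : 'I_(r + r) => j < r)%N (vals v) *
      \sum_b \prod_(j < r + r) sconj (j < r)%N (phi b (v j).+1)))).
    have -> : \sum_(v : {ffun 'I_(r + r) -> 'I_V}) csum q chi (fun j : 'I_(r + r) => j < r)%N (vals v) *
        \sum_b \prod_(j < r + r) sconj (j < r)%N (phi b (v j).+1) = (\sum_(lb : 'I_q * B) nm (Tz lb.1 lb.2) ^+ (2 * r))%:C%C.
      rewrite rmorph_sum; apply/esym.
      transitivity (\sum_(lb : 'I_q * B) \sum_(v : {ffun 'I_(r + r) -> 'I_V})
         (\prod_(j < r + r) sconj (j < r)%N (chi (lb.1%:Z + vals v j))) *
         (\prod_(j < r + r) sconj (j < r)%N (phi lb.2 (v j).+1))).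
        apply: eq_bigr => lb _; apply: etrans (nm_prod_sconj r (Tz lb.1 lb.2)) _.
        rewrite /Tz; under eq_bigr => j _ do rewrite sconj_sum.
        rewrite bigA_distr_bigA.
        apply: eq_bigr => v _; rewrite -big_split; apply: eq_bigr => j _.
        by rewrite sconjM.
      rewrite exchange_big; apply: eq_bigr => v _.
      by rewrite /csum big_distrlr pair_bigA.
    by rewrite nm_real ger0_norm // sumr_ge0 // => lb _; rewrite exprn_ge0 // nm_ge0.
  apply: le_trans (nm_sum _ _ _) _.
  rewrite [leRHS]big_distrr [leRHS]big_mkcond /=; apply: ler_sum => v _; rewrite nmM.
  have := hsum (fun j => (v j).+1) (fun j => ltn_ord (v j)).
  rewrite inE; case: ifP => _ h; first by rewrite mulrC ler_wpM2r ?nm_ge0.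
  by rewrite -(mulr0 (nm (csum q chi (fun j : 'I_(r + r) => j < r)%N (vals v)))) ler_wpM2l ?nm_ge0.
have S10 : 0 <= S1 by apply: sumr_ge0 => p _; apply: nm_ge0.
apply: (@le_trans _ _ ((\sum_lb W lb * nm (Tz lb.1 lb.2)) ^+ (2 * r))).
  by rewrite lerXn2r ?nnegrE // (le_trans S10).
apply: le_trans (holder_even r0 W0 (fun lb => nm_ge0 _)) _.
rewrite sumW ler_wpM2l ?exprn_ge0 ?ler0n // ler_pM // ?sumr_ge0 // => lb _.
  by rewrite sqr_ge0.
by rewrite exprn_ge0 ?nm_ge0.
Qed.

End BurgessStep.

(** * Averaging over shifts and conclusion *)

Section ShiftedAverage.
Variables (R : rcfType) (f : int -> R[i]).

Definition psum (M : int) (N : nat) : R[i] := \sum_(k < N) f (M + k.+1%:Z).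

Lemma psum_add M N t : psum M (N + t) = psum M N + psum (M + N%:Z) t.
Proof.
rewrite /psum big_split_ord; congr (_ + _); apply: eq_bigr => k _; congr f.
by rewrite /= -addrA -PoszD addnS.
Qed.

Lemma psum_shift M N t :
  psum M N = psum (M + t%:Z) N + psum M t - psum (M + N%:Z) t.
Proof. by rewrite [_ + psum M t]addrC -psum_add addnC psum_add addrK. Qed.

(** A shift by [t = u v <= U V] alters the sum by two end sums of length [t], each at most [G]. *)
Lemma shifted_average (U V N : nat) (M : int) (UU : pred 'I_U) (G : R) :
  (forall M' t, (t <= U * V)%N -> nm (psum M' t) <= G) ->
  (V * #|UU|)%:R * nm (psum M N) <=
  \sum_(p : 'I_U * 'I_N | p.1 \in UU)
      nm (\sum_(v < V) f (M + p.2.+1%:Z + p.1.+1%:Z * v.+1%:Z)) + (V * #|UU|)%:R * (2 * G).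
Proof.
move=> hG; have E (x : R) : (V * #|UU|)%:R * x = \sum_(u in UU) \sum_(v < V) x.
  by rewrite !sumr_const card_ord -mulrnA -[x *+ _]mulr_natl.
have -> : \sum_(p : 'I_U * 'I_N | p.1 \in UU)
      nm (\sum_(v < V) f (M + p.2.+1%:Z + p.1.+1%:Z * v.+1%:Z)) =
    \sum_(u in UU) \sum_(m < N) nm (\sum_(v < V) f (M + m.+1%:Z + u.+1%:Z * v.+1%:Z)).
  by rewrite pair_big_dep; apply: eq_bigl => p; rewrite andbT.
rewrite !E -big_split; apply: ler_sum => u _ /=.
have -> : \sum_(v < V) nm (psum M N) = nm (\sum_(v < V) psum M N).
  by rewrite !sumr_const -[in RHS]mulr_natl nmM nm_nat mulr_natl.
have -> : \sum_(v < V) psum M N =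
   \sum_(m < N) \sum_(v < V) f (M + m.+1%:Z + u.+1%:Z * v.+1%:Z) +
   \sum_(v < V) (psum M (u.+1 * v.+1) - psum (M + N%:Z) (u.+1 * v.+1)).
  rewrite [X in _ = X + _]exchange_big -big_split; apply: eq_bigr => v _ /=.
  rewrite {1}(psum_shift M N (u.+1 * v.+1)) -addrA; congr (_ + _).
  by apply: eq_bigr => m _; rewrite PoszM addrAC.
apply: le_trans (nmD _ _) _; apply: lerD; first exact: nm_sum.
apply: le_trans (nm_sum _ _ _) _; apply: ler_sum => v _.
apply: le_trans (nmD _ _) _; rewrite nmN mulr_natl mulr2n.
by apply: lerD; apply: hG; apply: leq_mul.
Qed.

End ShiftedAverage.

(** * Diagonal solutions and the size of [r] *)

Lemma card_vmvt_sols_ge (r d V : nat) : (V ^ r <= J r d V)%N.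
Proof.
pose h (f : {ffun 'I_r -> 'I_V}) : {ffun 'I_(r + r) -> 'I_V} :=
  [ffun j : 'I_(r + r) => match fintype.split j with inl a => f a | inr a => f a end].
have hl f a : h f (lshift r a) = f a.
  by rewrite ffunE -[lshift r a]/(unsplit (inl a)) unsplitK.
have hr f a : h f (rshift r a) = f a.
  by rewrite ffunE -[rshift r a]/(unsplit (inr a)) unsplitK.
have hinj : injective h.
  by move=> f g e; apply/ffunP => a; rewrite -hl e hl.
have {1}<- : #|{ffun 'I_r -> 'I_V}| = (V ^ r)%N by rewrite card_ffun !card_ord.
rewrite -(card_codom hinj); apply: subset_leq_card; apply/fintype.subsetP => _ /codomP[f ->].
rewrite inE; apply/forallP => i; apply/eqP; apply: eq_bigr => j _.
by rewrite hl hr.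
Qed.

Lemma Dr_half (R : realType) (d : nat) : Dr R d = (d * d.+1)./2%:R.
Proof.
have ev : (2 * (d * d.+1)./2 = d * d.+1)%N.
  rewrite mul2n -[RHS]odd_double_half oddM oddS; by case: (odd d).
by rewrite /Dr -{1}ev natrM mulrC mulKf ?pnatr_eq0.
Qed.

Lemma sum_succ (d : nat) : (\sum_(i < d) i.+1 = (d * d.+1)./2)%N.
Proof.
elim: d => [|d IH]; first by rewrite big_ord0.
transitivity ((d * d.+1)./2 + d.+1)%N; first by rewrite big_ord_recr IH.
have -> : (d.+1 * d.+2 = d.+1.*2 + d * d.+1)%N by lia.
by rewrite halfD odd_double doubleK addnC.
Qed.

(** Otherwise [r + 1 <= D], and with [eps = 1/2] the diagonal would give [V^r <= C V^(r - 1/2)],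
    which fails for [V > C^2]. *)
Lemma vmvt_exponent_ge (R : realType) (d rd r : nat) :
  is_rd R d rd -> (rd <= r)%N -> ((d * d.+1)./2 <= r)%N.
Proof.
case=> rd1 hv _ rdr; set D := (d * d.+1)./2; rewrite leqNgt; apply/negP => rD.
have e0 : 0 < 2^-1 :> R by rewrite invr_gt0.
have [C hC] := hv r (leq_trans rd1 rdr) rdr _ e0.
have key V : (0 < V)%N -> V%:R `^ 2^-1 <= C.
  move=> V0; have Vp : 0 < V%:R :> R by rewrite ltr0n.
  have : V%:R `^ r%:R <= C * V%:R `^ (r%:R - 2^-1).
    apply: le_trans (_ : (J r d V)%:R <= _).
      by rewrite powR_mulrn ?ler0n // -natrX ler_nat card_vmvt_sols_ge.
    apply: le_trans (hC V V0) _; apply: ler_wpM2l.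
      have := hC 1%N isT; rewrite powR1 mulr1; apply: le_trans; exact: ler0n.
    apply: ler_powR; first by rewrite ler1n.
    have : r%:R + 1 <= D%:R :> R by rewrite natr1 ler_nat.
    by rewrite Dr_half -/D natrM; lra.
  have -> : V%:R `^ r%:R = V%:R `^ 2^-1 * V%:R `^ (r%:R - 2^-1) :> R.
    by rewrite -powRD ?(gt_eqF Vp) ?implybT // addrC subrK.
  by rewrite ler_pM2r ?powR_gt0.
have C0 : 0 <= C by apply: le_trans (key 1%N isT); apply: powR_ge0.
pose V := (Num.truncn (C ^+ 2)).+1.
have := key V isT; rewrite -(@ler_pXn2r _ 2) ?nnegrE ?powR_ge0 //.
rewrite -powR_mulrn ?powR_ge0 // -powRrM mulVf // powRr1 ?ler0n //.
by rewrite leNgt truncnS_gt.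
Qed.

(* Here [v] stands for [V], so that [v ^+ m] is [q] up to a constant, [u] for the number of
   shifts [U], and [c] for the number of them coprime to [q]. *)
Lemma burgess_arith (R : realFieldType) (r D m w : nat) (q n u v c h H E K W S : R) :
  (0 < r)%N -> (D + m = 2 * r)%N -> 0 <= c -> 0 <= v -> 0 <= u -> 0 <= q -> 0 <= K -> 0 <= E ->
  0 <= h -> h <= H -> 1 <= H -> u <= n -> u <= 2 ^+ w.+1 * c -> n <= 32 * v * u ->
  q <= (2 * v) ^+ m -> 0 <= W -> W <= v ^+ r * q * E ->
  S <= (n * c) ^+ (2 * r.-1) * ((3 * u ^+ 2 + 6 * n * u * h ^+ 2) * (K * v ^+ D * W)) ->
  S <= (v * c) ^+ (2 * r) * (n ^+ (2 * r.-1) *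
         (v ^+ r.+1 * (1152 * 2 ^+ m * K * (H ^+ 2 * 16 ^+ w * E)))).
Proof.
case: r => // r _ Dm c0 v0 u0 q0 K0 E0 h0 hH H1 un uc nu qv W0 WE hS; apply: le_trans hS _.
have n0 : 0 <= n by apply: le_trans un.
rewrite exprMn /= [(v * c) ^+ _]exprMn.
have -> : c ^+ (2 * r.+1) = c ^+ (2 * r) * c ^+ 2 by rewrite mulnS addnC exprD.
have -> : v ^+ (2 * r.+1) = v ^+ D * v ^+ m by rewrite -Dm exprD.
set a := n ^+ _; set b := c ^+ (2 * r).
have a0 : 0 <= a by apply: exprn_ge0.
have b0 : 0 <= b by apply: exprn_ge0.
have vD0 : 0 <= v ^+ D by apply: exprn_ge0.
have H20 : 0 <= H ^+ 2 by apply: sqr_ge0.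
(* Here [1152 = 9 * 32 * 4]: the left side is at most [9 n u H^2], then [n <= 32 v u], and
   [u^2 <= 4 * 16^w * c^2]. *)
have f1 : 3 * u ^+ 2 + 6 * n * u * h ^+ 2 <= 1152 * 16 ^+ w * v * c ^+ 2 * H ^+ 2.
  apply: (@le_trans _ _ (9 * (n * u) * H ^+ 2)).
    have hh : h ^+ 2 <= H ^+ 2 by apply: lerXn2r => //; rewrite nnegrE //; apply: le_trans h0 hH.
    have H2 : 1 <= H ^+ 2 by rewrite expr_ge1 // (le_trans ler01 H1).
    have uu : u ^+ 2 <= n * u by rewrite expr2 ler_wpM2r.
    have nu0 : 0 <= n * u by apply: mulr_ge0.
    have h1 : n * u * 1 <= n * u * H ^+ 2 by apply: ler_wpM2l.
    have h2 : n * u * h ^+ 2 <= n * u * H ^+ 2 by apply: ler_wpM2l.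
    move: h1 h2; rewrite mulr1 -!mulrA; move: (n * (u * _)) => x.
    by rewrite !mulrA; lra.
  apply: ler_wpM2r => //; apply: (@le_trans _ _ (9 * (32 * v * u ^+ 2))).
    by rewrite ler_pM2l ?ltr0n // expr2 mulrA ler_wpM2r.
  have u2 : u ^+ 2 <= 4 * 16 ^+ w * c ^+ 2.
    apply: (@le_trans _ _ ((2 ^+ w.+1 * c) ^+ 2)).
      by apply: lerXn2r => //; rewrite nnegrE // (le_trans u0).
    rewrite exprMn ler_wpM2r ?sqr_ge0 // -exprM mulnC exprM.
    have -> : (2 : R) ^+ 2 = 4 by ring.
    by rewrite exprS ler_wpM2l // lerXn2r ?nnegrE // ler_nat.
  apply: (@le_trans _ _ (9 * (32 * v * (4 * 16 ^+ w * c ^+ 2)))).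
    by rewrite !ler_wpM2l // mulr_ge0.
  by rewrite le_eqVlt; apply/orP; left; apply/eqP; ring.
have f2 : W <= v ^+ r.+1 * (2 ^+ m * v ^+ m) * E.
  by apply: le_trans WE _; rewrite ler_wpM2r // ler_wpM2l ?exprn_ge0 // -exprMn.
have f3 : (3 * u ^+ 2 + 6 * n * u * h ^+ 2) * (K * v ^+ D * W) <=
   (1152 * 16 ^+ w * v * c ^+ 2 * H ^+ 2) * (K * v ^+ D * (v ^+ r.+1 * (2 ^+ m * v ^+ m) * E)).
  apply: ler_pM => //.
  - by rewrite addr_ge0 ?mulr_ge0 ?sqr_ge0.
  - by rewrite !mulr_ge0.
  - by rewrite ler_wpM2l // mulr_ge0.
apply: le_trans (ler_wpM2l (mulr_ge0 a0 b0) f3) _.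
by rewrite le_eqVlt; apply/orP; left; apply/eqP; rewrite [v ^+ r.+2]exprS; ring.
Qed.

Section BurgessInduction.
Variables (R : realType) (q : nat) (chi : int -> R[i]) (F : {poly R}).
Variables (d r m V : nat) (H E B : R).
Local Notation D := (d * d.+1)./2.
Local Notation w := (size (primes q)).
Local Notation K := ((4 ^ (r * d))%:R * (4 * r)%:R ^+ d : R).
Hypotheses (sf : squarefree q) (hchi : dirichlet_character q chi).
Hypotheses (sF : (size F <= d.+1)%N) (r0 : (0 < r)%N) (V0 : (0 < V)%N).
Hypotheses (D0 : (0 < D)%N) (Dm : (D + m = 2 * r)%N) (qV : (q <= (2 * V) ^ m)%N).
Hypotheses (H1 : 1 <= H) (hH : forall U, (0 < U <= q)%N -> harm R U <= H) (E1 : 1 <= E).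
Hypothesis hE :
  \sum_(v in vmvt_sols r d V) nm (csum q chi (fun j : 'I_(r + r) => j < r)%N (vals v)) <=
  V%:R ^+ r * q%:R * E.
Hypotheses (B0 : 0 <= B) (hB : B ^+ (2 * r) =
  4 ^+ r * (V%:R ^+ r.+1 * (1152 * 2 ^+ m * K * (H ^+ 2 * 16 ^+ w * E)))).

Let g (n : nat) : R := n%:R `^ (1 - r%:R^-1).

Let g_ge0 n : 0 <= g n. Proof. exact: powR_ge0. Qed.

Let g_pow n : g n ^+ r = n%:R ^+ r.-1.
Proof.
rewrite -powR_mulrn // -powRrM -powR_mulrn ?ler0n //; congr (_ `^ _).
by rewrite mulrBl mul1r mulVf ?pnatr_eq0 -?lt0n // -[in LHS](prednK r0) -natr1 addrK.
Qed.

Let g_pow2 n : g n ^+ (2 * r) = n%:R ^+ (2 * r.-1).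
Proof. by rewrite mulnC exprM g_pow -exprM mulnC. Qed.

(** [16^(1 - 1/r) >= 4] as soon as [r >= 2]; hence the 16 in the length [U = N / (16 V)] of the
    shifts. *)
Let g_quarter n t : (2 <= r)%N -> (16 * t <= n)%N -> g t <= g n / 4.
Proof.
move=> r2 tn; rewrite ler_pdivlMr // -(@ler_pXn2r _ r) ?nnegrE ?mulr_ge0 //.
rewrite exprMn !g_pow; apply: (@le_trans _ _ ((16 * t)%:R ^+ r.-1)); last first.
  by rewrite lerXn2r ?nnegrE ?ler0n // ler_nat.
rewrite natrM exprMn mulrC ler_wpM2r ?exprn_ge0 ?ler0n //.
have -> : (16%:R : R) = 4 ^+ 2 by ring.
by rewrite -exprM; apply: ler_weXn2l; [rewrite ler1n | lia].
Qed.

(** The factor [4 ^+ r] in [hB] makes the main term at most half of [B * g n]; the other half is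
    left for the two ends. *)
Let hBg (x : R) n : 0 <= x -> x ^+ (2 * r) <=
  n%:R ^+ (2 * r.-1) * (V%:R ^+ r.+1 * (1152 * 2 ^+ m * K * (H ^+ 2 * 16 ^+ w * E))) ->
  x <= B * g n / 2.
Proof.
move=> x0 h; rewrite -(@ler_pXn2r _ (2 * r)) ?muln_gt0 // ?nnegrE ?divr_ge0 ?mulr_ge0 //.
apply: le_trans h _; rewrite !exprMn g_pow2 hB.
have -> : (2^-1 : R) ^+ (2 * r) = (4 ^+ r)^-1.
  by rewrite exprVn exprM; congr (_ ^+ _)^-1; ring.
have n4 : (4 : R) ^+ r != 0 by rewrite expf_neq0 // pnatr_eq0.
rewrite le_eqVlt; apply/orP; left; apply/eqP.
by move: (_ * (H ^+ 2 * _ * _)) => y; rewrite [X in _ = X]mulrC [4 ^+ r * _ * _]mulrAC [4 ^+ r * _]mulrC !mulrA [RHS]mulrC; field.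
Qed.

Let nm_psum M N : nm (psum (psi chi F) M N) <= N%:R.
Proof.
apply: le_trans (nm_sum _ _ _) _.
have -> : N%:R = \sum_(k < N) (1 : R) by rewrite sumr_const card_ord.
apply: ler_sum => k _.
by rewrite /psi nmM nm_ee mulr1 (nm_dir_le1 hchi).
Qed.

(* Induction on [N]: the ends created by a shift of length [t <= N / 16] are sums of the
   same kind, bounded by [B * g t <= B * g N / 4]. *)
Lemma burgess_induction (M : int) (N : nat) : (N * N <= 2 * q * V)%N ->
  nm (psum (psi chi F) M N) <= B * N%:R `^ (1 - r%:R^-1).
Proof.
elim/ltn_ind: N M => N IH M NN; rewrite -/(g N).
have q0 : (0 < q)%N by case: sf.
have BgN : 0 <= B * g N by apply: mulr_ge0.
have K1 : 1 <= K.
  by rewrite mulr_ege1 ?ler1n ?expn_gt0 // exprn_ege1 // ler1n muln_gt0.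
(* Below this length [U] may be too short for [coprime_count]; the trivial bound [N] suffices,
   because [N^2 <= 1024 V^2 16^w] is covered by the constants of [hB]. *)
have [small|big] := ltnP N (32 * V * 4 ^ w).
  apply: le_trans (nm_psum _ _) _.
  apply: (@le_trans _ _ (B * g N / 2)); last by rewrite ler_pdivrMr // ler_peMr // ler1n.
  apply: hBg; first exact: ler0n.
  have -> : (2 * r = 2 * r.-1 + 2)%N by move: r0; clear; lia.
  rewrite exprD ler_wpM2l ?exprn_ge0 ?ler0n //.
  have V1 : 1 <= V%:R :> R by rewrite ler1n.
  have w1 : 1 <= 16 ^+ w :> R by rewrite exprn_ege1 // ler1n.
  apply: (@le_trans _ _ (1024 * V%:R ^+ 2 * 16 ^+ w)).
    apply: (@le_trans _ _ ((32 * V * 4 ^ w)%:R ^+ 2)).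
      by rewrite lerXn2r ?nnegrE ?ler0n // ler_nat ltnW.
    rewrite !natrM natrX exprMn exprMn -exprM [(w * 2)%N]mulnC exprM.
    have -> : (4%:R : R) ^+ 2 = 16 by ring.
    by have -> : (32%:R : R) ^+ 2 = 1024 by ring.
  have -> : V%:R ^+ r.+1 = V%:R ^+ r.-1 * V%:R ^+ 2 :> R.
    by rewrite -[in LHS](prednK r0) -addn2 exprD.
  have Vr : 1 <= V%:R ^+ r.-1 :> R by rewrite exprn_ege1.
  have m1 : 1 <= 2 ^+ m :> R by rewrite exprn_ege1 // ler1n.
  have H2 : 1 <= H ^+ 2 by rewrite exprn_ege1.
  set a := V%:R ^+ r.-1; set b := V%:R ^+ 2.
  have b0 : 0 <= b by apply: sqr_ge0.
  have -> : a * b * (1152 * 2 ^+ m * K * (H ^+ 2 * 16 ^+ w * E)) =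
     (1152 * b * 16 ^+ w) * (a * (2 ^+ m * (K * (H ^+ 2 * E)))).
    by move: (16 ^+ w) (2 ^+ m) K (H ^+ 2) => x y z t; ring.
  have c1 : 1024 <= 1152 :> R by rewrite ler_nat.
  apply: (@le_trans _ _ (1152 * b * 16 ^+ w)).
    by apply: ler_wpM2r; [exact: le_trans ler01 w1 | apply: ler_wpM2r].
  have x0 : 0 <= 1152 * b * 16 ^+ w.
    by apply: mulr_ge0; [apply: mulr_ge0; [apply: ler0n | exact: b0] | exact: le_trans ler01 w1].
  apply: (ler_peMr x0).
  by do 4 (apply: mulr_ege1; first by assumption); assumption.
have N0 : (0 < N)%N.
  by apply: leq_trans big; rewrite !muln_gt0 expn_gt0 V0.
(* For [r = 1] one has [m <= 1], so [q <= 2 V] and [N^2 <= 2 q V <= 4 V^2], against [N >= 32 V]. *)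
have r2 : (2 <= r)%N.
  case: ltnP => // r1; have r1E : r = 1%N by move: r0 r1; clear; lia.
  have m1 : (m <= 1)%N by move: Dm D0; rewrite r1E; move: (_./2) => D; clear; lia.
  have qV' : (q <= 2 * V)%N.
    by apply: leq_trans qV _; case: (m) m1 => [|[|//]] _; rewrite ?expn0 ?expn1 //; move: V0; clear; lia.
  have w1 : (0 < 4 ^ w)%N by rewrite expn_gt0.
  have N32 : (32 * V <= N)%N by apply: leq_trans big; rewrite leq_pmulr.
  have := leq_mul N32 N32; have := leq_mul qV' (leqnn V); have := leq_mul V0 V0.
  by move: NN V0; move: (N * N)%N; clear; nia.
pose U := (N %/ (16 * V))%N.
have w1 : (0 < 4 ^ w)%N by rewrite expn_gt0.
have UV : (U * (16 * V) <= N)%N by apply: leq_trunc_div.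
have U2 : (2 * 4 ^ w <= U)%N
  by rewrite leq_divRL ?muln_gt0 // (_ : 2 * 4 ^ w * (16 * V) = 32 * V * 4 ^ w)%N //; ring.
have U0 : (0 < U)%N by apply: leq_trans U2; rewrite muln_gt0.
have NU : (N <= 32 * V * U)%N.
  have V16 : (0 < 16 * V)%N by rewrite muln_gt0.
  have := ltn_ceil N V16; rewrite -/U => h; apply: leq_trans (ltnW h) _.
  rewrite (_ : 32 * V * U = 2 * U * (16 * V))%N; last by ring.
  by rewrite leq_mul2r; apply/orP; right; move: U0; clear; lia.
(* By the choice of [U], [16 V N U <= N^2 <= 2 q V]. *)
have NUq : (N * U <= q)%N.
  move: (U) UV NN => u UV NN; rewrite -(leq_pmul2r (_ : 0 < 16 * V)%N) ?muln_gt0 //.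
  have := leq_mul (leqnn N) UV; rewrite mulnA => h; apply: leq_trans h _.
  by apply: leq_trans NN _; rewrite [leqRHS]mulnCA -mulnA leq_mul2r orbT.
have UN : (U <= N)%N by apply: leq_div.
set UU := [pred u : 'I_U | coprime u.+1 q].
set c := #|UU|.
(* As [U >= 2 * 4^w], the error [2^w] of [coprime_count] is at most half of its main term. *)
have Uc : U%:R <= 2 ^+ w.+1 * c%:R :> R.
  have := coprime_count R U q0; rewrite -/c.
  have : 2 * 4 ^+ w <= U%:R :> R by rewrite -natrX -natrM ler_nat.
  have -> : (4 : R) ^+ w = 2 ^+ w * 2 ^+ w by rewrite -exprMn; congr (_ ^+ _); ring.
  have w0 : 0 < 2 ^+ w :> R by rewrite exprn_gt0.
  rewrite exprS; move: (2 ^+ w) (U%:R : R) (c%:R : R) w0 => x u y x0 h1.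
  rewrite lerBlDr ler_pdivrMr // => h2; nra.
have c0 : (0 < c)%N.
  rewrite lt0n; apply/eqP => c0; move: Uc; rewrite c0 mulr0 lern0.
  by move/eqP; move: U0; case: (U).
have edges M' t : (t <= U * V)%N -> nm (psum (psi chi F) M' t) <= B * g N / 4.
  move=> tUV; have t16 : (16 * t <= N)%N.
    by apply: leq_trans UV; rewrite mulnCA leq_mul2l tUV orbT.
  have tN : (t < N)%N by move: t16 N0; clear; lia.
  apply: le_trans (IH t tN M' _) _; first by apply: leq_trans NN; rewrite leq_mul // ltnW.
  by rewrite -/(g t) -mulrA ler_wpM2l // g_quarter.
have := shifted_average N M UU edges.
rewrite -/c; set S1 := \sum_(p | _) _ => hS.
have Vc0 : 0 < (V * c)%:R :> R by rewrite ltr0n muln_gt0 V0.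
suff hS1 : S1 <= (V * c)%:R * (B * g N / 2).
  rewrite -(ler_pM2l Vc0); apply: le_trans hS _.
  apply: le_trans (lerD hS1 (lexx _)) _; rewrite -mulrDr ler_pM2l //.
  by move: (B * g N) => y; lra.
have S10 : 0 <= S1 by apply: sumr_ge0 => p _; apply: nm_ge0.
rewrite mulrC -ler_pdivrMr //; apply: hBg; first by rewrite divr_ge0 // ltW.
rewrite expr_div_n ler_pdivrMr ?exprn_gt0 // mulrC natrM.
have [A AE] := burgess_step M hchi sF r0 U0 V0 NUq; rewrite -/UU -/c -/S1 => hA.
move: hE hA; set W := \sum_(v in vmvt_sols r d V) _ => hW hA.
apply: (@burgess_arith _ r D m w q%:R N%:R U%:R V%:R c%:R (harm R U) H E K W) => //.
- exact: le_trans ler01 E1.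
- by apply: sumr_ge0 => k _; rewrite invr_ge0 ler0n.
- by apply: hH; rewrite U0; apply: leq_trans NUq; rewrite leq_pmull.
- by rewrite ler_nat.
- by rewrite -!natrM ler_nat.
- by rewrite -natrM -natrX ler_nat.
- by apply: sumr_ge0 => v _; apply: nm_ge0.
have -> : K * V%:R ^+ D * W = (4 ^ (r * d) * A)%:R * W :> R.
  rewrite AE big_split /= prod_nat_const card_ord -expn_sum sum_succ.
  by rewrite [(4 ^ _ * _)%:R]natrM [(_ ^ d * _)%:R]natrM !natrX mulrA.
by rewrite -natrM; apply: hA.
Qed.

End BurgessInduction.

(** * Choice of the constants and of [V] *)

Lemma powR_nat_ge1 (R : realType) (q : nat) (x : R) : (0 < q)%N -> 0 <= x -> 1 <= q%:R `^ x.
Proof. by move=> q0 x0; rewrite -[leLHS](powRr0 q%:R); apply: ler_powR => //; rewrite ler1n. Qed.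

Lemma burgess_constants (R : realType) (r d m : nat) (eps : R) :
  (0 < r)%N -> (0 < m)%N -> 0 < eps ->
  (forall e : R, 0 < e -> exists C : R, forall V : nat, (1 <= V)%N ->
     (J r d V)%:R <= C * V%:R `^ (m%:R + e)) ->
  exists2 C : R, 0 <= C & forall (q V : nat) (chi : int -> R[i]), squarefree q ->
    dirichlet_character q chi -> locally_nontrivial q chi -> (0 < V)%N -> (V ^ m <= q)%N ->
    exists H E : R, [/\ 1 <= H, forall U, (0 < U <= q)%N -> harm R U <= H, 1 <= E,
      \sum_(v in vmvt_sols r d V)
         nm (csum q chi (fun j : 'I_(r + r) => j < r)%N (vals v)) <= V%:R ^+ r * q%:R * E &
      H ^+ 2 * 16 ^+ size (primes q) * E <= C * q%:R `^ eps].
Proof.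
(* There will be four factors [q^e]: two from [H ^+ 2], one from [E], and one from the constants
   raised to the number of primes of [q]. *)
move=> r0 m0 eps0 hJ; pose e := eps / 4; have e0 : 0 < e by rewrite divr_gt0.
have [CJ0 hCJ0] := hJ e e0; have [CH0 hCH0] := harm_powR e0.
pose CJ := Num.max 1 CJ0; pose CH := Num.max 1 CH0.
have CJ1 : 1 <= CJ by rewrite le_max lexx.
have CH1 : 1 <= CH by rewrite le_max lexx.
(* Per prime of [q]: [2r] from Weil's bound, and [2^r] from the divisor function to the power
   [r - 1/2], rounded up. *)
pose A := ((r + r) * 2 ^ r)%N.
have A0 : (0 < A)%N by rewrite muln_gt0 expn_gt0 addn_gt0 r0.
have [Cw hCw] := @omega_bound R (16 * A) e (ltac:(by rewrite muln_gt0)) e0.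
have Cw0 : 0 <= Cw.
  by have := hCw 1%N isT; rewrite powR1 mulr1; apply: le_trans; apply: ler0n.
pose K : R := (r ^ (r + r))%:R + ((r + r) * 2 ^ r)%:R * CJ.
have K1 : 1 <= K.
  apply: ler_wpDr; last by rewrite ler1n expn_gt0 r0.
  by rewrite mulr_ge0 ?ler0n // (le_trans ler01).
exists (CH ^+ 2 * K * Cw).
  by rewrite !mulr_ge0 // ?sqr_ge0 // (le_trans ler01).
move=> q V chi sf hchi hnt V0 Vq; have q0 : (0 < q)%N by case: sf.
set w := size (primes q); pose Q : R := q%:R `^ e.
have Q1 : 1 <= Q by apply: powR_nat_ge1 => //; apply: ltW.
have Q0 : 0 <= Q by apply: powR_ge0.
have Aw1 : 1 <= A%:R ^+ w :> R by rewrite exprn_ege1 // ler1n.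
exists (CH * Q), (K * A%:R ^+ w * Q); split.
- exact: mulr_ege1.
- move=> U /andP[U0 Uq]; apply: le_trans (hCH0 U U0) _.
  apply: (@le_trans _ _ (CH * U%:R `^ e)).
    by rewrite ler_wpM2r ?powR_ge0 // le_max lexx orbT.
  apply: ler_wpM2l; first exact: le_trans ler01 CH1.
  by apply: ge0_ler_powR; rewrite ?nnegrE ?ler0n ?ler_nat // ltW.
- by rewrite !mulr_ege1.
- apply: le_trans (moment_bound d V _ r0 sf hchi hnt) _.
  rewrite -/w; set P := (V * _ ^ _)%N.
  have VQ : V%:R `^ e <= Q.
    apply: ge0_ler_powR; rewrite ?nnegrE ?ler0n ?ler_nat ?ltW //.
    by apply: leq_trans Vq; rewrite -{1}(expn1 V) leq_pexp2l.
  (* Up to [q^e], [J] is at most [V^m], hence at most [q]: this is why [V ^ m <= q] is imposed. *)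
  have sJ : Num.sqrt (J r d V)%:R <= CJ * Q * Num.sqrt q%:R.
    have X0 : 0 <= CJ * Q * Num.sqrt q%:R.
      by rewrite !mulr_ge0 ?sqrtr_ge0 // (le_trans ler01).
    rewrite -(ger0_norm X0) -sqrtr_sqr ler_wsqrtr // exprMn sqr_sqrtr ?ler0n //.
    apply: le_trans (hCJ0 V V0) _; apply: (@le_trans _ _ (CJ * (V%:R `^ e * V%:R ^+ m))).
      rewrite -powR_mulrn ?ler0n // -powRD ?pnatr_eq0 -?lt0n ?V0 ?implybT // [e + _]addrC.
      by rewrite ler_wpM2r ?powR_ge0 // le_max lexx orbT.
    have X1 : 1 <= CJ * Q by apply: mulr_ege1.
    apply: (@le_trans _ _ (CJ * Q * q%:R)).
      rewrite -mulrA ler_wpM2l ?(le_trans ler01) // ler_pM ?powR_ge0 ?exprn_ge0 ?ler0n //.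
      by rewrite -natrX ler_nat.
    by rewrite ler_wpM2r ?ler0n // expr2 ler_peMr // (le_trans ler01).
  have sP : Num.sqrt P%:R <= 2 ^+ r * (2 ^+ r) ^+ w * V%:R ^+ r :> R.
    have X0 : 0 <= 2 ^+ r * (2 ^+ r) ^+ w * V%:R ^+ r :> R.
      by rewrite !mulr_ge0 ?exprn_ge0 ?ler0n.
    rewrite -(ger0_norm X0) -sqrtr_sqr ler_wsqrtr //.
    have -> : 2 ^+ r * (2 ^+ r) ^+ w * V%:R ^+ r = (2 * (2 ^ w * V))%:R ^+ r :> R.
      by rewrite !natrM natrX !exprMn -!exprM [(w * r)%N]mulnC mulrA.
    rewrite -exprM muln2 -addnn -natrX ler_nat /P.
    have -> : ((2 * (2 ^ w * V)) ^ (r + r) = (2 * (2 ^ w * V)) * (2 * (2 ^ w * V)) ^ (r + r).-1)%N.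
      by rewrite -expnS prednK // addn_gt0 r0.
    apply: leq_mul; first by rewrite mulnA leq_pmull // muln_gt0 expn_gt0.
    rewrite leq_exp2r; last by move: r0; clear; lia.
    by rewrite leq_mul2l leq_mul2r size_divisors_squarefree ?orbT.
  set W := A%:R ^+ w in Aw1 *.
  have WE : W = (r + r)%:R ^+ w * (2 ^+ r) ^+ w by rewrite /W natrM natrX exprMn.
  apply: (@le_trans _ _ (V%:R ^+ r * q%:R * ((r ^ (r + r))%:R * (W * Q)) +
     V%:R ^+ r * q%:R * (((r + r) * 2 ^ r)%:R * CJ * (W * Q)))); last first.
    by rewrite -mulrDr -mulrDl -[K * W * Q]mulrA.
  apply: lerD.
    have WQ1 : 1 <= W * Q by apply: mulr_ege1.
    have c0 : 0 <= (r ^ (r + r))%:R * (V%:R ^+ r * q%:R) :> R.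
      by rewrite !mulr_ge0 ?exprn_ge0 ?ler0n.
    rewrite [(r ^ _ * _ * _)%:R]natrM [(r ^ _ * _)%:R]natrM [(V ^ r)%:R]natrX -mulrA.
    apply: le_trans (ler_peMr c0 WQ1) _; rewrite le_eqVlt; apply/orP; left; apply/eqP.
    by move: (V%:R ^+ r) ((r ^ (r + r))%:R : R) (q%:R : R) => x y z; ring.
  rewrite natrX natrM natrX WE.
  apply: (@le_trans _ _ ((r + r)%:R * ((r + r)%:R ^+ w * Num.sqrt q%:R *
     ((CJ * Q * Num.sqrt q%:R) * (2 ^+ r * (2 ^+ r) ^+ w * V%:R ^+ r))))).
    rewrite ler_wpM2l ?ler0n // ler_wpM2l ?mulr_ge0 ?exprn_ge0 ?sqrtr_ge0 ?ler0n //.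
    by rewrite ler_pM ?sqrtr_ge0.
  rewrite le_eqVlt; apply/orP; left; apply/eqP.
  rewrite -[in RHS](@sqr_sqrtr _ q%:R) ?ler0n //.
  by move: (Num.sqrt _) (((2 : R) ^+ r) ^+ w) ((2 : R) ^+ r) ((r + r)%:R ^+ w : R) => x y z t; ring.
apply: (@le_trans _ _ (CH ^+ 2 * K * (16 * A)%:R ^+ w * (Q ^+ 3))).
  rewrite natrM [(_ * A%:R) ^+ w]exprMn le_eqVlt; apply/orP; left; apply/eqP.
  by move: (16 ^+ w) (A%:R ^+ w) => x y; ring.
have Q4 : q%:R `^ eps = Q * Q ^+ 3.
  by rewrite -exprS /Q -powR_mulrn // -powRrM /e mulfVK // pnatr_eq0.
rewrite Q4 mulrA ler_wpM2r ?exprn_ge0 // -[leRHS]mulrA ler_wpM2l ?mulr_ge0 ?sqr_ge0 ?(le_trans ler01) //.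
by rewrite -natrX; apply: hCw.
Qed.

Lemma exists_root_floor (m q : nat) : (0 < m)%N -> (0 < q)%N ->
  exists V : nat, [/\ (0 < V)%N, (V ^ m <= q)%N & (q <= (2 * V) ^ m)%N].
Proof.
move=> m0 q0; have ex : exists V, (V ^ m <= q)%N by exists 1%N; rewrite exp1n.
have ub V : (V ^ m <= q)%N -> (V <= q)%N.
  apply: leq_trans; case: V => // V; by rewrite -{1}(expn1 V.+1) leq_pexp2l.
have [V Vq Vmax] := ex_maxnP ex ub.
have V0 : (0 < V)%N by apply: Vmax; rewrite exp1n.
exists V; split=> //; apply: ltnW.
apply: (@leq_trans (V.+1 ^ m)); first by rewrite ltnNge; apply/negP => /Vmax; rewrite ltnn.
by rewrite leq_exp2r // mul2n -addnn -add1n leq_add2r.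
Qed.

Lemma powR_exprVn (R : realType) (x : R) (n : nat) : 0 <= x -> (0 < n)%N ->
  (x ^+ n) `^ n%:R^-1 = x.
Proof.
move=> x0 n0; rewrite -powR_mulrn // -powRrM mulfV ?pnatr_eq0 -?lt0n //.
by rewrite powRr1.
Qed.

Theorem theorem1 (R : realType) (d rd r : nat) :
  (1 <= d)%N -> is_rd R d rd -> (rd <= r)%N ->
  forall eps : R, 0 < eps ->
  exists C : R,
  forall (q : nat) (chi : int -> R[i]),
    squarefree q -> primitive_character q chi ->
  forall (M : int) (N : nat),
    N%:R <= q%:R `^ (2^-1 + (4 * (r%:R - Dr R d / 2))^-1) ->
  forall F : {poly R}, size F = d.+1 ->
    ComplexField.Normc.normc (char_exp_sum chi F M N) <=
      C * q%:R `^ eps * N%:R `^ (1 - r%:R^-1) *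
      q%:R `^ ((4 * r%:R)^-1 + Dr R d / (8 * r%:R * (r%:R - Dr R d / 2))
               + (4 * r%:R * (r%:R - Dr R d / 2))^-1).
Proof.
move=> d1 hrd rdr eps eps0; have rD := vmvt_exponent_ge hrd rdr.
have [rd1 hv _] := hrd; have r0 : (0 < r)%N := leq_trans rd1 rdr.
have D0 : (0 < (d * d.+1)./2)%N by case: (d) d1 => // d' _; rewrite half_gt0; lia.
pose m := (2 * r - (d * d.+1)./2)%N.
have Dm : ((d * d.+1)./2 + m = 2 * r)%N.
  by rewrite subnKC // (leq_trans rD) // mul2n -addnn leq_addr.
have m0 : (0 < m)%N by rewrite subn_gt0 (leq_ltn_trans rD) // mul2n -addnn -{1}(addn0 r) ltn_add2l.
have DrE : Dr R d = 2 * r%:R - m%:R.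
  by rewrite Dr_half -natrM -Dm natrD addrK.
have rR : 0 < r%:R :> R by rewrite ltr0n.
have mR : 0 < m%:R :> R by rewrite ltr0n.
(* The factor [2r] in front of [eps] compensates the [2r]-th root taken at the end. *)
have [||C C0 hC] := @burgess_constants R r d m (2 * r%:R * eps) r0 m0.
- by rewrite !mulr_gt0.
- move=> e e0; have [C hC] := hv r r0 rdr e e0; exists C => V V0.
  by apply: le_trans (hC V V0) _; rewrite DrE natrM opprB addrCA subrr addr0.
have [K KE K0] : exists2 K : R,
    K = 4 ^+ r * (1152 * 2 ^+ m * ((4 ^ (r * d))%:R * (4 * r)%:R ^+ d)) & 0 <= K.
  by eexists; first reflexivity; rewrite !mulr_ge0 ?exprn_ge0 ?ler0n.
exists ((K * C) `^ (2 * r)%:R^-1) => q chi sf hprim M N hN F sF.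
have [hchi _] := hprim; have hnt := primitive_locally_nontrivial hprim.
have q0 : (0 < q)%N by case: sf.
have qR : 0 < q%:R :> R by rewrite ltr0n.
have [V [V0 Vq qV]] := exists_root_floor m0 q0.
have [H [E [H1 hH E1 hE HE]]] := hC q V chi sf hchi hnt V0 Vq.
have Vroot : V%:R <= q%:R `^ m%:R^-1 :> R.
  rewrite -[leLHS](@powR_exprVn _ _ m) ?ler0n // -natrX.
  by apply: ge0_ler_powR; rewrite ?nnegrE ?ler0n ?ler_nat // invr_ge0 ler0n.
have rootV : q%:R `^ m%:R^-1 <= (2 * V)%:R :> R.
  rewrite -[leRHS](@powR_exprVn _ _ m) ?ler0n // -natrX.
  by apply: ge0_ler_powR; rewrite ?nnegrE ?ler0n ?ler_nat // invr_ge0 ler0n.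
(* As [r - D/2 = m/2], the hypothesis reads [N^2 <= q^(1 + 1/m)], and [q^(1/m) <= 2 V]. *)
have NN : (N * N <= 2 * q * V)%N.
  rewrite -(ler_nat R) natrM; apply: (@le_trans _ _ (q%:R `^ (2^-1 + (4 * (r%:R - Dr R d / 2))^-1) ^+ 2)).
    by rewrite -expr2 lerXn2r ?nnegrE ?ler0n ?powR_ge0.
  rewrite -powR_mulrn ?powR_ge0 // -powRrM.
  have -> : (2^-1 + (4 * (r%:R - Dr R d / 2))^-1) * 2%:R = 1 + m%:R^-1 :> R.
    rewrite DrE; have -> : r%:R - (2 * r%:R - m%:R) / 2 = m%:R / 2 :> R by lra.
    by field; rewrite gt_eqF.
  rewrite powRD ?(gt_eqF qR) ?implybT // powRr1 ?ler0n //.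
  apply: le_trans (ler_wpM2l (ltW qR) rootV) _.
  by rewrite -natrM ler_nat mulnCA mulnA.
pose Y : R := 4 ^+ r * (V%:R ^+ r.+1 * (1152 * 2 ^+ m * ((4 ^ (r * d))%:R * (4 * r)%:R ^+ d) *
   (H ^+ 2 * 16 ^+ size (primes q) * E))).
have Y0 : 0 <= Y.
  by rewrite !mulr_ge0 ?exprn_ge0 ?ler0n // (le_trans ler01).
have rr0 : (0 < 2 * r)%N by rewrite muln_gt0.
have BY : (Y `^ (2 * r)%:R^-1) ^+ (2 * r) = Y.
  by rewrite -powR_mulrn ?powR_ge0 // -powRrM mulVf ?pnatr_eq0 -?lt0n // powRr1.
have sF' : (size F <= d.+1)%N by rewrite sF.
have := burgess_induction sf hchi sF' r0 V0 D0 Dm qV H1 hH E1 hE (powR_ge0 _ _) BY M NN.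
move=> h; apply: le_trans h _.
rewrite mulrAC ler_wpM2r ?powR_ge0 //.
(* Here [V^(r+1) <= q^((r+1)/m)]; its [2r]-th root has exactly the exponent of the theorem. *)
apply: (@le_trans _ _ ((K * C * q%:R `^ (2 * r%:R * eps) * q%:R `^ (r.+1%:R / m%:R)) `^ (2 * r)%:R^-1)).
  have n0 : 0 <= (2 * r)%:R^-1 :> R by rewrite invr_ge0 ler0n.
  apply: (ge0_ler_powR n0); rewrite ?nnegrE; first exact: Y0.
    by rewrite mulr_ge0 ?powR_ge0 // mulr_ge0 ?powR_ge0 // mulr_ge0.
  have -> : Y = K * (H ^+ 2 * 16 ^+ size (primes q) * E) * V%:R ^+ r.+1.
    rewrite /Y KE; move: (4 ^+ r) (2 ^+ m) (_%:R * _ ^+ d) (H ^+ 2 * _ * _) (V%:R ^+ _).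
    by move=> a b c e f; ring.
  rewrite -[K * C * _]mulrA; apply: ler_pM; rewrite ?exprn_ge0 ?ler0n //.
  - by rewrite !mulr_ge0 ?exprn_ge0 ?ler0n // (le_trans ler01).
  - exact: ler_wpM2l.
  by rewrite mulrC powRrM powR_mulrn ?powR_ge0 // lerXn2r ?nnegrE ?powR_ge0 ?ler0n.
have KC0 : 0 <= K * C by apply: mulr_ge0.
move: (K * C) KC0 => k k0.
rewrite (powRM _ (mulr_ge0 k0 (powR_ge0 _ _)) (powR_ge0 _ _)) (powRM _ k0 (powR_ge0 _ _)).
rewrite -[(_ `^ (2 * r%:R * eps)) `^ _]powRrM -[(_ `^ (r.+1%:R / m%:R)) `^ _]powRrM.
have -> : 2 * r%:R * eps / (2 * r)%:R = eps.
  by rewrite natrM mulrAC divff ?mul1r // mulf_neq0 ?pnatr_eq0 -?lt0n.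
rewrite le_eqVlt; apply/orP; left; apply/eqP; congr (_ * _ `^ _).
rewrite DrE natrM -natr1.
have -> : r%:R - (2 * r%:R - m%:R) / 2 = m%:R / 2 :> R by lra.
by move: (r%:R : R) (m%:R : R) rR mR => x y x0 y0; field; rewrite !gt_eqF.
Qed.
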